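(* With the labelling of simple roots, the order $0<1<\cdots<r-1$ on $I$, and the right-to-left lexicographic order on words described in the context: (1) The good Lyndon words for $\mathfrak g$ of type $A_r$ are $$\{[i,\dots,j]\mid 0\le i\le j<r\}.$$ (2) The good Lyndon words for $\mathfrak g$ of type $B_r$ are $$\{[i,\dots,j]\mid 0\le i\le j<r\}\cup\{[j,j-1,\dots,0,0,\dots,k-1,k]\mid 0\le j<k<r\}.$$ (3) The good Lyndon words for $\mathfrak g$ of type $C_r$ are $$\{[i,\dots,j]\mid 0\le i\le j<r\}\cup\{[j,\dots,1,0,1,\dots,k]\mid 1\le j<k\le r-1\}\cup\{[0,\dots,j,1,\dots,j]\mid 1\le j<r\}.$$ (4) The good Lyndon words for $\mathfrak g$ of type $D_r$ are $$\{[0]\}\cup\{[0,2,\dots,i]\mid 2\le i<r\}\cup\{[i,\dots,j]\mid 1\le i\le j\le r-1\}\cup\{[j,\dots,1,0,2,\dots,k]\mid 1\le j<k<r\}.$$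
   Context: $\mathfrak g$ is a simple Lie algebra of the given classical type with simple roots $\alpha_i$, $i\in I=\{0,1,\dots,r-1\}$, and $\mathfrak n$ is the subalgebra generated by the positive Chevalley generators. Labelling: types $A_r,B_r,C_r$: chain $0-1-\cdots-(r-1)$; in $B_r$ the double edge joins $0,1$ and $\alpha_0$ is the short simple root; in $C_r$ the double edge joins $0,1$ and $\alpha_0$ is the long simple root. $D_r$: nodes $0$ and $1$ are both joined to $2$, followed by the chain $2-3-\cdots-(r-1)$. $(\cdot,\cdot)$ is the invariant form normalized so that short roots have $(\alpha,\alpha)=2$ (all roots in simply laced types). $\mathcal F$ is the free associative $\mathbb Q(q)$-algebra on letters $[i]$, $i\in I$ (concatenation $\cdot$, words $[i_1,\dots,i_k]=[i_1]\cdots[i_k]$), graded by $|[i]|=\alpha_i$. The quantum shuffle product $*$ on $\mathcal F$ is the bilinear product with the empty word $[]$ as unit and, inductively, $(x\cdot[i])*(y\cdot[j])=(x*(y\cdot[j]))\cdot[i]+q^{-(|x|+\alpha_i,\alpha_j)}((x\cdot[i])*y)\cdot[j]$. $\mathcal W\subseteq(\mathcal F,* )$ is the subalgebra generated by the letters $[i]$; it is isomorphic to $U_q(\mathfrak n)$ via $e_i\mapsto[i]$. Order $I$ by $0<1<\cdots<r-1$ and order words lexicographically from right to left: $[i]<[]$ for all $i$, and $[i_1,\dots,i_k]<[j_1,\dots,j_\ell]$ if $i_k<j_\ell$, or for some $m$, $i_{k-m}<j_{\ell-m}$ and $i_{k-s}=j_{\ell-s}$ for all $s<m$ (so a word is smaller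 than its proper right factors). For homogeneous $f\in\mathcal F$, $\min(f)$ is the smallest word occurring in $f$. A word is good if it equals $\min(w)$ for some homogeneous $w\in\mathcal W$. A word is Lyndon if it is larger than each of its proper left factors. A good Lyndon word is a word that is both good and Lyndon. The notation $[i,\dots,j]$ with $i\le j$ means $[i,i+1,\dots,j]$; a descending segment such as $[j,\dots,1,0,\dots]$ descends by $1$ at each step. In type $D_r$, the word $[j,\dots,1,0,2,\dots,k]$ is $[j,j-1,\dots,2,1,0,2,3,\dots,k]$. *)

(* Defs.v *)
From mathcomp Require Import all_boot all_order all_algebra.
From mathcomp Require Import finmap.
From mathcomp.multinomials Require Import monalg.

Set Implicit Arguments.
Unset Strict Implicit.
Unset Printing Implicit Defensive.

Import GRing.Theory.
Local Open Scope ring_scope.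

Inductive classical_type := typeA | typeB | typeC | typeD.

Section RootDatum.
Variables (X : classical_type) (r : nat).

(* half_len i = (alpha_i, alpha_i) / 2, with short roots of squared length 2 *)
Definition half_len (i : 'I_r) : nat :=
  match X with
  | typeA | typeD => 1%N
  | typeB => if i == 0%N :> nat then 1%N else 2%N
  | typeC => if i == 0%N :> nat then 2%N else 1%N
  end.

(* i < j are joined in the Dynkin diagram *)
Definition joined_lt (i j : nat) : bool :=
  match X with
  | typeA | typeB | typeC => j == i.+1
  | typeD => ((i == 0%N) && (j == 2%N)) || ((0 < i)%N && (j == i.+1))
  end.

Definition joined (i j : 'I_r) : bool := joined_lt i j || joined_lt j i.

(* For joined nodes, 2 (alpha_i, alpha_j) / (beta, beta) = -1 where beta is
   the longer of the two roots. *)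
Definition gram : 'M[int]_r :=
  \matrix_(i, j)
    if i == j then (2 * half_len i)%N%:Z
    else if joined i j then - (maxn (half_len i) (half_len j))%:Z
    else 0.

(* The root lattice is 'rV[int]_r, in the basis of simple roots. *)
Definition form (a b : 'rV[int]_r) : int := (a *m gram *m b^T) 0 0.

End RootDatum.

Definition simple_root r (i : 'I_r) : 'rV[int]_r := delta_mx 0 i.

Notation word r := {fmonom 'I_r}.

(* The ring multiplication of [freealg K r] is concatenation. *)
Notation freealg K r := {malg K[word r]}.

Definition mkword r (s : seq 'I_r) : word r := FMonom s.

Definition letter (K : fieldType) r (i : 'I_r) : freealg K r :=
  << mkword [:: i] >>.
Arguments letter {K r} i.

Definition weight r (s : seq 'I_r) : 'rV[int]_r := \sum_(i <- s) simple_root i.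

Definition homogeneous (K : fieldType) r (b : 'rV[int]_r) (f : freealg K r) : Prop :=
  forall u : word r, u \in msupp f -> weight u = b.

(* The base field and the quantum parameter are kept abstract here; they are
   specialized to Q(q) and its indeterminate below. *)
Section QuantumShuffle.
Variables (K : fieldType) (q : K) (X : classical_type) (r : nat).

(* [shuffle_rev u v] is the quantum shuffle product of the words [rev u] and
   [rev v]: reversing turns the recursion on last letters into a recursion on
   first letters. *)
Fixpoint shuffle_rev (u : seq 'I_r) : seq 'I_r -> freealg K r :=
  match u with
  | [::] => fun v => << mkword (rev v) >>
  | i :: u' =>
    fix shuffle_rev_u (v : seq 'I_r) : freealg K r :=
      match v with
      | [::] => << mkword (rev u) >>
      | j :: v' =>
          shuffle_rev u' v * letter i
          + q ^ (- form X (weight u) (simple_root j))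
              *: (shuffle_rev_u v' * letter j)
      end
  end.

Definition qshuffle (x y : freealg K r) : freealg K r :=
  \sum_(u <- msupp x) \sum_(v <- msupp y)
    (x@_u * y@_v) *: shuffle_rev (rev u) (rev v).

(* The subalgebra of (F, * ) generated by the letters. *)
Inductive in_W : freealg K r -> Prop :=
  | in_W_letter i : in_W (letter i)
  | in_W_one : in_W 1
  | in_W_add x y : in_W x -> in_W y -> in_W (x + y)
  | in_W_scale (c : K) x : in_W x -> in_W (c *: x)
  | in_W_mul x y : in_W x -> in_W y -> in_W (qshuffle x y).

End QuantumShuffle.

Section WordOrder.
Variable r : nat.

(* Left-to-right lexicographic order in which the empty word is largest. *)
Fixpoint lex_lt (u v : seq 'I_r) : bool :=
  match u, v with
  | [::], _ => false
  | _ :: _, [::] => true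
  | i :: u', j :: v' => (i < j)%N || ((i == j) && lex_lt u' v')
  end.

Definition word_lt (u v : seq 'I_r) : bool := lex_lt (rev u) (rev v).

Definition is_min (K : fieldType) (f : freealg K r) (w : word r) : Prop :=
  w \in msupp f /\ forall u : word r, u \in msupp f -> u <> w -> word_lt w u.

(* Proper left factors are nonempty, and so are Lyndon words. *)
Definition lyndon (w : seq 'I_r) : Prop :=
  w <> [::] /\
  forall u v : seq 'I_r, u <> [::] -> v <> [::] -> w = u ++ v -> word_lt u w.

Definition good (K : fieldType) (q : K) (X : classical_type) (w : word r) :
    Prop :=
  exists (f : freealg K r) (b : 'rV[int]_r),
    [/\ in_W q X f, homogeneous b f & is_min f w].

Definition good_lyndon (K : fieldType) (q : K) (X : classical_type)
    (w : word r) : Prop :=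
  good q X w /\ lyndon w.

End WordOrder.

Definition ratfun : fieldType := {fraction {poly rat}}.
Definition qvar : ratfun := tofrac ('X : {poly rat}).

(* asc i j = [i, i+1, ..., j] and desc j i = [j, j-1, ..., i], for i <= j *)
Definition asc (i j : nat) : seq nat := iota i (j.+1 - i).
Definition desc (j i : nat) : seq nat := rev (asc i j).

Definition letters r (w : word r) : seq nat := [seq val i | i <- (w : seq 'I_r)].

(* [qshuffle] is the bilinear product determined on words by the unit [] and the
   recursion on last letters. *)
Section QuantumShuffleTheory.
Variables (K : fieldType) (q : K) (X : classical_type) (r : nat).
Local Notation F := (freealg K r).
Local Notation "x ** y" := (qshuffle q X x y) (at level 40, left associativity).

Lemma qshuffleEw (D1 D2 : {fset word r}) (x y : F) :
  (msupp x `<=` D1)%fset -> (msupp y `<=` D2)%fset ->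
  x ** y = \sum_(u <- D1) \sum_(v <- D2)
             (x@_u * y@_v) *: shuffle_rev q X (rev u) (rev v).
Proof.
move=> le1 le2; rewrite /qshuffle (big_fset_incl _ le1) /=; last first.
  move=> u _ /mcoeff_outdom ->; rewrite big1 // => v _.
  by rewrite mul0r scale0r.
apply: eq_bigr => u _; apply: (big_fset_incl _ le2) => v _ /mcoeff_outdom ->.
by rewrite mulr0 scale0r.
Qed.

Lemma qshuffle_linearl (y : F) (c : K) (x x' : F) :
  (c *: x + x') ** y = c *: (x ** y) + x' ** y.
Proof.
set D := (msupp (c *: x + x') `|` (msupp x `|` msupp x'))%fset.
rewrite !(@qshuffleEw D (msupp y)) ?fsubset_refl //; last first.
- by rewrite /D fsubsetUl.
- by rewrite /D fsubsetU // fsubsetUl orbT.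
- by rewrite /D fsubsetU // fsubsetUr orbT.
rewrite scaler_sumr -big_split; apply: eq_bigr => u _ /=.
rewrite scaler_sumr -big_split; apply: eq_bigr => v _ /=.
by rewrite mcoeffD mcoeffZ mulrDl scalerDl scalerA mulrA.
Qed.

Lemma qshuffle_linearr (x : F) (c : K) (y y' : F) :
  x ** (c *: y + y') = c *: (x ** y) + x ** y'.
Proof.
set D := (msupp (c *: y + y') `|` (msupp y `|` msupp y'))%fset.
rewrite !(@qshuffleEw (msupp x) D) ?fsubset_refl //; last first.
- by rewrite /D fsubsetUl.
- by rewrite /D fsubsetU // fsubsetUl orbT.
- by rewrite /D fsubsetU // fsubsetUr orbT.
rewrite scaler_sumr -big_split; apply: eq_bigr => u _ /=.
rewrite scaler_sumr -big_split; apply: eq_bigr => v _ /=.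
by rewrite mcoeffD mcoeffZ mulrDr scalerDl scalerA mulrCA.
Qed.

Lemma qshuffle0l (y : F) : 0 ** y = 0.
Proof. by rewrite /qshuffle msupp0 big_seq_fset0. Qed.

Lemma qshuffle0r (x : F) : x ** 0 = 0.
Proof. by rewrite /qshuffle msupp0 big1 // => u _; rewrite big_seq_fset0. Qed.

Lemma qshuffle_word (u v : word r) :
  << u >> ** << v >> = shuffle_rev q X (rev u) (rev v).
Proof.
rewrite (@qshuffleEw [fset u]%fset [fset v]%fset) ?msuppU_le //.
by rewrite !big_seq_fset1 !mcoeffUU mulr1 scale1r.
Qed.

Lemma qshuffle_word1l (v : word r) : 1 ** << v >> = << v >>.
Proof. by rewrite qshuffle_word fm1 /= revK; case: v. Qed.

Lemma qshuffle_word1r (u : word r) : << u >> ** 1 = << u >>.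
Proof.
rewrite qshuffle_word fm1; case: u => u /=.
by rewrite -[in RHS](revK u); case: (rev u).
Qed.

Lemma mul_word_letter (u : word r) (i : 'I_r) :
  << u >> * letter i = << mkword (rcons u i) >> :> F.
Proof.
rewrite malgM_def fgmulUU mulr1; congr << _ >>; apply/eqP.
by rewrite fmP fmM /= cats1.
Qed.

Lemma weight_rev (u : seq 'I_r) : weight (rev u) = weight u.
Proof. by rewrite /weight (perm_big u) // perm_rev. Qed.

Lemma weight_cons (i : 'I_r) (u : seq 'I_r) :
  weight (i :: u) = weight u + simple_root i.
Proof. by rewrite /weight big_cons addrC. Qed.

Lemma qshuffle_word_rcons (u v : word r) (i j : 'I_r) :
  (<< u >> * letter i) ** (<< v >> * letter j) =
    (<< u >> ** (<< v >> * letter j)) * letter i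
    + q ^ (- form X (weight u + simple_root i) (simple_root j))
        *: (((<< u >> * letter i) ** << v >>) * letter j).
Proof.
rewrite 2!mul_word_letter.
rewrite [LHS]qshuffle_word [in X in _ = X * _ + _]qshuffle_word.
rewrite [in X in _ = _ + _ *: (X * _)]qshuffle_word !rev_rcons /=.
by rewrite weight_cons weight_rev.
Qed.

End QuantumShuffleTheory.

(* Main.v *)
(** Removing a last letter [i] is a twisted derivation of the quantum shuffle
    product; these derivations satisfy the quantum Serre relations on [in_W].

    Upper bound: let [w] be the smallest word of [f] in [in_W], cut after each
    occurrence of its last letter [k], which is its largest letter when [w] is
    Lyndon.  The derivations for letters below [k], applied to a lowest vector,
    follow the weights of the vector representation, so that each block of [w]
    is one of the few words [pathp].  Iterated q-commutators of the derivations
    q-commute, so a block is never followed by a larger one, and Lyndon words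
    have a single block; the q-commutation fails for one pair of blocks in type
    C, which gives the words [0,...,k,1,...,k].

    Lower bound: the q-commutator with a letter [j] inserts [j] into a word.
    With a suitable power of [q] all insertions but one cancel.  In type D two
    words survive, and for [0,...,k,1,...,k] an element with many words is
    obtained whose smallest word is controlled. *)
Require Import Defs.
From mathcomp Require Import all_boot all_order all_algebra.
From mathcomp Require Import finmap zify ring.
From mathcomp.multinomials Require Import monalg.

Set Implicit Arguments.
Unset Strict Implicit.
Unset Printing Implicit Defensive.
Import Order.TTheory GRing.Theory Num.Theory.
Local Open Scope ring_scope.

(** The operators [dw y (d k m)] on lowest vectors and the iterated q-commutators [E y] obey the
    same formal relations, so the vanishing of words off the paths is proved once, for a
    [serre_family]. If [low b f], the correction terms of the q-commutators vanish and [E a (E b f)]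
    is [dw a (d k (dw b (d k f)))]; when [a] and [b] q-commute this is a multiple of [E b (E a f)],
    which is zero if [a] is smaller than [b]. For the pair [x = up k 0], [y = up k 1] of type C, the
    relation contains the commutator of two further blocks. On lowest vectors it still excludes the
    block sequences [x y y] and [x x y], so the blocks alternate and the Lyndon condition leaves
    [x y] alone. In the converse, [j] is inserted after a prefix [u] with coefficient
    [q^(-n) - c q^n], where [n] is the pairing of the weight of [u] with [j]. The choice [c = 1]
    suppresses [n = 0]; the choice [c = q^m], with [m] the squared length of [j], suppresses
    [n = -m/2] and makes the coefficients at [n = 0] and [n = -m] opposite, so that they cancel
    around a letter [j] already present. *)

Inductive lincomb (K : Type) :=
  | LVar of nat
  | LZero
  | LAdd of lincomb K & lincomb K
  | LOpp of lincomb K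
  | LScale of K & lincomb K.
Arguments LVar {K}.
Arguments LZero {K}.

Section LinComb.
Variables (K : pzRingType) (M : lmodType K).

Fixpoint lc_eval (env : seq M) (e : lincomb K) : M :=
  match e with
  | LVar n => nth 0 env n
  | LZero => 0
  | LAdd a b => lc_eval env a + lc_eval env b
  | LOpp a => - lc_eval env a
  | LScale c a => c *: lc_eval env a
  end.

Fixpoint lc_coef (e : lincomb K) (n : nat) : K :=
  match e with
  | LVar m => if m == n then 1 else 0
  | LZero => 0
  | LAdd a b => lc_coef a n + lc_coef b n
  | LOpp a => - lc_coef a n
  | LScale c a => c * lc_coef a n
  end.

Fixpoint lc_eq (a b : lincomb K) (n : nat) : Prop :=
  if n is n'.+1 then lc_coef a n' = lc_coef b n' /\ lc_eq a b n' else True.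

Lemma lc_evalE (env : seq M) (e : lincomb K) :
  lc_eval env e = \sum_(n < size env) lc_coef e n *: nth 0 env n.
Proof.
elim: e => [m||a IHa b IHb|a IHa|c a IHa] /=.
- have [lt_m|le_m] := ltnP m (size env); last first.
    rewrite nth_default // big1 // => i _.
    by rewrite gtn_eqF ?scale0r // (leq_trans _ le_m).
  rewrite (bigD1 (Ordinal lt_m)) //= eqxx scale1r big1 ?addr0 // => i ne.
  by rewrite eq_sym (_ : _ == _ = false) ?scale0r //; apply: contraNF ne => /eqP;
    rewrite -val_eqE /= => ->.
- by rewrite big1 // => i _; rewrite scale0r.
- by rewrite IHa IHb -big_split; apply: eq_bigr => i _ /=; rewrite scalerDl.
- by rewrite IHa -sumrN; apply: eq_bigr => i _; rewrite scaleNr.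
- by rewrite IHa scaler_sumr; apply: eq_bigr => i _; rewrite scalerA.
Qed.

(** The condition is sufficient only: the atoms in [env] are treated as if they were independent. *)
Lemma lc_eq_eval (env : seq M) (a b : lincomb K) :
  lc_eq a b (size env) -> lc_eval env a = lc_eval env b.
Proof.
have ltE n : lc_eq a b n -> forall i, (i < n)%N -> lc_coef a i = lc_coef b i.
  elim: n => // n IHn /= [eq_n /IHn eq_lt] i.
  by rewrite ltnS leq_eqVlt => /predU1P[->|/eq_lt].
by move=> /ltE eq_ab; rewrite !lc_evalE; apply: eq_bigr => i _; rewrite eq_ab.
Qed.

End LinComb.

Ltac lc_mem x l :=
  match l with
  | nil => constr:(false)
  | cons x _ => constr:(true)
  | cons _ ?l' => lc_mem x l'
  end.
Ltac lc_index x l :=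
  match l with
  | cons x _ => constr:(0%N)
  | cons _ ?l' => let n := lc_index x l' in constr:(S n)
  end.
Ltac lc_atoms l t :=
  match t with
  | GRing.add ?a ?b => let l1 := lc_atoms l a in lc_atoms l1 b
  | GRing.opp ?a => lc_atoms l a
  | GRing.scale _ ?a => lc_atoms l a
  | GRing.zero => l
  | _ => match lc_mem t l with true => l | false => constr:(cons t l) end
  end.
Ltac lc_reify K l t :=
  match t with
  | GRing.add ?a ?b =>
      let x := lc_reify K l a in let y := lc_reify K l b in constr:(@LAdd K x y)
  | GRing.opp ?a => let x := lc_reify K l a in constr:(@LOpp K x)
  | GRing.scale ?c ?a => let x := lc_reify K l a in constr:(@LScale K c x)
  | GRing.zero => constr:(@LZero K)
  | _ => let n := lc_index t l in constr:(@LVar K n)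
  end.
(* Reduces an equality of linear combinations over the module [M] to
   equalities of scalars. *)
Ltac lincomb M :=
  match type of M with
  | GRing.Lmodule.type ?R =>
  match goal with
  | |- @eq _ ?a ?b =>
      let l0 := constr:(@nil (GRing.Lmodule.sort M)) in
      let l1 := lc_atoms l0 a in
      let l := lc_atoms l1 b in
      let ea := lc_reify R l a in
      let eb := lc_reify R l b in
      apply: (@lc_eq_eval _ M l ea eb); rewrite /=; repeat split
  end end.

(** * Path words *)

Definition hlen (X : classical_type) (i : nat) : nat :=
  match X with
  | typeA | typeD => 1%N
  | typeB => if i == 0%N then 1%N else 2%N
  | typeC => if i == 0%N then 2%N else 1%N
  end.

Definition gr (X : classical_type) (i j : nat) : int :=
  if i == j then (2 * hlen X i)%N%:Z
  else if joined_lt X i j || joined_lt X j i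
       then - (maxn (hlen X i) (hlen X j))%:Z else 0.

Lemma gr_sym (X : classical_type) (i j : nat) : gr X i j = gr X j i.
Proof. by rewrite /gr eq_sym orbC maxnC; case: eqVneq => // ->. Qed.

(** [com], [cub] and [qua] are the Cartan integers $a_{ij}=0,-1,-2$; the last occurs only for a
    short $\alpha_i$ at a double bond. *)
Definition com X i j := gr X i j == 0.
Definition cub X i j := (i != j) && (gr X i i == - (gr X i j *+ 2)).
Definition qua X i j := (i != j) && (gr X i i == 2) && (gr X i j == -2).

(** The index word omits a base letter [k], which acts first; the last three fields are the Serre
    relations in which [k] occurs once. [sf_eq] asks for [perm_eq] because the twist of a
    q-commutator depends on the weight of the word. *)
Record serre_family (K : fieldType) (q : K) (X : classical_type) (k : nat)
  (M : lmodType K) (Q : M -> Prop) (V : seq nat -> M -> M) : Prop := {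
  sf_zero : forall i y, (i < k)%N -> (forall m, Q m -> V y m = 0) ->
    forall m, Q m -> V (i :: y) m = 0;
  sf_eq : forall i y y', perm_eq y y' -> (forall m, Q m -> V y m = V y' m) ->
    forall m, Q m -> V (i :: y) m = V (i :: y') m;
  sf_com : forall i j y m, (i < k)%N -> (j < k)%N -> com X i j -> Q m ->
    V [:: i, j & y] m = V [:: j, i & y] m;
  sf_cub : forall i j y m, (i < k)%N -> (j < k)%N -> cub X i j -> Q m ->
    V [:: i, i, j & y] m - (q ^ gr X i j + (q ^ gr X i j)^-1) *: V [:: i, j, i & y] m
    + V [:: j, i, i & y] m = 0;
  sf_qua : forall i j y m, (i < k)%N -> (j < k)%N -> qua X i j -> Q m ->
    V [:: i, i, i, j & y] m
    - (q ^+ 2 + 1 + q ^- 2) *: V [:: i, i, j, i & y] m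
    + (q ^+ 2 + 1 + q ^- 2) *: V [:: i, j, i, i & y] m
    - V [:: j, i, i, i & y] m = 0;
  sf_com1 : forall i m, (i < k)%N -> com X i k -> Q m -> V [:: i] m = 0;
  sf_cub1 : forall i m, (i < k)%N -> cub X i k -> Q m -> V [:: i; i] m = 0;
  sf_qua1 : forall i m, (i < k)%N -> qua X i k -> Q m -> V [:: i; i; i] m = 0
}.

Ltac gram :=
  rewrite /com /cub /qua /gr /hlen /joined_lt /=;
  repeat (case: ifP => /= ?); lia.

Definition up (k j : nat) : seq nat := iota j (k - j).
Definition climb (lo n : nat) (w : seq nat) : seq nat := rev (iota lo n) ++ w.

Lemma upS k j : (j < k)%N -> up k j = j :: up k j.+1.
Proof. by move=> lt_jk; rewrite /up (_ : k - j = (k - j.+1).+1)%N //; lia. Qed.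

Lemma up_nil k j : (k <= j)%N -> up k j = [::].
Proof. by rewrite /up -subn_eq0 => /eqP->. Qed.

Lemma climbS lo n w : climb lo n.+1 w = (lo + n)%N :: climb lo n w.
Proof. by rewrite /climb -addn1 iotaD rev_cat. Qed.

Lemma climb0 lo w : climb lo 0 w = w.
Proof. by []. Qed.

(* The words that lead from [k] along weights of the vector representation,
   read from right to left. *)
Definition pathp (X : classical_type) (k : nat) (w : seq nat) : Prop :=
  match X with
  | typeA => exists2 j, (j <= k)%N & w = up k j
  | typeB => (exists2 j, (j <= k)%N & w = up k j) \/
             (exists2 m, (0 < m <= k)%N & w = climb 0 m (up k 0))
  | typeC => (exists2 j, (j <= k)%N & w = up k j) \/
             (exists2 m, (0 < m < k)%N & w = climb 1 m (up k 0))
  | typeD => [\/ w = [::], exists2 j, (0 < j <= k)%N & w = up k j,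
                 (2 <= k)%N /\ w = 0%N :: up k 2
               | exists2 m, (m.+1 < k)%N & w = climb 2 m [:: 1%N, 0%N & up k 2]]
  end.

(* The exceptions are the edges at the double bond that path words do follow. *)
Definition chain_gap (T : classical_type) (i j : nat) : bool :=
  match T with
  | typeB => (0 < i)%N || (0 < j)%N
  | typeC => (i != 1%N) || (0 < j)%N
  | typeD => (0 < i)%N && (0 < j)%N
  | typeA => true
  end.

Section PathLemma.
Variables (K : fieldType) (q : K) (X : classical_type) (k : nat).
Variables (M : lmodType K) (Q : M -> Prop) (V : seq nat -> M -> M).
Hypothesis q_neq0 : q != 0.
Hypothesis q_not_root1 : forall n, q ^+ n.+1 != 1.
Hypothesis serreV : serre_family q X k Q V.

Definition nul (y : seq nat) := forall m, Q m -> V y m = 0.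

(** A zero of $x+x^{-1}$ is a fourth root of unity. *)
Lemma quantum2_neq0 n : (0 < n)%N -> q ^ n%:Z + (q ^ n%:Z)^-1 != 0.
Proof.
move=> n_gt0; have x0 : q ^ n%:Z != 0 by apply: expfz_neq0.
apply: contra (q_not_root1 (n * 4).-1) => /eqP H.
rewrite prednK ?muln_gt0 ?n_gt0 // exprM -[q ^+ n]/(q ^ n%:Z).
move: (q ^ n%:Z) x0 H => x x0 H; apply/eqP.
have -> : x ^+ 4 = 1 + (x ^+ 3 - x) * (x + x^-1) by field.
by rewrite H mulr0 addr0.
Qed.

Lemma quantum3_neq0 : q ^+ 2 + 1 + q ^- 2 != 0.
Proof.
apply: contra (q_not_root1 5) => /eqP H; apply/eqP.
have -> : q ^+ 6 = 1 + (q ^+ 4 - q ^+ 2) * (q ^+ 2 + 1 + q ^- 2) by field.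
by rewrite H mulr0 addr0.
Qed.

Lemma cub_neq0 i j : cub X i j -> q ^ gr X i j + (q ^ gr X i j)^-1 != 0.
Proof.
have hlen_gt0 n : (0 < hlen X n)%N by case: X => //=; case: ifP.
case/andP => /negPf ne_ij; rewrite /gr eqxx ne_ij; case: ifP => _.
  by move=> _; rewrite -invr_expz invrK addrC quantum2_neq0 // leq_max hlen_gt0.
by rewrite mul0rn oppr0 eqz_nat muln_eq0 /= gtn_eqF.
Qed.

Lemma nul_com i j y : (i < k)%N -> (j < k)%N -> com X i j ->
  nul (i :: y) -> nul [:: i, j & y].
Proof.
move=> lti ltj cij niy m Qm; rewrite (sf_com serreV) //.
exact: (sf_zero serreV ltj niy).
Qed.

(** The Serre relation has the orders [iij], [iji], [jii]. If two of its terms vanish, so does the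
    third, since the coefficient of the middle one is a nonzero quantum integer. *)
Lemma nul_top i j y : (i < k)%N -> (j < k)%N -> cub X i j ->
  nul (i :: y) -> nul [:: i, i, j & y].
Proof.
move=> lti ltj cij niy m Qm; have := sf_cub serreV y lti ltj cij Qm.
rewrite (sf_zero serreV lti (sf_zero serreV ltj niy)) //.
by rewrite (sf_zero serreV ltj (sf_zero serreV lti niy)) // scaler0 subr0 addr0.
Qed.

Lemma nul_mid i j y : (i < k)%N -> (j < k)%N -> cub X i j ->
  nul (j :: y) -> nul [:: i, i & y] -> nul [:: i, j, i & y].
Proof.
move=> lti ltj cij njy niiy m Qm; have := sf_cub serreV y lti ltj cij Qm.
rewrite (sf_zero serreV lti (sf_zero serreV lti njy)) //.
rewrite (sf_zero serreV ltj niiy) // add0r addr0 => /eqP.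
by rewrite oppr_eq0 scaler_eq0 (negPf (cub_neq0 cij)) => /eqP.
Qed.

Lemma nul_qua_top i j y : (i < k)%N -> (j < k)%N -> qua X i j ->
  nul (i :: y) -> nul [:: i, i, i, j & y].
Proof.
move=> lti ltj qij niy m Qm; have := sf_qua serreV y lti ltj qij Qm.
rewrite (sf_zero serreV lti (sf_zero serreV lti (sf_zero serreV ltj niy))) //.
rewrite (sf_zero serreV lti (sf_zero serreV ltj (sf_zero serreV lti niy))) //.
rewrite (sf_zero serreV ltj (sf_zero serreV lti (sf_zero serreV lti niy))) //.
by rewrite !scaler0 !subr0 addr0.
Qed.

Lemma nul_qua_mid i j y : (i < k)%N -> (j < k)%N -> qua X i j ->
  nul (j :: y) -> nul [:: i, i & y] -> nul [:: i, i, j, i & y].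
Proof.
move=> lti ltj qij njy niiy m Qm; have := sf_qua serreV y lti ltj qij Qm.
rewrite (sf_zero serreV lti (sf_zero serreV lti (sf_zero serreV lti njy))) //.
rewrite (sf_zero serreV lti (sf_zero serreV ltj niiy)) //.
rewrite (sf_zero serreV ltj (sf_zero serreV lti niiy)) //.
rewrite scaler0 sub0r subr0 addr0 => /eqP.
by rewrite oppr_eq0 scaler_eq0 (negPf quantum3_neq0) => /eqP.
Qed.

Lemma nul_qua_low i j y : (i < k)%N -> (j < k)%N -> qua X i j ->
  nul (j :: y) -> nul [:: j, i & y] -> nul [:: i, i, i & y] ->
  nul [:: i, j, i, i & y].
Proof.
move=> lti ltj qij njy njiy niiiy m Qm; have := sf_qua serreV y lti ltj qij Qm.
rewrite (sf_zero serreV lti (sf_zero serreV lti (sf_zero serreV lti njy))) //.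
rewrite (sf_zero serreV lti (sf_zero serreV lti njiy)) //.
rewrite (sf_zero serreV ltj niiiy) //.
rewrite scaler0 !subr0 add0r => /eqP.
by rewrite scaler_eq0 (negPf quantum3_neq0) => /eqP.
Qed.

(** Only the letter before [j] continues a chain that has come down to [j]. A letter equal to [j] or
    [j.+1] repeats a letter at the front and falls to a Serre relation; any other one commutes past
    [j] into a shorter chain. *)
Lemma nul_up i j : (i < k)%N -> (j <= k)%N -> i.+1 <> j ->
  chain_gap X i j -> nul (i :: up k j).
Proof.
have [n] := ubnP (k - j)%N; elim: n i j => // n IHn i j.
rewrite ltnS => le_n lti le_jk ne_ij gap_ij.
move: (le_jk); rewrite leq_eqVlt => /predU1P[eq_jk|lt_jk].
  rewrite up_nil ?eq_jk //; move=> m; apply: (sf_com1 serreV) => //.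
  by case: X gap_ij => /= gap_ij; gram.
rewrite (upS lt_jk).
have [eq_ij|ne] := eqVneq i j.
  rewrite {}eq_ij {i lti} in ne_ij gap_ij *.
  have [eq_k|lt_k] := eqVneq j.+1 k.
    rewrite up_nil ?eq_k //; move=> m; apply: (sf_cub1 serreV) => //.
    by case: X gap_ij => /= gap_ij; gram.
  rewrite upS; last by lia.
  apply: nul_top; [by []|by lia| |by apply: IHn; [lia|lia|lia|lia|case: X gap_ij => /=; lia]].
  by case: X gap_ij => /= gap_ij; gram.
have [eq_ij|ne'] := eqVneq i j.+1.
  rewrite {}eq_ij {i ne ne_ij} in gap_ij lti *.
  rewrite (upS lti); apply: nul_mid => //; last 2 first.
  - by apply: IHn; [lia|lia|lia|lia|case: X gap_ij => /=; lia].
  - by rewrite -upS //; apply: IHn; [lia|lia|lia|lia|case: X gap_ij => /=; lia].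
  by case: X gap_ij => /= gap_ij; gram.
apply: nul_com => //; last by apply: IHn; [lia|lia|lia|lia|case: X gap_ij => /=; lia].
by case: X gap_ij => /= gap_ij; gram.
Qed.

(** Two earlier stages are assumed because [i] may be either of the last two letters climbed, and
    the Serre relation then reaches back below both. *)
Lemma nul_climb_up lo m i w : (i < k)%N -> (lo + m.+1 < k)%N ->
  (X = typeC -> (0 < lo + m)%N) -> (X = typeD -> (1 < lo + m)%N) ->
  (X = typeB -> (0 < lo + m)%N) ->
  (forall j, (j < k)%N -> j <> (lo + m)%N -> nul (j :: climb lo m w)) ->
  (forall j, (j < k)%N -> j <> (lo + m.+1)%N -> nul (j :: climb lo m.+1 w)) ->
  i <> (lo + m.+2)%N -> nul (i :: climb lo m.+2 w).
Proof.
rewrite !addnS => lti ltm XC XD XB nm nm1 ne_i; rewrite !climbS addnS.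
have [->|ne] := eqVneq i (lo + m).+1.
  apply: nul_top; [lia|lia| |apply: nm; lia].
  by case: X XC XD XB => /= XC XD XB; try have {}XC := XC erefl; try have {}XD := XD erefl;
    try have {}XB := XB erefl; gram.
have [->|ne'] := eqVneq i (lo + m)%N.
  apply: nul_mid; [lia|lia| |apply: nm; lia|].
  by case: X XC XD XB => /= XC XD XB; try have {}XC := XC erefl; try have {}XD := XD erefl;
    try have {}XB := XB erefl; gram.
  by rewrite -climbS; apply: nm1; lia.
apply: nul_com => //; last by rewrite -climbS; apply: nm1; lia.
by case: X XC XD XB => /= XC XD XB; try have {}XC := XC erefl; try have {}XD := XD erefl;
  try have {}XB := XB erefl; gram.
Qed.

Lemma nul_climbB m i : X = typeB -> (i < k)%N -> (0 < m <= k)%N -> i <> m ->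
  nul (i :: climb 0 m (up k 0)).
Proof.
move=> XB; elim/ltn_ind: m i => m IHm i lti /andP[m_gt0 le_mk] ne_im.
have nulup a b : (a < k)%N -> (b <= k)%N -> a.+1 <> b -> (0 < a + b)%N -> nul (a :: up k b).
  by move=> *; apply: nul_up => //; rewrite XB /=; lia.
have k_gt0 : (0 < k)%N by lia.
have nul000 : nul [:: 0%N, 0%N, 0%N & up k 1].
  have [eq_k1|k_gt1] := leqP k 1.
    rewrite up_nil // => x; apply: (sf_qua1 serreV) => //; rewrite XB.
    by have ->: k = 1%N by lia.
  rewrite upS //; apply: nul_qua_top => //; first by rewrite XB.
  by apply: nulup; lia.
case: m m_gt0 le_mk ne_im IHm => // -[|[|m]] _ le_mk ne_im IHm.
- rewrite climbS climb0 upS //.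
  have [->//|i_neq0] := eqVneq i 0%N.
  apply: nul_com => //; first by rewrite XB; gram.
  by rewrite -upS //; apply: nulup; lia.
- have nul1 : forall j, (j < k)%N -> j <> 1%N -> nul (j :: climb 0 1 (up k 0)).
    by move=> j ltj ne_j; apply: IHm; lia.
  rewrite !climbS climb0 (upS k_gt0).
  have [->|ne1] := eqVneq i 1%N.
    apply: nul_top; [lia|lia|by rewrite XB|].
    by rewrite -upS //; apply: nulup; lia.
  have [->|ne0] := eqVneq i 0%N.
    apply: nul_qua_low => //; first by rewrite XB.
      by apply: nulup; lia.
    by rewrite -upS //; apply: nulup; lia.
  apply: nul_com => //; first by rewrite XB; gram.
  by rewrite -upS //; move: (nul1 i lti); rewrite climbS climb0; apply; lia.
- apply: nul_climb_up; rewrite ?XB //.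
  + by move=> j ltj ne_j; apply: IHm; lia.
  + by move=> j ltj ne_j; apply: IHm; lia.
Qed.

Lemma nul_climbC m i : X = typeC -> (i < k)%N -> (0 < m < k)%N -> i <> m.+1 ->
  nul (i :: climb 1 m (up k 0)).
Proof.
move=> XC; elim/ltn_ind: m i => m IHm i lti /andP[m_gt0 lt_mk] ne_im.
have nulup a b : (a < k)%N -> (b <= k)%N -> a.+1 <> b -> (a <> 1%N) \/ (0 < b)%N ->
    nul (a :: up k b).
  by move=> *; apply: nul_up => //; rewrite XC /=; lia.
have k_gt0 : (0 < k)%N by lia.
have k_gt1 : (1 < k)%N by lia.
case: m m_gt0 lt_mk ne_im IHm => // -[|[|m]] _ lt_mk ne_im IHm.
- rewrite climbS climb0 (upS k_gt0).
  have [->|ne1] := eqVneq i 1%N.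
    (* The word is [1, 1, 0, 1] followed by [up k 2], the second term of the quartic relation. *)
    rewrite (upS k_gt1); apply: nul_qua_mid => //; first by rewrite XC.
      by apply: nulup; lia.
    by rewrite -(upS k_gt1); apply: nulup; lia.
  have [->|ne0] := eqVneq i 0%N.
    apply: nul_mid => //; first by rewrite XC.
      by apply: nulup; lia.
    by rewrite -(upS k_gt0); apply: nulup; lia.
  apply: nul_com => //; first by rewrite XC; gram.
  by rewrite -(upS k_gt0); apply: nulup; lia.
- have nul1 : forall j, (j < k)%N -> j <> 2%N -> nul (j :: climb 1 1 (up k 0)).
    by move=> j ltj ne_j; apply: IHm; lia.
  apply: nul_climb_up; rewrite ?XC //.
  by move=> j ltj ne_j; rewrite climb0; apply: nulup; lia.
- apply: nul_climb_up; rewrite ?XC //.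
  + by move=> j ltj ne_j; apply: IHm; lia.
  + by move=> j ltj ne_j; apply: IHm; lia.
Qed.

(** * Type D: words through the fork *)

Section TypeD.
Hypothesis XD : X = typeD.
Ltac side := try by [lia|rewrite XD; gram].

Lemma nul_up0D j : (2 < j <= k)%N -> nul (0%N :: up k j).
Proof.
have [n] := ubnP (k - j)%N; elim: n j => // n IHn j.
rewrite ltnS => le_n /andP[lt_2j].
rewrite leq_eqVlt => /predU1P[eq_jk|lt_jk].
  rewrite up_nil ?eq_jk // => m; apply: (sf_com1 serreV) => //; first by lia.
  by rewrite XD; gram.
rewrite upS //; apply: nul_com => //; [by lia|by rewrite XD; gram|].
by apply: IHn; lia.
Qed.

Let nulup a b : (0 < a < k)%N -> (0 < b <= k)%N -> a.+1 <> b ->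
  nul (a :: up k b).
Proof. by move=> *; apply: nul_up => //; rewrite ?XD /=; lia. Qed.

Lemma nul_fork0 i : (2 <= k)%N -> (i < k)%N -> i <> 1%N ->
  nul [:: i, 0%N & up k 2].
Proof.
move=> k_ge2 lti ne1; have [->|ne0] := eqVneq i 0%N.
  have [eq_k|k_gt2] := leqP k 2.
    rewrite up_nil // => m; apply: (sf_cub1 serreV); first by lia.
    by rewrite XD; have ->: k = 2%N by lia.
  rewrite upS //; apply: nul_top; side.
  by apply: nul_up0D; lia.
have [->|ne2] := eqVneq i 2%N.
  rewrite upS; last by lia.
  apply: nul_mid; [lia|lia|by rewrite XD|by apply: nul_up0D; lia|].
  by rewrite -upS; [apply: nulup|]; lia.
apply: nul_com; side.
by apply: nulup; lia.
Qed.

Lemma nul_eq y y' : (forall m, Q m -> V y m = V y' m) -> nul y' -> nul y.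
Proof. by move=> yy' ny' m Qm; rewrite yy' // ny'. Qed.

Lemma fork_swap : (2 <= k)%N ->
  forall m, Q m -> V [:: 1%N, 0%N & up k 2] m = V (0%N :: up k 1) m.
Proof.
move=> k_ge2 m Qm; rewrite (upS (j := 1)) //.
by apply: (sf_com serreV) => //; [lia|rewrite XD].
Qed.

Lemma nul_fork i : (2 <= k)%N -> (i < k)%N -> i <> 2%N ->
  nul [:: i, 1%N, 0%N & up k 2].
Proof.
move=> k_ge2 lti ne2.
have [->|ne1] := eqVneq i 1%N.
  (* Exchanging the inner pair brings the repeated letter 1 next to [up k 1] after one commutation
     with 0. *)
  apply: (nul_eq (y' := [:: 1%N, 0%N & up k 1])).
    apply: (sf_eq serreV) => //; last exact: fork_swap.
    by rewrite [in X in perm_eq _ X]upS //; apply/permP => a /=; lia.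
  apply: nul_com; side.
  by apply: nulup; lia.
have [->|ne0] := eqVneq i 0%N.
  apply: nul_com; side.
  by apply: nul_fork0 => //; lia.
apply: nul_com; side.
by apply: nul_fork0 => //; lia.
Qed.

Lemma nul_climbD m i : (m.+1 < k)%N -> (i < k)%N -> i <> m.+2 ->
  nul (i :: climb 2 m [:: 1%N, 0%N & up k 2]).
Proof.
have [n] := ubnP m; elim: n m i => // n IHn m i.
rewrite ltnS => le_m ltm lti ne_i.
case: m le_m ltm ne_i => [|[|m]] le_m ltm ne_i.
- by rewrite climb0; apply: nul_fork.
- rewrite climbS climb0 addn0.
  have [->|ne2] := eqVneq i 2%N.
    apply: nul_top; side.
    by apply: nul_fork0; lia.
  have [->|ne1] := eqVneq i 1%N.
    apply: nul_mid; [lia|lia|by rewrite XD|by apply: nul_fork0; lia|].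
    by apply: nul_fork; lia.
  have [->|ne0] := eqVneq i 0%N.
    (* With the inner pair written as [0, 1] the word is the middle term of the Serre relation of 0
       and 2 on [up k 1]. *)
    apply: (nul_eq (y' := [:: 0%N, 2%N, 0%N & up k 1])).
      have up1 : up k 1 = 1%N :: up k 2 by rewrite upS //; lia.
      have swap1 : perm_eq [:: 1%N, 0%N & up k 2] (0%N :: up k 1).
        by rewrite up1; apply/permP => a /=; lia.
      apply: (sf_eq serreV); first by rewrite perm_cons.
      by apply: (sf_eq serreV) => //; apply: fork_swap; lia.
    apply: nul_mid; [lia|lia|by rewrite XD|by apply: nulup; lia|].
    apply: (nul_eq (y' := [:: 0%N, 1%N, 0%N & up k 2])); last by apply: nul_fork; lia.
    have up1 : up k 1 = 1%N :: up k 2 by rewrite upS //; lia.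
    apply: (sf_eq serreV); first by rewrite up1; apply/permP => a /=; lia.
    by move=> x Qx; rewrite fork_swap //; lia.
  apply: nul_com; side.
  by apply: nul_fork; lia.
- apply: nul_climb_up; rewrite ?XD //.
  + by move=> j ltj ne_j; apply: IHn; lia.
  + by move=> j ltj ne_j; apply: IHn; lia.
Qed.

Lemma perm_climb n y y' : perm_eq y y' -> perm_eq (climb 2 n y) (climb 2 n y').
Proof. by rewrite /climb perm_cat2l. Qed.

Lemma climb_swap n : (2 <= k)%N -> forall m, Q m ->
  V (climb 2 n [:: 1%N, 0%N & up k 2]) m = V (climb 2 n (0%N :: up k 1)) m.
Proof.
move=> k_ge2; elim: n => [|n IHn]; first exact: fork_swap.
rewrite !climbS; apply: (sf_eq serreV) => //; apply: perm_climb.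
by rewrite (upS (j := 1)) //; apply/permP => a /=; lia.
Qed.

End TypeD.

(** A letter either continues the walk along the weights or kills. The third case arises only when 0
    is put in front of [up k 1]: this reaches the weight that [1, 0] already reaches, by a word not
    listed in [pathp]. *)
Lemma pathp_cons i w : (i < k)%N -> pathp X k w ->
  [\/ nul (i :: w), pathp X k (i :: w) |
      X = typeD /\ exists2 n, (n.+1 < k)%N & i :: w = climb 2 n (0%N :: up k 1)].
Proof.
move=> lti pw.
have up_or j : (j <= k)%N -> chain_gap X i j ->
    nul (i :: up k j) \/ i.+1 = j /\ i :: up k j = up k i.
  move=> le_jk gap_ij; have [<-|/eqP ne_ij] := eqVneq i.+1 j.
    by right; split=> //; rewrite [RHS]upS.
  by left; apply: nul_up.
have [XE|XE|XE|XE] : [\/ X = typeA, X = typeB, X = typeC | X = typeD].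
  by case: X; [constructor 1|constructor 2|constructor 3|constructor 4].
- move: pw up_or; rewrite XE /= => pw up_or; case: pw => j le_jk ->;
  have [|[_ ->]] := up_or j le_jk isT; first by constructor 1.
  by constructor 2; exists i => //; apply: ltnW.
- move: pw up_or; rewrite XE /= => pw up_or; case: pw => -[j le_jk ->].
    have [gap|] := boolP ((0 < i)%N || (0 < j)%N).
      have [|[_ ->]] := up_or j le_jk gap; first by constructor 1.
      by constructor 2; left; exists i => //; apply: ltnW.
    rewrite negb_or -!eqn0Ngt => /andP[/eqP-> /eqP->].
    by constructor 2; right; exists 1%N; rewrite ?climbS //; lia.
  have [<-|/eqP ne] := eqVneq i j.
    by constructor 2; right; exists i.+1; rewrite ?climbS //; lia.
  by constructor 1; apply: nul_climbB.
- move: pw up_or; rewrite XE /= => pw up_or; case: pw => -[j le_jk ->].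
    have [gap|] := boolP ((i != 1%N) || (0 < j)%N).
      have [|[_ ->]] := up_or j le_jk gap; first by constructor 1.
      by constructor 2; left; exists i => //; apply: ltnW.
    rewrite negb_or -eqn0Ngt negbK => /andP[/eqP eq_i /eqP->].
    by constructor 2; right; exists 1%N; rewrite ?climbS ?eq_i //; lia.
  have [eq_i|/eqP ne] := eqVneq i j.+1.
    by constructor 2; right; exists j.+1; rewrite ?climbS ?eq_i //; lia.
  by constructor 1; apply: nul_climbC.
- move: pw up_or; rewrite XE /= => pw up_or.
  have nil_or0 : i = 0%N -> (k < 3)%N -> nul [:: i] \/ [:: i] = 0%N :: up k 2 /\ (2 <= k)%N.
    move=> -> lt_k3; have [eq_k|k_gt1] := leqP k 1; last by right; rewrite up_nil.
    left=> m; apply: (sf_com1 serreV); first by lia.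
    by rewrite XE; have ->: k = 1%N by lia.
  have up0 j : (2 < j <= k)%N -> nul (0%N :: up k j) by apply: nul_up0D.
  case: pw => [->|[j /andP[j_gt0 le_jk] ->]|[k_ge2 ->]|[m ltm ->]].
  + have [i0|i_gt0] := posnP i.
      have [k_ge3|k_lt3] := leqP 3 k.
        by constructor 1; rewrite i0 -[ [::] ](up_nil (leqnn k)); apply: up0; lia.
      have [|[-> ?]] := nil_or0 i0 k_lt3; first by constructor 1.
      by constructor 2; constructor 3.
    have [|| |[_]] := up_or k => //; first by lia.
      by rewrite up_nil //; constructor 1.
    by rewrite up_nil // => ->; constructor 2; constructor 2; exists i => //; lia.
  + have [i0|i_gt0] := posnP i; last first.
      have [|| |[_ ->]] := up_or j => //; [lia|by constructor 1|].
      by constructor 2; constructor 2; exists i => //; lia.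
    have [j_ge3|j_lt3] := leqP 3 j.
      by constructor 1; rewrite i0; apply: up0; lia.
    have [k_ge2|k_lt2] := leqP 2 k; last first.
      rewrite up_nil; last by lia.
      have [||[_ ?]] := nil_or0 i0; [lia|by constructor 1|lia].
    have [j1|j2] : j = 1%N \/ j = 2%N by lia.
      by constructor 3; split=> //; exists 0%N; rewrite ?climb0 ?i0 ?j1.
    by constructor 2; constructor 3; rewrite i0 j2.
  + have [->|/eqP ne] := eqVneq i 1%N; first by constructor 2; constructor 4; exists 0%N.
    by constructor 1; apply: nul_fork0.
  + have [eq_i|/eqP ne] := eqVneq i m.+2.
      by constructor 2; constructor 4; exists m.+1; rewrite ?climbS ?eq_i //; lia.
    by constructor 1; apply: nul_climbD.
Qed.

(* In type D the words that pass 0 before 1 repeat, up to commutation, those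
   that pass 1 before 0. *)
Lemma nul_pathp w : all (fun i => i < k)%N w ->
  [\/ nul w, pathp X k w |
      X = typeD /\ exists2 n, (n.+1 < k)%N & w = climb 2 n (0%N :: up k 1)].
Proof.
elim: w => [|i w IHw] /=.
  move=> _; apply: Or32; rewrite /pathp; case: X => /=.
  - by exists k; rewrite ?up_nil.
  - by left; exists k; rewrite ?up_nil.
  - by left; exists k; rewrite ?up_nil.
  - by apply: Or41.
case/andP=> lti ltw; have {IHw ltw} := IHw ltw.
case=> [nw|pw|[XD [n ltn ->]]].
- by apply: Or31; apply: (sf_zero serreV lti nw).
- by apply: pathp_cons.
- have [eq_i|ne_i] := eqVneq i n.+2.
    by apply: Or33; split=> //; exists n.+1; rewrite ?climbS ?eq_i //; lia.
  apply: Or31; apply: (nul_eq (y' := i :: climb 2 n [:: 1%N, 0%N & up k 2])).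
    move=> m Qm; apply/esym/(sf_eq serreV) => //; last by apply: climb_swap => //; lia.
    by apply: perm_climb; rewrite (upS (j := 1)) //; [apply/permP => a /=|]; lia.
  by apply: nul_climbD => //; lia.
Qed.

End PathLemma.

(** * The order on words *)

Fixpoint nlex (u v : seq nat) : bool :=
  match u, v with
  | [::], _ => false
  | _ :: _, [::] => true
  | i :: u', j :: v' => (i < j)%N || ((i == j) && nlex u' v')
  end.
Definition wlt (u v : seq nat) : bool := nlex (rev u) (rev v).

Lemma nlex_cat2l u v w : nlex (u ++ v) (u ++ w) = nlex v w.
Proof. by elim: u => //= i u ->; rewrite ltnn eqxx. Qed.

Lemma nlex_catr u v w : nlex u v -> nlex (u ++ w) v.
Proof.
elim: u v => [|i u IHu] [|j v] //= /orP[->//|/andP[/eqP-> /IHu->]].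
by rewrite eqxx orbT.
Qed.

Lemma nlex_trans u v w : nlex u v -> nlex v w -> nlex u w.
Proof.
elim: u v w => [|i u IHu] [|j v] [|l w] //= /orP[lt_ij|/andP[/eqP<- uv]].
  case/orP=> [lt_jl|/andP[/eqP<- _]]; last by rewrite lt_ij.
  by rewrite (ltn_trans lt_ij).
by case/orP=> [->//|/andP[-> /(IHu _ _ uv)->]]; rewrite orbT.
Qed.

Lemma nlex_total u v : [\/ u = v, nlex u v | nlex v u].
Proof.
elim: u v => [|i u IHu] [|j v] /=; try by [constructor 1|constructor 2|constructor 3].
have [lt_ij|lt_ji|<-] := ltngtP i j; [by constructor 2|by constructor 3|].
by rewrite /=; case: (IHu v) => [->|->|->]; [constructor 1|constructor 2|constructor 3].
Qed.

Lemma nlex_irr u : nlex u u = false.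
Proof. by elim: u => //= i u ->; rewrite ltnn andbF. Qed.

Lemma nlex_cat u v : nlex u (u ++ v) = false.
Proof. by elim: u => //= i u ->; rewrite ltnn andbF. Qed.

(** As [k] exceeds every letter of [u], the comparison cannot first turn out differently at [k]:
    there [v] has ended and is already the larger word. *)
Lemma nlex_sep k u v w : all (fun i => i < k)%N u -> nlex u (v ++ k :: w) ->
  nlex u v.
Proof.
elim: u v => [|i u IHu] [|j v] //= /andP[lti ltu].
by case/orP=> [->//|/andP[-> /(IHu _ ltu)->]]; rewrite orbT.
Qed.

Lemma wlt_trans u v w : wlt u v -> wlt v w -> wlt u w.
Proof. exact: nlex_trans. Qed.

Lemma wlt_total u v : [\/ u = v, wlt u v | wlt v u].
Proof.
case: (nlex_total (rev u) (rev v)) => ?; [|by constructor 2|by constructor 3].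
by constructor 1; apply: (can_inj revK).
Qed.

Lemma wlt_irr u : wlt u u = false.
Proof. exact: nlex_irr. Qed.

Lemma wlt_catr t u v : wlt u v -> wlt (t ++ u) v.
Proof. by rewrite /wlt rev_cat; apply: nlex_catr. Qed.

Lemma wlt_cons i u : wlt (i :: u) u.
Proof. by rewrite /wlt rev_cons -cats1 -{2}[rev u]cats0 nlex_cat2l. Qed.

Lemma wlt_suffix t u : wlt u (t ++ u) = false.
Proof. by rewrite /wlt rev_cat nlex_cat. Qed.

Lemma wlt_cat2r t u v : wlt (u ++ t) (v ++ t) = wlt u v.
Proof. by rewrite /wlt !rev_cat nlex_cat2l. Qed.

Lemma up_split k i j : (i <= j <= k)%N -> up k i = iota i (j - i) ++ up k j.
Proof.
move=> /andP[le_ij le_jk]; rewrite /up.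
have -> : (k - i = (j - i) + (k - j))%N by lia.
by rewrite iotaD subnKC.
Qed.

Lemma climb_split lo m n w : (m <= n)%N ->
  climb lo n w = rev (iota (lo + m) (n - m)) ++ climb lo m w.
Proof.
by move=> le_mn; rewrite /climb catA -rev_cat -iotaD subnKC.
Qed.

Lemma climb_cat lo n w : climb lo n w = rev (iota lo n) ++ w.
Proof. by []. Qed.

Lemma below_up k j : all (fun i => i < k)%N (up k j).
Proof. by apply/allP => i; rewrite mem_iota; lia. Qed.

Lemma below_climb k lo n w : (lo + n <= k)%N -> all (fun i => i < k)%N w ->
  all (fun i => i < k)%N (climb lo n w).
Proof.
move=> le_k ltw; rewrite all_cat ltw andbT all_rev.
by apply/allP => i; rewrite mem_iota; lia.
Qed.

Lemma pathp_below X k w : pathp X k w -> all (fun i => i < k)%N w.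
Proof.
case: X => /=.
- by case=> j _ ->; apply: below_up.
- case=> -[j lej ->]; first exact: below_up.
  by apply: below_climb; [lia|apply: below_up].
- case=> -[j lej ->]; first exact: below_up.
  by apply: below_climb; [lia|apply: below_up].
- case=> [->|[j _ ->]|[k2 ->]|[m ltm ->]] //; try exact: below_up.
    by rewrite /= below_up andbT; lia.
  by apply: below_climb; rewrite /= ?below_up; lia.
Qed.
(** * q-commutators of operators satisfying the Serre relations *)

(** [P] is to be the shuffle subalgebra: letter removals on the whole free algebra satisfy no
    relations. The bound by [k] keeps the indices inside the alphabet. *)
Record serre_module (K : fieldType) (q : K) (X : classical_type) (k : nat)
  (M : lmodType K) (P : M -> Prop) (d : nat -> M -> M) : Prop := {
  sm_lin : forall i c x y, d i (c *: x + y) = c *: d i x + d i y;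
  sm_subspace : forall c x y, P x -> P y -> P (c *: x + y);
  sm_stable : forall i x, P x -> P (d i x);
  sm_com : forall i j m, (i <= k)%N -> (j <= k)%N -> com X i j ->
    P m -> d i (d j m) = d j (d i m);
  sm_cub : forall i j m, (i <= k)%N -> (j <= k)%N -> cub X i j ->
    P m -> d i (d i (d j m))
           - (q ^ gr X i j + (q ^ gr X i j)^-1) *: d i (d j (d i m))
           + d j (d i (d i m)) = 0;
  sm_qua : forall i j m, (i <= k)%N -> (j <= k)%N -> qua X i j ->
    P m -> d i (d i (d i (d j m)))
           - (q ^+ 2 + 1 + q ^- 2) *: d i (d i (d j (d i m)))
           + (q ^+ 2 + 1 + q ^- 2) *: d i (d j (d i (d i m)))
           - d j (d i (d i (d i m))) = 0
}.

Section SerreModule.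
Variables (K : fieldType) (q : K) (X : classical_type) (k : nat).
Variables (M : lmodType K) (P : M -> Prop) (d : nat -> M -> M).
Local Notation g := (gr X).
Hypothesis q_neq0 : q != 0.
Hypothesis q_not_root1 : forall n, q ^+ n.+1 != 1.
Hypothesis serreM : serre_module q X k P d.
Let d_lin := sm_lin serreM.
Let P_lin := sm_subspace serreM.
Let P_d := sm_stable serreM.
Let d_com := sm_com serreM.
Let d_cub := sm_cub serreM.
Let d_qua := sm_qua serreM.

Let dD i x y : d i (x + y) = d i x + d i y.
Proof. by have := d_lin i 1 x y; rewrite !scale1r. Qed.
Let d0 i : d i 0 = 0.
Proof. by apply: (addIr (d i 0)); rewrite -dD !add0r. Qed.
Let dZ i c x : d i (c *: x) = c *: d i x.
Proof. by have := d_lin i c x 0; rewrite d0 !addr0. Qed.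
Let dN i x : d i (- x) = - d i x.
Proof. by rewrite -scaleN1r dZ scaleN1r. Qed.
Let dE := (dD, dN, dZ, d0).

Definition dw (s : seq nat) (m : M) : M := foldr d m s.

Lemma dw_cat s t m : dw (s ++ t) m = dw s (dw t m).
Proof. by rewrite /dw foldr_cat. Qed.

Lemma dw0 s : dw s 0 = 0.
Proof. by elim: s => //= i s ->; rewrite d0. Qed.

Lemma P_dw s m : P m -> P (dw s m).
Proof. by move=> Pm; elim: s => //= i s; apply: P_d. Qed.

Definition lowest (m : M) := P m /\ forall i, (i < k)%N -> d i m = 0.

(** In a relation containing [k] once, every term in which a smaller letter acts before [k] vanishes
    on a lowest vector, which leaves a single term. *)
Lemma serre_family_dw : serre_family q X k lowest (fun y m => dw y (d k m)).
Proof.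
split=> /=.
- by move=> i y _ Vy m Qm; rewrite (Vy m Qm) d0.
- by move=> i y y' _ Vy m Qm; rewrite (Vy m Qm).
- move=> i j y m lti ltj cij [Pm _]; apply: d_com => //; rewrite ?(ltnW lti) ?(ltnW ltj) //.
  by apply/P_dw/P_d.
- move=> i j y m lti ltj cij [Pm _]; apply: d_cub => //; rewrite ?(ltnW lti) ?(ltnW ltj) //.
  by apply/P_dw/P_d.
- move=> i j y m lti ltj cij [Pm _]; apply: d_qua => //; rewrite ?(ltnW lti) ?(ltnW ltj) //.
  by apply/P_dw/P_d.
- by move=> i m lti cik [Pm dm0]; rewrite d_com ?(ltnW lti) // (dm0 i lti) d0.
- move=> i m lti cik [Pm dm0]; have := d_cub (ltnW lti) (leqnn k) cik Pm.
  by rewrite (dm0 i lti) !d0 scaler0 subr0 addr0.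
- move=> i m lti cik [Pm dm0]; have := d_qua (ltnW lti) (leqnn k) cik Pm.
  by rewrite (dm0 i lti) !d0 !scaler0 !subr0 addr0.
Qed.

(** * Iterated q-commutators *)

Definition pr (i : nat) (y : seq nat) : int := g i k + \sum_(j <- y) g i j.
Definition chi (i : nat) (y : seq nat) : K := q ^ pr i y.

(** This is the q-adjoint action of the letters of [y] on [d k]. The twist [chi i y] pairs
    $\alpha_i$ with the weight of the operator reached so far, $\alpha_k$ plus the weight of [y]. *)
Fixpoint ad_rec (y : seq nat) (m : M) : M :=
  if y is i :: y' then d i (ad_rec y' m) - chi i y' *: ad_rec y' (d i m)
  else d k m.
Definition E := locked ad_rec.

Lemma E_nil m : E [::] m = d k m.
Proof. by rewrite /E; unlock. Qed.

Lemma E_cons i a m : E (i :: a) m = d i (E a m) - chi i a *: E a (d i m).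
Proof. by rewrite /E; unlock. Qed.

Lemma E_lin y c m m' : E y (c *: m + m') = c *: E y m + E y m'.
Proof. by elim: y m m' => [|i y IHy] m m'; rewrite ?E_nil ?E_cons ?d_lin // !IHy !dE;
  lincomb M; ring. Qed.

Let ED y m m' : E y (m + m') = E y m + E y m'.
Proof. by have := E_lin y 1 m m'; rewrite !scale1r. Qed.
Let E0 y : E y 0 = 0.
Proof. by apply: (addIr (E y 0)); rewrite -ED !add0r. Qed.
Let EZ y c m : E y (c *: m) = c *: E y m.
Proof. by have := E_lin y c m 0; rewrite E0 !addr0. Qed.
Let EN y m : E y (- m) = - E y m.
Proof. by rewrite -scaleN1r EZ scaleN1r. Qed.
Let EE := (ED, EN, EZ, E0).

Lemma P_E y m : P m -> P (E y m).
Proof.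
elim: y m => [|i y IHy] m Pm; first by rewrite E_nil; apply: P_d.
rewrite E_cons addrC -scaleNr; apply: P_lin; first by apply/IHy/P_d.
by apply/P_d/IHy.
Qed.

Lemma chi_cons i j y : chi i (j :: y) = q ^ g i j * chi i y.
Proof. by rewrite /chi -expfzDr // /pr big_cons; congr (_ ^ _); ring. Qed.

Lemma chi_neq0 i y : chi i y != 0.
Proof. exact: expfz_neq0. Qed.

Lemma chi_perm i y y' : perm_eq y y' -> chi i y = chi i y'.
Proof. by move=> yy'; rewrite /chi /pr (perm_big _ yy'). Qed.

Lemma chi_nil i : chi i [::] = q ^ g i k.
Proof. by rewrite /chi /pr big_nil addr0. Qed.

Lemma cub_pow i j : cub X i j -> q ^ g i i = (q ^ g i j) ^- 2.
Proof.
by case/andP => _ /eqP->; rewrite mulr2n opprD expfzDr // -invr_expz -invfM expr2.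
Qed.

Lemma qua_pow i j : qua X i j -> q ^ g i i = q ^+ 2 /\ q ^ g i j = q ^- 2.
Proof. by case/andP => /andP[_ /eqP->] /eqP->. Qed.

Lemma serre_family_E : serre_family q X k P E.
Proof.
split=> /=.
- by move=> i y _ Ey m Pm; rewrite E_cons !Ey ?d0 ?scaler0 ?subr0 //; apply: P_d.
- by move=> i y y' yy' Ey m Pm; rewrite !E_cons (chi_perm _ yy') !Ey //; apply: P_d.
- move=> i j y m lti ltj cij Pm.
  rewrite !E_cons !chi_cons [g j i]gr_sym (eqP cij) !mul1r !dE.
  rewrite d_com ?(ltnW lti) ?(ltnW ltj) //; last exact: P_E.
  by rewrite (@d_com i j m) ?(ltnW lti) ?(ltnW ltj) //; lincomb M; ring.
- move=> i j y m lti ltj cij Pm.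
  have H1 := d_cub (ltnW lti) (ltnW ltj) cij (P_E y Pm).
  have := congr1 (E y) (d_cub (ltnW lti) (ltnW ltj) cij Pm).
  rewrite !EE => H2; rewrite !E_cons !chi_cons [g j i]gr_sym (cub_pow cij).
  have p0 : q ^ g i j != 0 by apply: expfz_neq0.
  move: (q ^ g i j) p0 H1 H2 => p p0 H1 H2.
  move: (chi i y) (chi j y) => x z; rewrite !dE.
  pose L1 := d i (d i (d j (E y m))) - (p + p^-1) *: d i (d j (d i (E y m))) + d j (d i (d i (E y m))).
  pose L2 := E y (d i (d i (d j m))) - (p + p^-1) *: E y (d i (d j (d i m))) + E y (d j (d i (d i m))).
  (* [L1] is the relation applied after [E y] and [L2] the one applied before it; the terms with
     letters on both sides of [E y] cancel, given the value of [q ^ g i i]. *)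
  transitivity (L1 - (z * x ^+ 2) *: L2); last by rewrite /L1 /L2 H1 H2 scaler0 subr0.
  by rewrite /L1 /L2; lincomb M; field.
- move=> i j y m lti ltj cij Pm.
  have H1 := d_qua (ltnW lti) (ltnW ltj) cij (P_E y Pm).
  have := congr1 (E y) (d_qua (ltnW lti) (ltnW ltj) cij Pm).
  rewrite !EE => H2; rewrite !E_cons !chi_cons [g j i]gr_sym.
  have [-> ->] := qua_pow cij.
  move: (chi i y) (chi j y) => x z; rewrite !dE.
  set c := q ^+ 2 + 1 + q ^- 2 in H1 H2 *.
  pose L1 := d i (d i (d i (d j (E y m)))) - c *: d i (d i (d j (d i (E y m))))
    + c *: d i (d j (d i (d i (E y m)))) - d j (d i (d i (d i (E y m)))).
  pose L2 := E y (d i (d i (d i (d j m)))) - c *: E y (d i (d i (d j (d i m))))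
    + c *: E y (d i (d j (d i (d i m)))) - E y (d j (d i (d i (d i m)))).
  transitivity (L1 - (z * x ^+ 3) *: L2); last by rewrite /L1 /L2 H1 H2 scaler0 subr0.
  by rewrite /L1 /L2 /c; lincomb M; field.
- move=> i m lti cik Pm; rewrite E_cons !E_nil chi_nil (eqP cik) scale1r d_com ?(ltnW lti) //.
  by rewrite subrr.
- move=> i m lti cik Pm; have H := d_cub (ltnW lti) (leqnn k) cik Pm.
  rewrite !E_cons !E_nil chi_cons chi_nil (cub_pow cik) !dE -[RHS]H.
  have p0 : q ^ g i k != 0 by apply: expfz_neq0.
  by move: (q ^ g i k) p0 => p p0; lincomb M; field.
- move=> i m lti cik Pm; have H := d_qua (ltnW lti) (leqnn k) cik Pm.
  rewrite !E_cons !E_nil !chi_cons chi_nil; have [-> ->] := qua_pow cik.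
  rewrite !dE -[RHS]H.
  by lincomb M; field.
Qed.

(** * Quadratic relations between q-commutators *)

Let famE := serre_family_E.
Local Notation nulE := (nul P E).

Lemma d_E i a m : d i (E a m) = E (i :: a) m + chi i a *: E a (d i m).
Proof. by rewrite E_cons subrK. Qed.

(* A list of triples (c, a, b) stands for the sum of the operators c E_a E_b. *)
Definition quad := seq (K * seq nat * seq nat).
Definition quad_eval (l : quad) (m : M) : M :=
  \sum_(t <- l) t.1.1 *: E t.1.2 (E t.2 m).
Definition quad_ad (i : nat) (l : quad) : quad :=
  flatten [seq [:: (t.1.1, i :: t.1.2, t.2);
                   (t.1.1 * chi i t.1.2, t.1.2, i :: t.2)] | t <- l].
Definition quad_rel (l : quad) := forall m, P m -> quad_eval l m = 0.

(** The q-adjoint action is a twisted derivation of products. Homogeneity makes the twist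
    [chi i a * chi i b] the same for all terms, so a relation is carried to a relation. *)
Lemma quad_adP i l w :
  all (fun t : K * seq nat * seq nat => perm_eq (t.1.2 ++ t.2) w) l ->
  quad_rel l -> quad_rel (quad_ad i l).
Proof.
move=> hom rel m Pm.
suff -> : quad_eval (quad_ad i l) m =
    d i (quad_eval l m) - (q ^ (g i k) * chi i w) *: quad_eval l (d i m).
  by rewrite !rel ?d0 ?scaler0 ?subr0 //; apply: P_d.
elim: l hom {rel} => [|[[c a] b] l IHl] /=.
  by rewrite /quad_eval !big_nil d0 scaler0 subr0.
case/andP=> hom_ab /IHl {}IHl; rewrite /quad_eval /= !big_cons /=.
rewrite -!/(quad_eval _ _) IHl dD dZ !d_E !EE.
have -> : q ^ g i k * chi i w = chi i a * chi i b.
  rewrite /chi -!expfzDr //; congr (_ ^ _); rewrite /pr -(perm_big _ hom_ab) big_cat /=.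
  by ring.
lincomb M; ring.
Qed.

Definition qcomm (c : K) (a b : seq nat) :=
  forall m, P m -> E a (E b m) = c *: E b (E a m).

Lemma qcomm_quad c a b : qcomm c a b <-> quad_rel [:: (1, a, b); (- c, b, a)].
Proof.
split=> H m Pm; have := H m Pm; rewrite /quad_eval !big_cons big_nil /= addr0.
  by move=> ->; lincomb M; ring.
by move=> H'; rewrite -[RHS]addr0 -[in RHS]H'; lincomb M; ring.
Qed.

Ltac homogeneous :=
  rewrite /= ?andbT;
  repeat match goal with |- is_true (_ && _) => apply/andP; split end;
  apply/permP => x;
  rewrite ?count_cat /= ?count_cat /=;
  repeat match goal with |- context [nat_of_bool ?b] => move: (nat_of_bool b) => ? end;
  repeat match goal with |- context [count ?p ?l] => move: (count p l) => ? end;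
  lia.

(** Acting by [i] and then by [j] on the given relation yields eight products; the two vanishing
    words remove all but the products of [[:: i, j & b]] with [j :: b]. *)
Lemma qcomm_step i j b c : qcomm c (j :: b) b ->
  nulE (i :: b) -> nulE [:: j, i, j & b] ->
  qcomm (c * chi i b / chi j [:: i, j & b]) [:: i, j & b] (j :: b).
Proof.
move=> /qcomm_quad/(quad_adP i (w := j :: b ++ b)) rel1.
have /(quad_adP j (w := i :: j :: b ++ b)) rel2 := rel1 ltac:(homogeneous).
move: rel2 => /(_ ltac:(homogeneous)) rel nib njijb m Pm; have := rel m Pm.
rewrite /quad_eval !big_cons big_nil /=.
have E0l a x : nulE a -> P x -> E a x = 0 by move=> na; apply: na.
have nx x : nulE (i :: b) -> nulE (x :: i :: b).
  move=> ni y Py; rewrite E_cons !ni ?d0 ?scaler0 ?subr0 //; exact: P_d.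
rewrite !(nib m Pm) !(njijb m Pm) !(nx j nib m Pm) ?EE.
rewrite !(nib (E _ m)) ?(njijb (E _ m)) ?(nx j nib (E _ m)) //; try exact: P_E.
move=> H; have c0 := chi_neq0 j [:: i, j & b].
rewrite -[RHS]addr0 -[in RHS](scaler0 _ (chi j [:: i, j & b])^-1) -[in RHS]H !scaler0.
lincomb M; field => //.
Qed.

Let nulE_up := nul_up q_neq0 q_not_root1 famE.

(** This is the Serre relation with two letters [k] and one [j], factored as a q-commutator of
    q-commutators. *)
Lemma qcomm_base j : (j < k)%N -> cub X k j ->
  qcomm (q ^ g k j)^-1 [:: j] [::].
Proof.
move=> ltj ckj m Pm; have := d_cub (leqnn k) (ltnW ltj) ckj Pm.
have p0 : q ^ g k j != 0 by apply: expfz_neq0.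
rewrite !E_cons !E_nil chi_nil [g j k]gr_sym !dE; move: (q ^ g k j) p0 => p p0 H.
by rewrite -[RHS]addr0 -[in RHS]H; lincomb M; field.
Qed.

Lemma pr_up i j : (forall l, (j <= l <= k)%N -> com X i l) -> (j <= k)%N ->
  pr i (up k j) = 0.
Proof.
move=> com_il le_jk; rewrite /pr (eqP (com_il k _)) ?le_jk ?leqnn // add0r.
rewrite big1_seq // => l /=; rewrite mem_iota => ltl.
by apply/eqP/com_il; lia.
Qed.

Lemma pr_cons i j y : pr i (j :: y) = g i j + pr i y.
Proof. by rewrite /pr big_cons; ring. Qed.

Lemma pr_up_next i j : (forall l, (j < l <= k)%N -> com X i l) -> (j <= k)%N ->
  pr i (up k j) = g i j.
Proof.
move=> com_il; rewrite leq_eqVlt => /predU1P[->|lt_jk].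
  by rewrite up_nil // /pr big_nil addr0.
by rewrite upS // pr_cons pr_up ?addr0.
Qed.

(** For [j = 0] the pair [up k 0], [up k 1] is the exceptional one in type C, and in type D the
    letters 0 and 1 are not joined. *)
Definition above_fork (T : classical_type) (j : nat) : bool :=
  if T is (typeC | typeD) then (0 < j)%N else true.

(** The constant does not depend on [j]: the exponents contributed by [qcomm_step] are pairings of
    an interior node with itself and its two neighbours, and add up to 0. *)
Lemma qcomm_up j : (j < k)%N -> above_fork X j ->
  qcomm (q ^ g k k.-1)^-1 (up k j) (up k j.+1).
Proof.
have [n] := ubnP (k - j)%N; elim: n j => // n IHn j.
rewrite ltnS => le_n lt_jk jX.
have [eq_k|ne_k] := eqVneq j.+1 k.
  rewrite upS // [up k j.+1]up_nil ?eq_k // (_ : k.-1 = j); last by lia.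
  apply: qcomm_base => //.
  by case: X jX => /= jX; gram.
have lt_j1k : (j.+1 < k)%N by lia.
set c := (q ^ _)^-1.
have := @qcomm_step j j.+1 (up k j.+2) c; rewrite -!upS //.
have <- : c = c * chi j (up k j.+2) / chi j.+1 (up k j).
  rewrite /chi (@pr_up j j.+2) //; last first.
    by move=> l ltl; case: X jX => /= jX; gram.
  rewrite expr0z mulr1 upS // upS // !pr_cons pr_up_next //; last first.
    by move=> l ltl; case: X jX => /= jX; gram.
  suff -> : g j.+1 j + (g j.+1 j.+1 + g j.+1 j.+2) = 0 by rewrite expr0z divr1.
  by case: X jX => /= jX; gram.
apply.
- by apply: IHn; [lia|lia|case: X jX => /=; lia].
- by apply: nulE_up => //; try lia; case: X jX => /=; lia.
- by apply: nulE_up => //; try lia; case: X jX => /=; lia.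
Qed.

Definition qcommutes a b := exists2 c, c != 0 & qcomm c a b.

Lemma qcommutes_step i j b : qcommutes (j :: b) b ->
  nulE (i :: b) -> nulE [:: j, i, j & b] -> qcommutes [:: i, j & b] (j :: b).
Proof.
move=> [c c0 cjb] nib njijb; exists (c * chi i b / chi j [:: i, j & b]).
  by rewrite !mulf_neq0 ?invr_eq0 ?chi_neq0.
exact: qcomm_step.
Qed.

Lemma qcommutes_up j : (j < k)%N -> above_fork X j ->
  qcommutes (up k j) (up k j.+1).
Proof.
move=> lt_jk jX; exists (q ^ g k k.-1)^-1; last exact: qcomm_up.
by rewrite invr_eq0 expfz_neq0.
Qed.

Lemma qcommutes_climb lo m w : qcommutes (climb lo 1 w) w ->
  (forall i n, (n <= m.+1)%N -> (i < k)%N -> i <> (lo + n)%N ->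
     nulE (i :: climb lo n w)) -> (lo + m < k)%N ->
  qcommutes (climb lo m.+1 w) (climb lo m w).
Proof.
move=> qw; elim: m => [|m IHm] nw ltm //.
rewrite (climbS _ m.+1) climbS; apply: qcommutes_step.
- by rewrite -climbS; apply: IHm => [i n le_n|]; [apply: nw|]; lia.
- by apply: nw; lia.
- by rewrite -!climbS; apply: nw; lia.
Qed.

Lemma nulE_zero a b m : nulE a -> P m -> E a (E b m) = 0 /\ E b (E a m) = 0.
Proof. by move=> na Pm; rewrite !na ?E0 //; apply: P_E. Qed.

(** * Type B: passing the double bond *)

Section QcommB.
Hypotheses (XB : X = typeB) (k_gt0 : (0 < k)%N).

Lemma nulE_climbB m i : (i < k)%N -> (0 < m <= k)%N -> i <> m ->
  nulE (i :: climb 0 m (up k 0)).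
Proof. exact: (nul_climbB q_neq0 q_not_root1 famE). Qed.

(** Acting twice by 0 on the relation of [up k 0] and [up k 1] leaves, once the words with three
    letters 0 vanish, only products of the two blocks wanted. *)
Lemma qcommutes_midB : qcommutes (climb 0 1 (up k 0)) (up k 0).
Proof.
have up0 : up k 0 = 0%N :: up k 1 by rewrite upS.
have pr1 : pr 0 (up k 1) = -2.
  by rewrite pr_up_next // => [|l ltl]; rewrite XB; gram.
have c2 : (q ^ g k k.-1)^-1 = q ^ 2.
  rewrite (_ : g k k.-1 = -2); first by rewrite -invr_expz invrK.
  by rewrite XB; gram.
have rel0 : qcomm (q ^ 2) (0%N :: up k 1) (up k 1).
  by rewrite -c2 -up0; apply: qcomm_up => //; rewrite XB.
have nul3 : nulE [:: 0%N, 0%N, 0%N & up k 1].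
  by rewrite -up0 -(climb0 0 (0%N :: up k 0)) climb0; apply: (@nulE_climbB 1).
set b := up k 1 in up0 pr1 rel0 nul3 *.
move/qcomm_quad/(quad_adP 0 (w := 0%N :: b ++ b)): rel0 => /(_ ltac:(homogeneous)).
move/(quad_adP 0 (w := 0%N :: 0%N :: b ++ b)) => /(_ ltac:(homogeneous)) rel.
exists (q ^ 2); first exact: expfz_neq0.
move=> m Pm; have := rel m Pm; rewrite climbS climb0 addn0 up0.
rewrite /quad_eval !big_cons big_nil /= !chi_cons /chi pr1 XB /=.
have [-> ->] := nulE_zero b nul3 Pm.
rewrite (_ : gr typeB 0 0 = 2) // => H.
have q20 : q ^ 2 != 0 by apply: expfz_neq0.
rewrite -[RHS]addr0 -[in RHS]H -invr_expz.
by move: (q ^ 2) q20 => p p0; lincomb M; field.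
Qed.

End QcommB.

(** * Type C: the double bond and the exceptional pair *)

Section QcommC.
Hypotheses (XC : X = typeC) (k_gt1 : (1 < k)%N).
Let k_gt0 := ltnW k_gt1.
Let up0 : up k 0 = 0%N :: up k 1. Proof. exact: upS. Qed.
Let up1 : up k 1 = 1%N :: up k 2. Proof. exact: upS. Qed.
Local Notation x := (up k 0).
Local Notation y := (up k 1).
Local Notation z := (up k 2).
Local Notation w := (climb 1 1 x).

Lemma nulE_climbC m i : (i < k)%N -> (m < k)%N -> i <> m.+1 ->
  nulE (i :: climb 1 m (up k 0)).
Proof.
case: m => [|m] lti ltm ne_i; last exact: (nul_climbC q_neq0 q_not_root1 famE).
by apply: nulE_up; rewrite ?XC //=; lia.
Qed.

Let nulE_upC i j : (i < k)%N -> (0 < j <= k)%N -> i.+1 <> j -> nulE (i :: up k j).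
Proof. by move=> *; apply: nulE_up; rewrite ?XC //=; lia. Qed.

Let gk1 : (q ^ g k k.-1)^-1 = q.
Proof.
rewrite (_ : g k k.-1 = -1); first by rewrite -invr_expz invrK.
by rewrite XC; gram.
Qed.

Let chi0z : chi 0 z = 1.
Proof. by rewrite /chi pr_up // => l ltl; rewrite XC; gram. Qed.

Let chi1z : chi 1 z = q^-1.
Proof.
rewrite /chi pr_up_next //; first by rewrite XC.
by move=> l ltl; rewrite XC; gram.
Qed.

Let rel_yz : qcomm q y z.
Proof. by rewrite -{1}gk1; apply: qcomm_up; rewrite ?XC. Qed.

Let nul0z : nulE (0%N :: z). Proof. by apply: nulE_upC; lia. Qed.
Let nul1y : nulE [:: 1%N, 1%N & z].
Proof. by rewrite -up1; apply: nulE_upC; lia. Qed.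
Let nul1w : nulE [:: 1%N, 1%N, 0%N, 1%N & z].
Proof. by rewrite -up1 -up0; apply: (@nulE_climbC 1). Qed.
Let nul0w : nulE [:: 0%N, 1%N, 0%N, 1%N & z].
Proof. by rewrite -up1 -up0; apply: (@nulE_climbC 1). Qed.

Let wE : w = [:: 1%N, 0%N, 1%N & z].
Proof. by rewrite climbS climb0 addn0 up0 up1. Qed.

Let rel_mid : quad_rel (quad_ad 1 (quad_ad 0 [:: (1, y, z); (- q, z, y)])).
Proof.
move: rel_yz => /qcomm_quad; rewrite up1 => rel.
apply: (@quad_adP 1 _ (0%N :: 1%N :: z ++ z)); first by homogeneous.
by apply: (@quad_adP 0 _ (1%N :: z ++ z)) => //; homogeneous.
Qed.

(** The pairs [x, y] and [w, z] have the same total weight. Acting by 0 and then by 1 on the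
    relation of [y] and [z] therefore mixes them, and the commutator of [w] and [z] stays. *)
Lemma E_xy m : P m ->
  E x (E y m) = q *: (q *: E y (E x m) + E z (E w m) - E w (E z m)).
Proof.
move=> Pm; have := rel_mid Pm.
rewrite /quad_eval !big_cons big_nil /= wE up0 up1 !chi_cons chi0z chi1z XC /=.
have [-> ->] := nulE_zero [:: 1%N, 1%N & z] nul0z Pm.
have nul10z : nulE [:: 1%N, 0%N & z] by apply: (sf_zero famE).
have [-> ->] := nulE_zero [:: 1%N & z] nul10z Pm.
move=> H; rewrite -[RHS]addr0 -[in RHS](scaler0 _ q) -[in RHS]H.
have m2 : q ^ (-2) = q ^- 2 by [].
have gC10 : gr typeC 1 0 = -2 by [].
have gC11 : gr typeC 1 1 = 2 by [].
rewrite gC10 gC11 m2 -exprnP.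
lincomb M; field => //.
Qed.

(** One more action by 1 leaves only products of [w] and [y], with a common factor [q + q^-1] to be
    divided out. *)
Lemma qcomm_wy : qcomm q w y.
Proof.
have rel : quad_rel (quad_ad 1 (quad_ad 1 (quad_ad 0 [:: (1, y, z); (- q, z, y)]))).
  apply: (@quad_adP 1 _ (1%N :: 0%N :: 1%N :: z ++ z)); last exact: rel_mid.
  by rewrite up1; homogeneous.
move=> m Pm; have := rel m Pm.
rewrite /quad_eval !big_cons big_nil /= wE up1 !chi_cons chi0z chi1z XC /=.
have nul10z : nulE [:: 1%N, 0%N & z] by apply: (sf_zero famE).
have nul110z : nulE [:: 1%N, 1%N, 0%N & z] by apply: (sf_zero famE).
have z1 a := nulE_zero a nul1y Pm.
have z2 a := nulE_zero a nul10z Pm.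
have z3 a := nulE_zero a nul110z Pm.
have z4 a := nulE_zero a nul0z Pm.
have z5 a := nulE_zero a nul1w Pm.
rewrite ?(z1 _).1 ?(z1 _).2 ?(z2 _).1 ?(z2 _).2 ?(z3 _).1 ?(z3 _).2.
rewrite ?(z4 _).1 ?(z4 _).2 ?(z5 _).1 ?(z5 _).2 {z1 z2 z3 z4 z5}.
have m2 : q ^ (-2) = q ^- 2 by [].
have gC10 : gr typeC 1 0 = -2 by [].
have gC11 : gr typeC 1 1 = 2 by [].
rewrite gC10 gC11 m2 -exprnP => H.
have c0 : q + q^-1 != 0 by apply: (quantum2_neq0 q_neq0 q_not_root1 (n := 1)).
apply: (scalerI c0); rewrite -[RHS]addr0 -[in RHS]H; lincomb M; field => //.
Qed.

Lemma qcommutes_wx : qcommutes w x.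
Proof.
have rel : quad_rel (quad_ad 0 [:: (1, w, y); (- q, y, w)]).
  apply: (@quad_adP 0 _ (w ++ y)); first by rewrite wE; homogeneous.
  by apply/qcomm_quad/qcomm_wy.
exists (q / chi 0 w); first by rewrite mulf_neq0 ?invr_eq0 ?chi_neq0.
move=> m Pm; have := rel m Pm.
rewrite /quad_eval !big_cons big_nil /= -up0 wE.
have [-> ->] := nulE_zero y nul0w Pm.
have [c0 c1] := (chi_neq0 0 [:: 1%N, 0%N, 1%N & z], chi_neq0 0 y).
rewrite -wE; move=> H.
rewrite -[RHS]addr0 -[in RHS](scaler0 _ (chi 0 w)^-1) -[in RHS]H.
rewrite wE; lincomb M; field => //.
Qed.
End QcommC.

(** * Type D: blocks through the fork *)

Section QcommD.
Hypotheses (XD : X = typeD) (k_gt1 : (1 < k)%N).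
Let k_gt0 := ltnW k_gt1.
Let up1 : up k 1 = 1%N :: up k 2. Proof. exact: upS. Qed.
Local Notation z := (up k 2).
Local Notation fork := [:: 1%N, 0%N & z].

Lemma nulE_climbD m i : (m.+1 < k)%N -> (i < k)%N -> i <> m.+2 ->
  nulE (i :: climb 2 m fork).
Proof. exact: (nul_climbD q_neq0 q_not_root1 famE). Qed.

Lemma nulE_fork0 i : (i < k)%N -> i <> 1%N -> nulE [:: i, 0%N & z].
Proof. by move=> *; apply: (nul_fork0 q_neq0 q_not_root1 famE). Qed.

Lemma E_fork_swap m : P m -> E fork m = E [:: 0%N, 1%N & z] m.
Proof. by move=> Pm; apply: (sf_com famE); rewrite ?XD. Qed.

Let nul0fork : nulE [:: 0%N, 0%N, 1%N & z].
Proof.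
apply: (nul_eq (V := E) (y' := 0%N :: fork)).
  apply: (sf_eq famE) => [|m Pm]; last by rewrite E_fork_swap.
  by apply/permP => x /=; lia.
by apply: (@nulE_climbD 0).
Qed.

Let nul00 : nulE [:: 0%N, 0%N & z]. Proof. exact: nulE_fork0. Qed.

Let chi0z : chi 0 z = q^-1.
Proof.
rewrite /chi pr_up_next //; first by rewrite XD.
by move=> l ltl; rewrite XD; gram.
Qed.

Let chi1z : chi 1 z = q^-1.
Proof.
rewrite /chi pr_up_next //; first by rewrite XD.
by move=> l ltl; rewrite XD; gram.
Qed.

Let gk1 : (q ^ g k k.-1)^-1 = q.
Proof.
rewrite (_ : g k k.-1 = -1); first by rewrite -invr_expz invrK.
by rewrite XD; gram.
Qed.

Lemma qcomm_fork1 : qcomm q (1%N :: z) z.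
Proof. by rewrite -{1}gk1 -up1; apply: qcomm_up; rewrite ?XD. Qed.

(** This mirrors the case of the letter 1 under the symmetry of the fork; [k = 2] is separate
    because 0 is then joined to [k] itself. *)
Lemma qcomm_fork0 : qcomm q (0%N :: z) z.
Proof.
have [k_le2|k_gt2] := leqP k 2.
  have k2 : k = 2%N by lia.
  have gk0 : (q ^ g k 0)^-1 = q.
    rewrite (_ : g k 0 = -1); first by rewrite -invr_expz invrK.
    by rewrite XD k2.
  by rewrite -{1}gk0 up_nil //; apply: qcomm_base => //; rewrite XD k2.
have up2 : up k 2 = 2%N :: up k 3 by rewrite upS.
have rel : qcomm q (2%N :: up k 3) (up k 3).
  by rewrite -{1}gk1 -up2; apply: qcomm_up; rewrite ?XD.
have := qcomm_step (i := 0) rel; rewrite -up2.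
have <- : q = q * chi 0 (up k 3) / chi 2 (0%N :: up k 2).
  rewrite {1}/chi pr_up //; last by move=> l ltl; rewrite XD; gram.
  rewrite up2 !chi_cons /chi pr_up_next //; last by move=> l ltl; rewrite XD; gram.
  by rewrite XD /=; rewrite (_ : gr typeD 2 0 = -1) // (_ : gr typeD 2 2 = 2) //
    (_ : gr typeD 2 3 = -1) // -!invr_expz expr0z (_ : q ^ 2 = q ^+ 2) // expr1z; field;
    rewrite q_neq0 oner_eq0.
apply.
  by apply: (nul_up0D q_neq0 famE XD); lia.
by apply: nulE_fork0.
Qed.

Let rel1 : quad_rel (quad_ad 1 [:: (1, 0%N :: z, z); (- q, z, 0%N :: z)]).
Proof.
apply: (@quad_adP 1 _ (0%N :: z ++ z)); first by homogeneous.
by apply/qcomm_quad/qcomm_fork0.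
Qed.

Let rel0 : quad_rel (quad_ad 0 [:: (1, 1%N :: z, z); (- q, z, 1%N :: z)]).
Proof.
apply: (@quad_adP 0 _ (1%N :: z ++ z)); first by homogeneous.
by apply/qcomm_quad/qcomm_fork1.
Qed.

Let gD10 : gr typeD 1 0 = 0. Proof. by []. Qed.
Let gD01 : gr typeD 0 1 = 0. Proof. by []. Qed.
Let gD00 : gr typeD 0 0 = 2. Proof. by []. Qed.

(** Acting by 0 on the relation of [1 :: z] and [z], and by 1 on that of [0 :: z] and [z], gives the
    same products of the fork with [z]; they cancel in the difference. *)
Lemma qcomm_fork : qcomm 1 (0%N :: z) (1%N :: z).
Proof.
move=> m Pm; have := rel0 Pm; have := rel1 Pm.
rewrite /quad_eval !big_cons big_nil /= !chi_cons chi0z chi1z XD gD10 gD01 /= !addr0.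
rewrite -!E_fork_swap //; last exact: P_E.
move=> H1 H0; have c0 : q + q^-1 != 0.
  by apply: (quantum2_neq0 q_neq0 q_not_root1 (n := 1)).
apply: (scalerI c0); rewrite -[RHS]addr0 -[in RHS]H1.
rewrite -[RHS]subr0 -[in RHS]H0 !expr0z; lincomb M; field => //.
Qed.

Lemma qcommutes_fork : qcommutes fork (0%N :: z).
Proof.
exists q => // m Pm.
have rel : quad_rel (quad_ad 0 (quad_ad 0 [:: (1, 1%N :: z, z); (- q, z, 1%N :: z)])).
  apply: (@quad_adP 0 _ (0%N :: 1%N :: z ++ z)); last exact: rel0.
  by homogeneous.
have := rel m Pm.
rewrite /quad_eval !big_cons big_nil /= !chi_cons chi0z XD gD01 gD00 /=.
have z1 a := nulE_zero a nul00 Pm.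
have z2 a := nulE_zero a nul0fork Pm.
rewrite ?(z1 _).1 ?(z1 _).2 ?(z2 _).1 ?(z2 _).2.
rewrite -!E_fork_swap //; last exact: P_E.
move=> H; have c0 : q + q^-1 != 0.
  by apply: (quantum2_neq0 q_neq0 q_not_root1 (n := 1)).
apply: (scalerI c0); rewrite -[RHS]addr0 -[in RHS]H !expr0z -exprnP.
lincomb M; field => //.
Qed.

Lemma qcommutes_climbD m : (m.+2 < k)%N ->
  qcommutes (climb 2 m.+1 fork) (climb 2 m fork).
Proof.
move=> ltm; apply: qcommutes_climb; last by lia.
  rewrite climbS climb0; apply: qcommutes_step; first exact: qcommutes_fork.
    by apply: nulE_fork0; lia.
  by apply: (@nulE_climbD 1); lia.
by move=> i n le_n lti ne_i; apply: nulE_climbD; lia.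
Qed.

End QcommD.

(** * Descent of blocks on lowest vectors *)

Local Notation below := (all (fun i => i < k)%N).

(** This is what remains of minimality of a word ending in [k :: b ++ k :: s] after the suffix [s]
    has been removed: no smaller block can stand in the place of [b]. *)
Definition low (b : seq nat) (f : M) := lowest f /\
  forall b', below b' -> wlt b' b -> d k (dw b' (d k f)) = 0.

Lemma E_kill g a : (forall t, below t -> d k (dw t g) = 0) -> below a ->
  E a g = 0.
Proof.
elim: a g => [|i a IHa] g dg /=; first by rewrite E_nil (dg [::]).
case/andP=> lti lta; rewrite E_cons IHa // d0 IHa ?scaler0 ?subr0 // => t ltt.
by rewrite -[d i g]/(dw [:: i] g) -dw_cat dg // all_cat ltt /= lti.
Qed.

(** In every correction term of the q-commutator a letter below [k] acts on [g] before [k] does. *)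
Lemma E_word g a : (forall i t, (i < k)%N -> below t -> d k (dw t (d i g)) = 0) ->
  below a -> E a g = dw a (d k g).
Proof.
move=> dg; elim: a => [|i a IHa] /=; first by rewrite E_nil.
case/andP=> lti lta; rewrite E_cons IHa // (@E_kill (d i g)) //.
  by rewrite scaler0 subr0.
by move=> t ltt; apply: dg.
Qed.

Lemma lowest_E f a : lowest f -> below a -> E a f = dw a (d k f).
Proof.
case=> Pf df; apply: E_word => i t lti _.
by rewrite (df i lti) dw0 d0.
Qed.

Lemma low_E0 b f a b' : low b f -> below a -> below b' -> wlt b' b ->
  E a (E b' f) = 0.
Proof.
case=> lf df lta ltb' lt_b'b; rewrite (lowest_E lf) //; apply: E_kill => // t ltt.
by rewrite -dw_cat df ?all_cat ?ltt // wlt_catr.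
Qed.

Lemma low_E b f a : low b f -> below a -> below b ->
  E a (E b f) = dw a (d k (dw b (d k f))).
Proof.
case=> lf df lta ltb; rewrite (lowest_E lf) //; apply: E_word => // i t lti ltt.
rewrite -[d i _]/(dw (i :: b) _) -dw_cat df ?all_cat ?ltt /= ?lti //.
by rewrite wlt_catr // wlt_cons.
Qed.

Lemma low_drop b f t a : low b f -> below a -> below b -> E a (E b f) = 0 ->
  dw (t ++ a) (d k (dw b (d k f))) = 0.
Proof. by move=> lf lta ltb Eab; rewrite dw_cat -low_E // Eab dw0. Qed.

(** After the exchange [E a] acts on [f] first, where minimality of [b] forbids the smaller block
    [a]. *)
Lemma low_qcommutes b f a : low b f -> below a -> below b -> wlt a b ->
  qcommutes a b -> E a (E b f) = 0.
Proof.
move=> lf lta ltb lt_ab [c _ ->]; last by case: lf => -[].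
by rewrite (low_E0 lf) ?scaler0.
Qed.

Lemma low_next b f t i : low b f -> below (i :: b) -> qcommutes (i :: b) b ->
  dw (t ++ i :: b) (d k (dw b (d k f))) = 0.
Proof.
move=> lf ltib qib; have ltb : below b by case/andP: ltib.
by apply: low_drop => //; apply: low_qcommutes => //; apply: wlt_cons.
Qed.

Lemma low_up t j f : (0 < j <= k)%N -> above_fork X j.-1 -> low (up k j) f ->
  dw (t ++ up k j.-1) (d k (dw (up k j) (d k f))) = 0.
Proof.
move=> /andP[j_gt0 le_jk] jX lf; have upj : up k j.-1 = j.-1 :: up k j.
  by rewrite upS ?prednK //; lia.
rewrite upj; apply: low_next; rewrite // -upj ?below_up //.
by have := @qcommutes_up j.-1; rewrite prednK //; apply; lia.
Qed.

Lemma low_up2 i j f : (j <= k)%N -> wlt (up k i) (up k j) -> (i <= k)%N ->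
  above_fork X j.-1 -> low (up k j) f ->
  dw (up k i) (d k (dw (up k j) (d k f))) = 0.
Proof.
move=> le_jk lt_ij le_ik jX; have [le_ji|lt] := leqP j i.
  by move: lt_ij; rewrite (@up_split _ j i) ?le_ji // wlt_suffix.
by rewrite (@up_split _ i j.-1) => [|//]; [apply: low_up|]; lia.
Qed.

Lemma wlt_up_climb i lo n : wlt (up k i) (climb lo n (up k 0)) -> (i <= k)%N -> False.
Proof.
by move=> H le_ik; move: H; rewrite climb_cat (@up_split _ 0 i) // catA wlt_suffix.
Qed.

Lemma low_climb lo m n w f : below w -> (lo + n <= k)%N ->
  wlt (climb lo n w) (climb lo m w) ->
  ((m < n)%N -> qcommutes (climb lo m.+1 w) (climb lo m w)) ->
  low (climb lo m w) f ->
  dw (climb lo n w) (d k (dw (climb lo m w) (d k f))) = 0.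
Proof.
move=> ltw le_k lt_nm qm lf; have [le_nm|lt_mn] := leqP n m.
  by move: lt_nm; rewrite (climb_split _ _ le_nm) wlt_suffix.
rewrite (climb_split _ _ lt_mn) climbS; apply: low_next => //.
  by rewrite -climbS; apply: below_climb => //; lia.
by rewrite -climbS; apply: qm.
Qed.

Lemma low_fork0 t j f : X = typeD -> (1 < k)%N -> (0 < j <= k)%N ->
  low (up k j) f ->
  dw (t ++ 0%N :: up k 2) (d k (dw (up k j) (d k f))) = 0.
Proof.
move=> XD k_gt1 /andP[j_gt0 le_jk] lf.
have lt0 : below (0%N :: up k 2) by rewrite /= below_up; lia.
have [j_gt2|j_le2] := ltnP 2 j.
  rewrite (@up_split _ 2 j.-1); last by lia.
  by rewrite -cat_cons catA; apply: low_up => //; rewrite ?XD /=; lia.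
have [j1|j2] : j = 1%N \/ j = 2%N by lia.
  subst j; apply: low_drop => //; first exact: below_up.
  apply: (low_qcommutes lf) => //; first exact: below_up.
    by rewrite (upS k_gt1) -cat1s -[1%N :: _]cat1s wlt_cat2r.
  by exists 1; rewrite ?oner_eq0 // (upS k_gt1); apply: qcomm_fork.
by subst j; apply: low_next => //; exists q => //; apply: qcomm_fork0.
Qed.

(** Whenever [wlt a b] is possible, some suffix of [a] is still smaller than [b] and q-commutes with
    it; this suffix is mostly [b] with one more letter in front. The other combinations of path
    words contradict [wlt a b]. *)
Theorem block_drop a b f : pathp X k a -> pathp X k b -> wlt a b ->
  ~ (X = typeC /\ a = up k 0 /\ b = up k 1) -> low b f ->
  dw a (d k (dw b (d k f))) = 0.
Proof.
move=> pa pb lt_ab nspec lf.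
have [XA|XB|XC|XD] : [\/ X = typeA, X = typeB, X = typeC | X = typeD].
  by case: X; [constructor 1|constructor 2|constructor 3|constructor 4].
- move: pa pb; rewrite XA => -[i le_i eq_a] [j le_j eq_b]; subst a b.
  by apply: low_up2; rewrite ?XA.
- move: pa pb; rewrite XB => -[[i le_i eq_a]|[n len eq_a]] [[j le_j eq_b]|[m lem eq_b]]; subst a b.
  + by apply: low_up2; rewrite ?XB.
  + by case: (wlt_up_climb lt_ab).
  + have [j0|j_gt0] := posnP j.
      subst j; rewrite (@climb_split 0 1); last by lia.
      have := qcommutes_midB XB; rewrite climbS climb0 => qm.
      apply: low_next => //; last by apply: qm; lia.
      by rewrite /= below_up; lia.
    rewrite climb_cat (@up_split _ 0 j.-1) ?catA; last by lia.
    by apply: low_up => //; rewrite ?XB //; lia.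
  + apply: low_climb => //; [exact: below_up|lia|move=> lt_mn].
    apply: (@qcommutes_climb 0 m); [by apply: qcommutes_midB => //; lia| |lia].
    move=> i [|n'] le_n' lti ne_i; last by apply: nulE_climbB => //; lia.
    by rewrite climb0; apply: nulE_up; rewrite ?XB //=; lia.
- move: pa pb; rewrite XC => -[[i le_i eq_a]|[n len eq_a]] [[j le_j eq_b]|[m lem eq_b]]; subst a b.
  + have [j1|j_gt1] := leqP j 1; last by apply: low_up2; rewrite ?XC //=; lia.
    have [le_ji|lt_ij] := leqP j i.
      by move: lt_ab; rewrite (@up_split _ j i) ?le_ji // wlt_suffix.
    case: nspec; have -> : i = 0%N by lia.
    by have -> : j = 1%N by lia.
  + by case: (wlt_up_climb lt_ab).
  + have k_gt1 : (1 < k)%N by lia.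
    have [j_gt1|j_le1] := ltnP 1 j.
      rewrite climb_cat (@up_split _ 0 j.-1) ?catA; last by lia.
      by apply: low_up => //; rewrite ?XC //=; lia.
    rewrite (@climb_split 1 1); last by lia.
    have [j0|j1] : j = 0%N \/ j = 1%N by lia.
      have := qcommutes_wx XC k_gt1; rewrite climbS climb0 => qm.
      by subst j; apply: low_next => //; rewrite /= below_up; lia.
    (* The pair [up k 0], [up k 1] is exceptional, so the suffix must include the letter 1 in front
       of [up k 0]. *)
    subst j; apply: low_drop => //; [by apply: below_climb; rewrite ?below_up|exact: below_up|].
    apply: (low_qcommutes lf); [by apply: below_climb; rewrite ?below_up|exact: below_up| |].
      by rewrite climbS climb0 (upS (ltnW k_gt1)) (@wlt_catr [:: _]) ?wlt_cons.
    by exists q => //; apply: qcomm_wy.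
  + have k_gt1 : (1 < k)%N by lia.
    apply: low_climb => //; [exact: below_up|lia|move=> lt_mn].
    apply: (@qcommutes_climb 1 m); [exact: qcommutes_wx| |lia].
    by move=> i n' le_n' lti ne_i; apply: nulE_climbC => //; lia.
- have [k0|k_gt0] := posnP k.
    have nil c : below c -> c = [::] by rewrite k0; case: c.
    by move: lt_ab; rewrite (nil _ (pathp_below pa)) (nil _ (pathp_below pb)).
  have pathD c : pathp X k c ->
      [\/ exists2 j, (0 < j <= k)%N & c = up k j,
          (1 < k)%N /\ c = 0%N :: up k 2 |
          exists2 m, (m.+1 < k)%N & c = climb 2 m [:: 1%N, 0%N & up k 2]].
    rewrite XD; case=> [->|?|?|?];
      [constructor 1|by constructor 1|by constructor 2|by constructor 3].
    by exists k; rewrite ?k_gt0 ?leqnn ?up_nil.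
  have climb_fork n : climb 2 n [:: 1%N, 0%N & up k 2] =
      (rev (iota 2 n) ++ [:: 1%N]) ++ 0%N :: up k 2.
    by rewrite climb_cat -catA.
  have nwlt1 t : (1 < k)%N -> wlt (up k 1) (t ++ 0%N :: up k 2) = false.
    move=> k_gt1; rewrite (upS k_gt1) -(cat1s 1%N) -(cat1s 0%N) catA wlt_cat2r.
    by rewrite /wlt rev_cat.
  have nwlt2 i t : (1 < k)%N -> (0 < i <= k)%N -> wlt (up k i) (t ++ 0%N :: up k 2) = false.
    move=> k_gt1 /andP[i_gt0 le_ik]; have [i_gt1|i_le1] := ltnP 1 i.
      by rewrite -cat1s (@up_split _ 2 i) ?i_gt1 // !catA wlt_suffix.
    by have -> : i = 1%N; [lia|apply: nwlt1].
  have bfork : (1 < k)%N -> below [:: 1%N, 0%N & up k 2].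
    by move=> k_gt1 /=; rewrite below_up k_gt1 /= andbT; lia.
  case: (pathD _ pa) => [[i lei eq_a]|[k_gt1 eq_a]|[n len eq_a]];
  case: (pathD _ pb) => [[j lej eq_b]|[k_gt1' eq_b]|[m lem eq_b]]; subst a b.
  + have [j1|j_gt1] := leqP j 1; last by apply: low_up2; rewrite ?XD //=; lia.
    by move: lt_ab; rewrite (@up_split _ j i) ?wlt_suffix //; lia.
  + by move: lt_ab; rewrite (nwlt2 i [::]).
  + by move: lt_ab; rewrite climb_fork nwlt2 //; lia.
  + by apply: (@low_fork0 [::]).
  + by move: lt_ab; rewrite wlt_irr.
  + by move: lt_ab; rewrite climb_fork wlt_suffix.
  + by rewrite climb_fork; apply: low_fork0 => //; lia.
  + rewrite climb_fork -catA; apply: low_next => //; first exact: bfork.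
    exact: qcommutes_fork.
  + have k_gt1 : (1 < k)%N by lia.
    apply: low_climb => //; [exact: bfork|move=> lt_mn].
    by apply: qcommutes_climbD => //; lia.
Qed.

(** * Type C: sequences of exceptional blocks *)

Section DropC.
Hypothesis XC : X = typeC.
Local Notation x := (up k 0).
Local Notation y := (up k 1).
Local Notation z := (up k 2).
Local Notation w := (climb 1 1 x).

Lemma qcomm_xz : (1 < k)%N -> qcomm q x z.
Proof.
move=> k_gt1; have k_gt0 := ltnW k_gt1.
have rel : quad_rel (quad_ad 0 [:: (1, y, z); (- q, z, y)]).
  apply: (@quad_adP 0 _ (y ++ z)); first by homogeneous.
  apply/qcomm_quad; have := @qcomm_up 1; rewrite XC.
  have -> : (q ^ gr typeC k k.-1)^-1 = q.
    rewrite (_ : gr typeC k k.-1 = -1); first by rewrite -invr_expz invrK.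
    by gram.
  by apply.
have nul0z : nulE (0%N :: z) by apply: nulE_up; rewrite ?XC //=; lia.
move=> m Pm; have := rel m Pm.
rewrite /quad_eval !big_cons big_nil /= -(upS k_gt0).
have [-> ->] := nulE_zero y nul0z Pm.
have -> : chi 0 z = 1.
  by rewrite /chi pr_up // => l ltl; rewrite XC; gram.
move=> H; rewrite -[RHS]addr0 -[in RHS]H; lincomb M; ring.
Qed.

Variable f : M.
Hypotheses (k_gt0 : (0 < k)%N) (lf : low y f).
Local Notation h := (dw y (d k f)).
Let Pf : P f. Proof. by case: lf => -[]. Qed.
Let Ph : P h. Proof. by apply/P_dw/P_d. Qed.
Let wlt_xy : wlt x y. Proof. by rewrite (upS k_gt0) wlt_cons. Qed.

Let E_y : E y f = h. Proof. by apply: lowest_E; [case: lf|apply: below_up]. Qed.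

Let E_h a : below a -> E a h = dw a (d k h).
Proof.
apply: E_word => i t lti ltt; rewrite -[d i _]/(dw (i :: y) _) -dw_cat.
case: lf => _ ->; rewrite ?all_cat ?ltt //= ?lti ?below_up //.
by rewrite wlt_catr // wlt_cons.
Qed.

Let EE0 b a : below a -> below b -> wlt b y -> E a (E b f) = 0.
Proof. by move=> lta ltb; apply: low_E0. Qed.

Let low_w : (1 < k)%N -> below w /\ wlt w y.
Proof.
move=> k_gt1; split; first by apply: below_climb; rewrite ?below_up.
by rewrite climbS climb0 (wlt_catr [:: _]).
Qed.

Let E_wz : (1 < k)%N -> E w (E z f) = - q^-1 *: E x h.
Proof.
move=> k_gt1; have [ltw wlt_wy] := low_w k_gt1.
have := E_xy XC k_gt1 Pf; rewrite (EE0 _ _ wlt_xy) ?below_up //.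
rewrite (EE0 _ _ wlt_wy) ?below_up // E_y => ->.
lincomb M; field => //.
Qed.

(** In the exceptional relation applied to [h] only [E w (E z h)] survives. Exchanging blocks turns
    it into a multiple of [E y (E w (E z f))], hence of [E y (E x h)], where [x] is too small. *)
Lemma drop_xyy :
  (forall b, below b -> wlt b y -> d k (dw b (d k h)) = 0) ->
  dw x (d k (dw y (d k h))) = 0.
Proof.
(* For [k = 1] the word [w] contains [k] itself, so the quartic Serre relation is used directly. *)
move=> dh; have [k_le1|k_gt1] := leqP k 1.
  have k1 : k = 1%N by lia.
  have := d_qua (i := 1) (j := 0) _ _ _ Pf; rewrite k1 XC => /(_ isT isT isT).
  have d00 : d 0 f = 0 by case: lf => -[_ df] _; apply: df.
  have d101 : d 1 (d 0 (d 1 f)) = 0.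
    by case: lf => _ /(_ [:: 0%N]); rewrite k1 /=; apply.
  have : d 1 (d 0 (d 1 (d 1 f))) = 0.
    by have := dh [:: 0%N]; rewrite k1 /=; apply.
  move=> ->; rewrite d00 d101 !d0 !scaler0 subr0 addr0 sub0r => /eqP.
  by rewrite oppr_eq0 => /eqP.
have [ltw wlt_wy] := low_w k_gt1.
have Eb a b : below a -> below b -> wlt b y -> E a (E b h) = 0.
  move=> lta ltb lt_by; rewrite (E_h ltb); apply: E_kill => // t ltt.
  by rewrite -dw_cat dh ?all_cat ?ltt // wlt_catr.
have E_hh a : below a -> E a (dw y (d k h)) = dw a (d k (dw y (d k h))).
  apply: E_word => i t lti ltt; rewrite -[d i _]/(dw (i :: y) _) -dw_cat dh //.
    by rewrite all_cat ltt /= lti below_up.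
  by rewrite wlt_catr // wlt_cons.
rewrite -E_hh ?below_up // -E_h ?below_up // (E_xy XC k_gt1 Ph).
rewrite (Eb y x) ?(Eb z w) ?below_up //.
have [c c0 cyz] : qcommutes y z by apply: qcommutes_up; rewrite ?XC.
have -> : E z h = c^-1 *: E y (E z f).
  by rewrite cyz // E_y scalerA mulVf // scale1r.
rewrite EZ (qcomm_wy XC k_gt1); last exact: P_E.
by rewrite E_wz // EZ Eb ?below_up // !scaler0 addr0 subr0 scaler0.
Qed.

(** [E x h] is a multiple of [E w (E z f)]. A second [E x] passes both factors and reaches [f],
    where the block [x] is smaller than [y]. *)
Lemma drop_xxy :
  (forall b, below b -> wlt b x -> d k (dw b (d k h)) = 0) ->
  dw x (d k (dw x (d k h))) = 0.
Proof.
move=> dh; have [k_le1|k_gt1] := leqP k 1.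
  have k1 : k = 1%N by lia.
  have cub01 := d_cub (i := 0) (j := 1); have qua10 := d_qua (i := 1) (j := 0).
  rewrite k1 XC in cub01 qua10.
  have {}cub01 m Pm := cub01 m isT isT isT Pm.
  have {}qua10 m Pm := qua10 m isT isT isT Pm.
  have d00 : d 0 f = 0 by case: lf => -[_ df] _; apply: df.
  have d101 : d 1 (d 0 (d 1 f)) = 0.
    by case: lf => _ /(_ [:: 0%N]); rewrite k1 /=; apply.
  have d001 : d 0 (d 0 (d 1 f)) = 0.
    by have := cub01 f Pf; rewrite d00 !d0 scaler0 subr0 addr0.
  have d0011 : d 0 (d 0 (d 1 (d 1 f))) = 0.
    have := cub01 (d 1 f) (P_d _ Pf).
    by rewrite d101 d001 !d0 scaler0 subr0 addr0.
  have d0111 : d 0 (d 1 (d 1 (d 1 f))) =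
      (q ^+ 2 + 1 + q ^- 2) *: d 1 (d 0 (d 1 (d 1 f))).
    have := qua10 f Pf; rewrite d00 d101 !d0 scaler0 subr0 add0r => /eqP.
    by rewrite subr_eq0 => /eqP.
  have := cub01 (d 1 (d 1 f)) (P_d _ (P_d _ Pf)); rewrite d0111 d0011 d0 addr0 dZ.
  have -> : q ^ gr typeC 0 1 = q ^- 2 by [].
  (* The quartic relation contributes $q^2+1+q^{-2}$ and the cubic one $q^2+q^{-2}$; their
     difference is 1. *)
  rewrite invrK -scalerBl (_ : _ - _ = 1); last by ring.
  by rewrite k1 /= scale1r.
have [ltw wlt_wy] := low_w k_gt1.
have E_hh a : below a -> E a (dw x (d k h)) = dw a (d k (dw x (d k h))).
  apply: E_word => i t lti ltt; rewrite -[d i _]/(dw (i :: x) _) -dw_cat dh //.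
    by rewrite all_cat ltt /= lti below_up.
  by rewrite wlt_catr // wlt_cons.
rewrite -E_hh ?below_up // -E_h ?below_up //.
have -> : E x h = - q *: E w (E z f).
  by rewrite E_wz // scalerA mulrNN mulfV // scale1r.
have [c c0 cwx] := qcommutes_wx XC k_gt1.
have -> : E x (- q *: E w (E z f)) = (- q / c) *: E w (E x (E z f)).
  rewrite EZ cwx; last exact: P_E.
  by rewrite scalerA mulfVK.
rewrite (qcomm_xz k_gt1) // (EE0 _ _ wlt_xy) ?below_up //.
by rewrite scaler0 E0 scaler0.
Qed.

End DropC.

End SerreModule.

(** * Removal of the last letter *)

Section TwistedDerivation.
Variables (K : fieldType) (M : lmodType K) (I : Type).
Variables (d t : I -> M -> M) (m : M -> M -> M) (p : I -> I -> K).
Local Notation "x ** y" := (m x y) (at level 40, left associativity).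
Hypothesis d_lin : forall i c x y, d i (c *: x + y) = c *: d i x + d i y.
Hypothesis t_lin : forall i c x y, t i (c *: x + y) = c *: t i x + t i y.
Hypothesis m_linl : forall z c x y, (c *: x + y) ** z = c *: (x ** z) + y ** z.
Hypothesis m_linr : forall z c x y, z ** (c *: x + y) = c *: (z ** x) + z ** y.
Hypothesis d_m : forall i x y, d i (x ** y) = d i x ** y + t i x ** d i y.
Hypothesis t_d : forall i j x, t i (d j x) = p i j *: d j (t i x).
Hypothesis t_com : forall i j x, t i (t j x) = t j (t i x).

Let lin_scale (f : M -> M) :
  (forall c x y, f (c *: x + y) = c *: f x + f y) ->
  (forall x y, f (x + y) = f x + f y) * (forall c x, f (c *: x) = c *: f x).
Proof.
move=> fl; have fD x y : f (x + y) = f x + f y.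
  by have := fl 1 x y; rewrite !scale1r.
have f0 : f 0 = 0 by apply: (addIr (f 0)); rewrite -fD !add0r.
by split=> // c x; have := fl c x 0; rewrite f0 !addr0.
Qed.
Let dD i x y : d i (x + y) = d i x + d i y.
Proof. by rewrite (lin_scale (d_lin i)). Qed.
Let dZ i c x : d i (c *: x) = c *: d i x.
Proof. by rewrite (lin_scale (d_lin i)). Qed.
Let tZ i c x : t i (c *: x) = c *: t i x.
Proof. by rewrite (lin_scale (t_lin i)). Qed.
Let mDr x y z : z ** (x + y) = z ** x + z ** y.
Proof. by rewrite (lin_scale (m_linr z)). Qed.
Let mDl x y z : (x + y) ** z = x ** z + y ** z.
Proof. by rewrite (@lin_scale (fun x => x ** z)). Qed.
Let mZl c x z : (c *: x) ** z = c *: (x ** z).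
Proof. by rewrite (lin_scale (fun c x y => m_linl z c x y)). Qed.
Let mZr c x z : z ** (c *: x) = c *: (z ** x).
Proof. by rewrite (lin_scale (m_linr z)). Qed.
Let NZ (x : M) : - x = (-1) *: x.
Proof. by rewrite scaleN1r. Qed.
Let expand := (d_m, t_d, tZ, dD, dZ, mDl, mDr, mZl, mZr).

(** The Serre expressions in twisted derivations are again twisted derivations (skew-primitive):
    with these values of [p] all mixed terms of the Leibniz expansion cancel. *)
Lemma leibniz_com i j : p i j = 1 -> p j i = 1 ->
  forall x y, (d i (d j (x ** y)) - d j (d i (x ** y))) =
    (d i (d j x) - d j (d i x)) ** y
    + t i (t j x) ** (d i (d j y) - d j (d i y)).
Proof.
move=> pij pji x y; rewrite !NZ !expand pij pji (t_com j i).
by lincomb M; ring.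
Qed.

Lemma leibniz_cub i j u : u != 0 -> p i i = u ^- 2 -> p i j = u -> p j i = u ->
  let T x := d i (d i (d j x)) - (u + u^-1) *: d i (d j (d i x)) + d j (d i (d i x)) in
  forall x y, T (x ** y) = T x ** y + t i (t i (t j x)) ** T y.
Proof.
move=> u0 pii pij pji T x y; rewrite /T !NZ !expand pii pij pji !(t_com j i).
by lincomb M; field.
Qed.

Lemma leibniz_qua i j u : u != 0 -> p i i = u ^+ 2 -> p i j = u ^- 2 -> p j i = u ^- 2 ->
  let c := u ^+ 2 + 1 + u ^- 2 in
  let T x := d i (d i (d i (d j x))) - c *: d i (d i (d j (d i x)))
             + c *: d i (d j (d i (d i x))) - d j (d i (d i (d i x))) in
  forall x y, T (x ** y) = T x ** y + t i (t i (t i (t j x))) ** T y.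
Proof.
move=> u0 pii pij pji c T x y; rewrite /T /c !NZ !expand pii pij pji !(t_com j i).
by lincomb M; field.
Qed.

End TwistedDerivation.

(** * Linear maps on the free algebra, given on words *)

Section FreeAlgebra.
Variables (K : fieldType) (r : nat).
Local Notation F := (freealg K r).

(* Locked copies of word elements and of appending a letter: unification must
   not unfold the monoid algebra. *)
Definition wd : seq 'I_r -> F := locked (fun s => << mkword s >>).
Definition snoc (i : 'I_r) : F -> F := locked (fun f => f * letter i).

Lemma wdE s : wd s = << mkword s >>.
Proof. by rewrite /wd; unlock. Qed.

Lemma snocE i f : snoc i f = f * letter i.
Proof. by rewrite /snoc; unlock. Qed.

Lemma snoc_wd i s : snoc i (wd s) = wd (rcons s i).
Proof. by rewrite snocE !wdE mul_word_letter. Qed.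

Lemma letter_wd i : letter i = wd [:: i].
Proof. by rewrite wdE. Qed.

Lemma one_wd : 1 = wd [::].
Proof. by rewrite wdE; congr << _ >>; apply/eqP; rewrite fmP fm1. Qed.

Lemma mcoeff_wd s (u : word r) : (wd s)@_u = (s == u)%:R.
Proof. by rewrite wdE mcoeffU1 fmP. Qed.

Lemma wd_decomp (f : F) : f = \sum_(u <- msupp f) f@_u *: wd u.
Proof.
rewrite [LHS]monalgE; apply: eq_bigr => u _; apply/malgP => v.
by rewrite mcoeffZ mcoeff_wd mcoeffU mulr_natr fmP.
Qed.

Definition lin (V : lmodType K) (phi : F -> V) :=
  forall c x y, phi (c *: x + y) = c *: phi x + phi y.

Section Lin.
Variables (V : lmodType K) (phi : F -> V).
Hypothesis phi_lin : lin phi.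

Lemma linD x y : phi (x + y) = phi x + phi y.
Proof. by have := phi_lin 1 x y; rewrite !scale1r. Qed.

Lemma lin0 : phi 0 = 0.
Proof. by apply: (addIr (phi 0)); rewrite -linD !add0r. Qed.

Lemma linZ c x : phi (c *: x) = c *: phi x.
Proof. by have := phi_lin c x 0; rewrite lin0 !addr0. Qed.

Lemma lin_sum (I : Type) (s : seq I) (G : I -> F) :
  phi (\sum_(i <- s) G i) = \sum_(i <- s) phi (G i).
Proof.
by elim: s => [|i s IHs]; rewrite ?big_nil ?lin0 // !big_cons linD IHs.
Qed.
End Lin.

Lemma lin_eq (V : lmodType K) (phi psi : F -> V) : lin phi -> lin psi ->
  (forall s, phi (wd s) = psi (wd s)) -> forall f, phi f = psi f.
Proof.
move=> lphi lpsi eq_u f; rewrite (wd_decomp f) !lin_sum //.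
by apply: eq_bigr => u _; rewrite !linZ // eq_u.
Qed.

Definition extend : (seq 'I_r -> F) -> F -> F :=
  locked (fun (h : seq 'I_r -> F) (f : F) =>
    \sum_(u <- msupp f) f@_u *: h (u : word r)).

Lemma extendEw (h : seq 'I_r -> F) (f : F) (D : {fset word r}) :
  (msupp f `<=` D)%fset -> extend h f = \sum_(u <- D) f@_u *: h u.
Proof.
rewrite /extend; unlock; move=> le; apply: (big_fset_incl _ le) => u _.
by move/mcoeff_outdom->; rewrite scale0r.
Qed.

Lemma extend_lin h : lin (extend h).
Proof.
move=> c x y; set D := (msupp (c *: x + y) `|` (msupp x `|` msupp y))%fset.
rewrite !(@extendEw h _ D) /D ?fsubsetUl //; last first.
- by rewrite fsubsetU // fsubsetUl orbT.
- by rewrite fsubsetU // fsubsetUr orbT.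
rewrite scaler_sumr -big_split; apply: eq_bigr => u _ /=.
by rewrite mcoeffD mcoeffZ scalerDl scalerA.
Qed.

Lemma extend_wd h s : extend h (wd s) = h s.
Proof.
rewrite wdE (@extendEw h _ [fset mkword s]%fset) ?msuppU_le //.
by rewrite big_seq_fset1 mcoeffUU scale1r.
Qed.

Lemma mcoeff_lin (u : word r) : lin (fun f : F => f@_u : K^o).
Proof. by move=> c x y; rewrite mcoeffD mcoeffZ. Qed.

Lemma snoc_lin i : lin (snoc i).
Proof. by move=> c x y; rewrite !snocE mulrDl scalerAl. Qed.

Definition dlast (i : 'I_r) : F -> F := extend (fun s =>
  if rev s is j :: v then if j == i then wd (rev v) else 0 else 0).

Lemma dlast_lin i : lin (dlast i).
Proof. exact: extend_lin. Qed.

Lemma dlast_wd i j (u : seq 'I_r) :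
  dlast i (wd (rcons u j)) = if j == i then wd u else 0.
Proof. by rewrite /dlast extend_wd rev_rcons revK. Qed.

Lemma dlast_nil i : dlast i (wd [::]) = 0.
Proof. by rewrite /dlast extend_wd. Qed.

Lemma dlast_snoc i j f : dlast i (snoc j f) = if j == i then f else 0.
Proof.
move: f; apply: lin_eq.
- by move=> c x y; rewrite snoc_lin dlast_lin.
- by move=> c x y; case: eqP => // _; rewrite scaler0 addr0.
- by move=> u; rewrite snoc_wd dlast_wd.
Qed.

Lemma mcoeff_dlast i f (u : seq 'I_r) :
  (dlast i f)@_(mkword u) = f@_(mkword (rcons u i)).
Proof.
move: f; apply: (lin_eq (V := K^o)); [|exact: mcoeff_lin|].
  by move=> c x y; rewrite dlast_lin mcoeff_lin.
move=> v; rewrite mcoeff_wd /=; case/lastP: v => [|v j].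
  by rewrite dlast_nil mcoeff0; case: u.
rewrite dlast_wd eqseq_rcons; have [_|_] := eqVneq j i; last first.
  by rewrite andbF mcoeff0.
by rewrite andbT mcoeff_wd.
Qed.

End FreeAlgebra.

(** * The form on weights as a sum over letters *)

Section FormGram.
Variables (X : classical_type) (r : nat).

Lemma formDl (a b c : 'rV[int]_r) :
  Defs.form X (a + b) c = Defs.form X a c + Defs.form X b c.
Proof. by rewrite /Defs.form !mulmxDl mxE. Qed.

Lemma form0l (c : 'rV[int]_r) : Defs.form X 0 c = 0.
Proof. by rewrite /Defs.form !mul0mx mxE. Qed.

Lemma form_simple (i j : 'I_r) :
  Defs.form X (simple_root i) (simple_root j) = gr X i j.
Proof.
rewrite /Defs.form /simple_root trmx_delta -rowE -colE !mxE /gr /joined.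
by rewrite -val_eqE /half_len /hlen; case: X.
Qed.

Lemma weight_rcons (u : seq 'I_r) i : weight (rcons u i) = weight u + simple_root i.
Proof. by rewrite /weight -cats1 big_cat big_seq1. Qed.

Definition wform (u : seq 'I_r) (j : 'I_r) : int := \sum_(i <- u) gr X i j.

Lemma wform_nil j : wform [::] j = 0.
Proof. exact: big_nil. Qed.

Lemma wform_cons i u j : wform (i :: u) j = gr X i j + wform u j.
Proof. exact: big_cons. Qed.

Lemma wform_cat u v j : wform (u ++ v) j = wform u j + wform v j.
Proof. exact: big_cat. Qed.

Lemma wform_rcons u i j : wform (rcons u i) j = wform u j + gr X i j.
Proof. by rewrite -cats1 wform_cat wform_cons wform_nil addr0. Qed.

Lemma form_weight (u : seq 'I_r) (j : 'I_r) :
  Defs.form X (weight u) (simple_root j) = wform u j.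
Proof.
elim: u => [|i u IHu]; first by rewrite /weight big_nil form0l wform_nil.
by rewrite weight_cons formDl IHu form_simple wform_cons addrC.
Qed.

End FormGram.

(** * Leibniz rule and Serre relations on the shuffle algebra *)

Section ShuffleDerivation.
Variables (K : fieldType) (q : K) (X : classical_type) (r : nat).
Hypothesis q_neq0 : q != 0.
Local Notation F := (freealg K r).
Local Notation wform := (wform X).
Let FM : lmodType K := F.

Definition qsh : F -> F -> F := locked (fun x y => qshuffle q X x y).
Local Notation "x ** y" := (qsh x y) (at level 40, left associativity).

Lemma qshE x y : x ** y = qshuffle q X x y.
Proof. by rewrite /qsh; unlock. Qed.

Lemma qsh_linl y : lin (fun x : F => x ** y).
Proof. by move=> c x x'; rewrite !qshE; apply: qshuffle_linearl. Qed.

Lemma qsh_linr x : lin (fun y : F => x ** y).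
Proof. by move=> c y y'; rewrite !qshE; apply: qshuffle_linearr. Qed.

Lemma qshDl y x x' : (x + x') ** y = x ** y + x' ** y.
Proof. exact: (linD (qsh_linl y)). Qed.

Lemma qshDr x y y' : x ** (y + y') = x ** y + x ** y'.
Proof. exact: (linD (qsh_linr x)). Qed.

Lemma qshZl c x y : (c *: x) ** y = c *: (x ** y).
Proof. exact: (linZ (qsh_linl y)). Qed.

Lemma qshZr c x y : x ** (c *: y) = c *: (x ** y).
Proof. exact: (linZ (qsh_linr x)). Qed.

Lemma qsh0l y : 0 ** y = 0.
Proof. exact: (lin0 (qsh_linl y)). Qed.

Lemma qsh0r x : x ** 0 = 0.
Proof. exact: (lin0 (qsh_linr x)). Qed.

Lemma qsh_nil_l y : wd K [::] ** y = y.
Proof.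
move: y; apply: lin_eq => [|c x y //|u]; first exact: qsh_linr.
by rewrite -one_wd qshE wdE qshuffle_word1l.
Qed.

Lemma qsh_nil_r x : x ** wd K [::] = x.
Proof.
move: x; apply: lin_eq => [|c x y //|u]; first exact: qsh_linl.
by rewrite -one_wd qshE wdE qshuffle_word1r.
Qed.

Lemma qsh_rcons u v i j :
  wd K (rcons u i) ** wd K (rcons v j) =
    snoc i (wd K u ** wd K (rcons v j))
    + q ^ (- wform (rcons u i) j) *: snoc j (wd K (rcons u i) ** wd K v).
Proof.
have := qshuffle_word_rcons q X (mkword u) (mkword v) i j.
rewrite !mul_word_letter -weight_rcons form_weight.
by rewrite !snocE !qshE !wdE.
Qed.

(** This is the action of $K_i^{-1}$ on weight spaces, the twist acquired when the removed letter
    comes from the second factor. *)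
Definition kop (i : 'I_r) : F -> F := extend (fun u => q ^ (- wform u i) *: wd K u).

Lemma kop_lin i : lin (kop i).
Proof. exact: extend_lin. Qed.

Lemma kop_wd i u : kop i (wd K u) = q ^ (- wform u i) *: wd K u.
Proof. exact: extend_wd. Qed.

Lemma kop_com i j x : kop i (kop j x) = kop j (kop i x).
Proof.
move: x; apply: lin_eq => [c x y|c x y|u]; [by rewrite !kop_lin|by rewrite !kop_lin|].
by rewrite !kop_wd !(linZ (@kop_lin _)) !kop_wd !scalerA mulrC.
Qed.

Lemma kop_dlast i j x :
  kop i (dlast j x) = q ^ gr X j i *: dlast j (kop i x).
Proof.
move: x; apply: lin_eq => [c x y|c x y|u].
- by rewrite dlast_lin kop_lin.
- by rewrite kop_lin dlast_lin scalerDr !scalerA mulrC.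
rewrite kop_wd (linZ (dlast_lin j)); case/lastP: u => [|u l].
  by rewrite dlast_nil !scaler0 (lin0 (@kop_lin i)).
rewrite dlast_wd; have [->|_] := eqVneq l j; last first.
  by rewrite (lin0 (@kop_lin i)) !scaler0.
rewrite kop_wd scalerA wform_rcons -(expfzDr _ _ q_neq0).
by apply: (f_equal (fun e => q ^ e *: _)); ring.
Qed.

(** On words this is the recursion of the shuffle product on last letters. *)
Lemma dlast_qsh i x y : dlast i (x ** y) = dlast i x ** y + kop i x ** dlast i y.
Proof.
move: x; apply: lin_eq => [c x x'|c x x'|u].
- by rewrite qsh_linl dlast_lin.
- by rewrite dlast_lin kop_lin !qsh_linl; lincomb FM; ring.
move: y; apply: lin_eq => [c y y'|c y y'|v].
- by rewrite qsh_linr dlast_lin.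
- by rewrite dlast_lin !qsh_linr; lincomb FM; ring.
rewrite kop_wd.
case/lastP: u => [|u a].
  by rewrite wform_nil oppr0 expr0z scale1r dlast_nil !qsh_nil_l qsh0l add0r.
case/lastP: v => [|v b].
  by rewrite dlast_nil qsh0r addr0 !qsh_nil_r.
rewrite qsh_rcons (linD (dlast_lin i)) (linZ (dlast_lin i)) !dlast_snoc !dlast_wd.
congr (_ + _); first by case: eqP => // _; rewrite qsh0l.
have [->|_] := eqVneq b i; first by rewrite qshZl.
by rewrite qsh0r !scaler0.
Qed.

Lemma kop_snoc i j f : kop i (snoc j f) = q ^ (- gr X j i) *: snoc j (kop i f).
Proof.
move: f; apply: lin_eq => [c f f'|c f f'|u].
- by rewrite snoc_lin kop_lin.
- by rewrite kop_lin snoc_lin; lincomb FM; ring.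
rewrite snoc_wd !kop_wd (linZ (@snoc_lin _ _ j)) snoc_wd scalerA -(expfzDr _ _ q_neq0).
by rewrite wform_rcons; apply: (f_equal (fun e => q ^ e *: _)); ring.
Qed.

Lemma kop_qsh i x y : kop i (x ** y) = kop i x ** kop i y.
Proof.
move: x; apply: lin_eq => [c x x'|c x x'|u].
- by rewrite qsh_linl kop_lin.
- by rewrite kop_lin !qsh_linl.
move: y; apply: lin_eq => [c y y'|c y y'|v].
- by rewrite qsh_linr kop_lin.
- by rewrite kop_lin !qsh_linr.
rewrite !kop_wd qshZl qshZr scalerA.
have [n] := ubnP (size u + size v); elim: n u v => // n IHn u v ltn.
case/lastP: u ltn => [|u a] ltn.
  by rewrite wform_nil oppr0 expr0z mul1r !qsh_nil_l kop_wd.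
case/lastP: v ltn => [|v b] ltn.
  by rewrite wform_nil oppr0 expr0z mulr1 !qsh_nil_r kop_wd.
rewrite qsh_rcons (linD (kop_lin i)) (linZ (kop_lin i)) !kop_snoc.
rewrite !IHn; try by move: ltn; rewrite !size_rcons; lia.
rewrite !(linZ (@snoc_lin _ _ _)) !scalerA scalerDr !scalerA -!(expfzDr _ _ q_neq0).
rewrite !wform_rcons.
by apply: f_equal2; apply: (f_equal (fun e => q ^ e *: _)); ring.
Qed.

Lemma dlD i (x y : F) : dlast i (x + y) = dlast i x + dlast i y.
Proof. exact: (linD (@dlast_lin K r i)). Qed.

Lemma dlZ i c (x : F) : dlast i (c *: x) = c *: dlast i x.
Proof. exact: (linZ (@dlast_lin K r i)). Qed.

Lemma dl0 i : dlast i 0 = 0 :> F.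
Proof. exact: (lin0 (@dlast_lin K r i)). Qed.

Lemma kopD i (x y : F) : kop i (x + y) = kop i x + kop i y.
Proof. exact: (linD (@kop_lin i)). Qed.

Lemma kopZ i c (x : F) : kop i (c *: x) = c *: kop i x.
Proof. exact: (linZ (@kop_lin i)). Qed.

Lemma dlast_letter (i j : 'I_r) :
  dlast i (letter j) = if j == i then wd K [::] else 0 :> F.
Proof. by rewrite letter_wd (dlast_wd K i j [::]). Qed.

Lemma dlast2_letter (i j l : 'I_r) : dlast i (dlast j (letter l)) = 0 :> F.
Proof. by rewrite dlast_letter; case: eqP; rewrite ?dlast_nil ?dl0. Qed.

Lemma in_W_qsh (x y : F) : in_W q X x -> in_W q X y -> in_W q X (x ** y).
Proof. by rewrite qshE; apply: in_W_mul. Qed.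

Lemma in_W_lin c (x y : F) : in_W q X x -> in_W q X y -> in_W q X (c *: x + y).
Proof. by move=> Wx Wy; apply: in_W_add => //; apply: in_W_scale. Qed.

Lemma in_W_0 : in_W q X (0 : F).
Proof. by rewrite -(scale0r 1); apply/in_W_scale/in_W_one. Qed.

Lemma in_W_kop i (x : F) : in_W q X x -> in_W q X (kop i x).
Proof.
elim=> [j||y z _ Wy _ Wz|c y _ Wy|y z _ Wy _ Wz].
- by rewrite letter_wd kop_wd -letter_wd; apply/in_W_scale/in_W_letter.
- by rewrite one_wd kop_wd -one_wd; apply/in_W_scale/in_W_one.
- by rewrite kopD; apply: in_W_add.
- by rewrite kopZ; apply: in_W_scale.
- by rewrite -qshE kop_qsh; apply: in_W_qsh.
Qed.

Lemma in_W_dlast i (x : F) : in_W q X x -> in_W q X (dlast i x).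
Proof.
elim=> [j||y z _ Wy _ Wz|c y _ Wy|y z Wy Wdy Wz Wdz].
- rewrite dlast_letter -one_wd; case: eqP => _; [exact: in_W_one|exact: in_W_0].
- by rewrite one_wd dlast_nil; apply: in_W_0.
- by rewrite dlD; apply: in_W_add.
- by rewrite dlZ; apply: in_W_scale.
- rewrite -qshE dlast_qsh; apply: in_W_add; apply: in_W_qsh => //.
  exact: in_W_kop.
Qed.

(** A twisted derivation is determined by its values on generators. *)
Lemma in_W_kill (T L : F -> F) : lin T ->
  (forall x y, T (x ** y) = T x ** y + L x ** T y) ->
  T (wd K [::]) = 0 -> (forall i, T (letter i) = 0) ->
  forall x : F, in_W q X x -> T x = 0.
Proof.
move=> linT TM T1 Tl x; elim=> [j||y z _ Wy _ Wz|c y _ Wy|y z _ Wy _ Wz].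
- exact: Tl.
- by rewrite one_wd.
- by rewrite (linD linT) Wy Wz addr0.
- by rewrite (linZ linT) Wy scaler0.
- by rewrite -qshE TM Wy Wz qsh0l qsh0r addr0.
Qed.

Let p (i j : 'I_r) : K := q ^ gr X j i.

Let kop_dlast' i j x : kop i (dlast j x) = p i j *: dlast j (kop i x).
Proof. exact: kop_dlast. Qed.

Lemma dlast_com (i j : 'I_r) (x : F) : com X i j -> in_W q X x ->
  dlast i (dlast j x) = dlast j (dlast i x).
Proof.
move=> cij Wx; apply/eqP; rewrite -subr_eq0; apply/eqP; move: x Wx.
apply: (@in_W_kill _ (fun x => kop i (kop j x))).
- by move=> c x y; rewrite !dlast_lin; lincomb FM; ring.
- by apply: (@leibniz_com K FM _ (@dlast K r) kop qsh p (@dlast_lin K r)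
    qsh_linl qsh_linr dlast_qsh kop_dlast' kop_com); rewrite /p ?(gr_sym X j i) (eqP cij).
- by rewrite !dlast_nil !dl0 subr0.
- by move=> l; rewrite !dlast2_letter subr0.
Qed.

Lemma dlast_cub (i j : 'I_r) (x : F) : cub X i j -> in_W q X x ->
  dlast i (dlast i (dlast j x))
  - (q ^ gr X i j + (q ^ gr X i j)^-1) *: dlast i (dlast j (dlast i x))
  + dlast j (dlast i (dlast i x)) = 0.
Proof.
move=> cij; move: x; apply: (@in_W_kill _ (fun x => kop i (kop i (kop j x)))).
- by move=> c x y; rewrite !dlast_lin; lincomb FM; ring.
- apply: (@leibniz_cub K FM _ (@dlast K r) kop qsh p (@dlast_lin K r) kop_lin
    qsh_linl qsh_linr dlast_qsh kop_dlast' kop_com); rewrite /p ?(gr_sym X j i) //.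
    exact: expfz_neq0.
  exact: cub_pow.
- by rewrite !dlast_nil !dl0 scaler0 subr0 addr0.
- by move=> l; rewrite !dlast2_letter !dl0 scaler0 subr0 addr0.
Qed.

Lemma dlast_qua (i j : 'I_r) (x : F) : qua X i j -> in_W q X x ->
  dlast i (dlast i (dlast i (dlast j x)))
  - (q ^+ 2 + 1 + q ^- 2) *: dlast i (dlast i (dlast j (dlast i x)))
  + (q ^+ 2 + 1 + q ^- 2) *: dlast i (dlast j (dlast i (dlast i x)))
  - dlast j (dlast i (dlast i (dlast i x))) = 0.
Proof.
move=> qij; move: x; apply: (@in_W_kill _ (fun x => kop i (kop i (kop i (kop j x))))).
- by move=> c x y; rewrite !dlast_lin; lincomb FM; ring.
- have [gii gij] := qua_pow q qij.
  by apply: (@leibniz_qua K FM _ (@dlast K r) kop qsh p (@dlast_lin K r) kop_lin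
    qsh_linl qsh_linr dlast_qsh kop_dlast' kop_com); rewrite /p ?(gr_sym X j i).
- by rewrite !dlast_nil !dl0 !scaler0 !subr0 addr0.
- by move=> l; rewrite !dlast2_letter !dl0 !scaler0 !subr0 addr0.
Qed.

End ShuffleDerivation.

(** * Good Lyndon words are root words *)

Lemma nlex_catk k u v s t : all (fun i => i < k)%N u -> nlex u v ->
  nlex (u ++ s) (v ++ k :: t).
Proof.
elim: u v => [|i u IHu] [|j v] //= /andP[lti ltu]; first by rewrite lti.
by case/orP=> [->//|/andP[-> /(IHu _ ltu)->]]; rewrite orbT.
Qed.

Lemma lex_ltE r (u v : seq 'I_r) : lex_lt u v = nlex (map val u) (map val v).
Proof. by elim: u v => [|i u IHu] [|j v] //=; rewrite -val_eqE IHu. Qed.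

Lemma word_ltE r (u v : seq 'I_r) : word_lt u v = wlt (map val u) (map val v).
Proof. by rewrite /word_lt lex_ltE /wlt -!map_rev. Qed.

Section GoodWord.
Variables (K : fieldType) (q : K) (X : classical_type) (r' : nat).
Local Notation r := r'.+1.
Local Notation F := (freealg K r).
Hypothesis q_neq0 : q != 0.
Hypothesis q_not_root1 : forall n, q ^+ n.+1 != 1.
Local Notation small := (all (fun i => i < r)%N).

(** [inord] sends a number outside the alphabet to the letter 0, whence the guards [small] below. *)
Definition nword (s : seq nat) : word r := mkword (map inord s).
Definition dn (n : nat) : F -> F := dlast (inord n).

Lemma letters_nword s : small s -> letters (nword s) = s.
Proof.
move=> lts; rewrite /letters /nword /= -map_comp -[RHS]map_id; apply/eq_in_map.
by move=> i /(allP lts) lti /=; rewrite inordK.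
Qed.

Lemma nword_letters (w : word r) : nword (letters w) = w.
Proof.
apply/eqP; rewrite fmP /= -map_comp -[X in _ == X]map_id; apply/eqP/eq_map => i /=.
exact: inord_val.
Qed.

Lemma small_letters (w : word r) : small (letters w).
Proof. by apply/allP => _ /mapP[i _ ->]; apply: ltn_ord. Qed.

Lemma mcoeff_dw s t f : (dw dn s f)@_(nword t) = f@_(nword (t ++ s)).
Proof.
elim: s t => [|i s IHs] t; first by rewrite cats0.
by rewrite /= mcoeff_dlast -map_rcons -/(nword _) IHs cat_rcons.
Qed.

Lemma dn_eq0 (f : F) : (forall t, small t -> f@_(nword t) = 0) -> f = 0.
Proof.
move=> f0; apply/malgP => u; rewrite mcoeff0 -(nword_letters u).
exact/f0/small_letters.
Qed.

Lemma serre_module_W k : (k < r)%N -> serre_module q X k (@in_W K q X r) dn.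
Proof.
move=> ltk; have inK i : (i <= k)%N -> (inord i : 'I_r) = i :> nat.
  by move=> le_ik; rewrite inordK // (leq_ltn_trans le_ik).
split.
- by move=> i c x y; apply: dlast_lin.
- by move=> c x y; apply: in_W_lin.
- by move=> i x; apply: in_W_dlast.
- move=> i j x /inK iK /inK jK cij Wx; apply: dlast_com Wx => //.
  by rewrite iK jK.
- move=> i j x /inK iK /inK jK cij Wx; rewrite -{4 5}iK -{4 5}jK.
  by have := @dlast_cub K q X r q_neq0 (inord i) (inord j) x; rewrite iK jK; apply.
- move=> i j x /inK iK /inK jK cij Wx.
  by have := @dlast_qua K q X r q_neq0 (inord i) (inord j) x; rewrite iK jK; apply.
Qed.

Variables (f : F) (w : seq nat) (k : nat).
Hypotheses (Wf : in_W q X f) (small_w : small w) (f_w : f@_(nword w) != 0).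
Hypothesis f_min : forall u, small u -> wlt u w -> f@_(nword u) = 0.
Hypothesis ltk : (k < r)%N.
Local Notation below := (all (fun i => i < k)%N).
Let serreW := serre_module_W ltk.

Lemma small_below s : below s -> small s.
Proof. by apply: sub_all => i lti; apply: (ltn_trans lti). Qed.

(** A letter [i] below [k] in the place of this [k] would belong to a word smaller than [w]. *)
Lemma lowest_suffix p s : w = rcons p k ++ s -> lowest k (@in_W K q X r) dn (dw dn s f).
Proof.
move=> w_eq; split; first exact: (P_dw serreW).
move=> i lti; apply: dn_eq0 => t ltt.
rewrite -[dn i _]/(dw dn (i :: s) f) mcoeff_dw f_min //.
  move: small_w; rewrite w_eq !all_cat all_rcons ltt /= => /andP[_ ->].
  by rewrite (ltn_trans lti).
rewrite w_eq -cat_rcons wlt_cat2r -!cats1 /wlt !rev_cat /= lti //.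
Qed.

Lemma mcoeff_block p a s (g := dw dn s f) : w = p ++ a ++ k :: s ->
  (dw dn a (dn k g))@_(nword p) != 0.
Proof.
move=> w_eq; rewrite -[dn k _]/(dw dn (k :: s) f) !mcoeff_dw -catA.
by rewrite -w_eq.
Qed.

Lemma dw_smaller u s v : small u -> small s -> w = v ++ s ->
  (forall t, small t -> wlt (t ++ u) v) -> dw dn u (dw dn s f) = 0.
Proof.
move=> ltu lts w_eq lt_uv; apply: dn_eq0 => t ltt.
rewrite !mcoeff_dw f_min // ?w_eq ?wlt_cat2r ?lt_uv //.
by rewrite !all_cat ltt lts ltu.
Qed.

Lemma small_suffix p s : w = p ++ s -> small s.
Proof. by move=> w_eq; move: small_w; rewrite w_eq all_cat => /andP[]. Qed.

Lemma block_path p a s : w = p ++ a ++ k :: s -> below a -> pathp X k a.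
Proof.
move=> w_eq lta; have ne0 := mcoeff_block w_eq.
have low_s : lowest k (@in_W K q X r) dn (dw dn s f).
  by apply: (@lowest_suffix (p ++ a)); rewrite cat_rcons -catA.
have fam := serre_family_dw serreW.
case: (nul_pathp q_neq0 q_not_root1 fam lta) => // [na|[XD [n ltn a_eq]]].
  by rewrite na ?mcoeff0 ?eqxx in ne0.
(* The block with [0, 1] gives the same operator as the block with [1, 0], and the latter would
   occur in a smaller word of [f]. *)
case/negP: ne0; have k_gt1 : (1 < k)%N by lia.
rewrite a_eq -(climb_swap q_neq0 fam XD n k_gt1 low_s).
rewrite -[dn k _]/(dw dn (k :: s) f) (@dw_smaller _ _ (p ++ a)) ?mcoeff0 //.
- by apply/small_below/below_climb; rewrite /= ?below_up; lia.
- by apply: (@small_suffix (p ++ a)); rewrite -catA.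
- by rewrite -catA.
move=> t _; rewrite a_eq (upS k_gt1) !climb_cat.
rewrite -(cat1s 1%N (0%N :: _)) -(cat1s 0%N) -(cat1s 0%N (1%N :: _)) -(cat1s 1%N (up _ _)).
by rewrite !catA wlt_cat2r /wlt !rev_cat.
Qed.

Lemma block_kill p b s b' : w = p ++ k :: b ++ s -> below b' -> wlt b' b ->
  dn k (dw dn b' (dw dn s f)) = 0.
Proof.
move=> w_eq ltb' lt_b'b; rewrite -[dn k _]/(dw dn (k :: b') (dw dn s f)).
apply: (@dw_smaller _ _ (p ++ k :: b)).
- by rewrite /= ltk small_below.
- by apply: (@small_suffix (p ++ k :: b)); rewrite w_eq -catA.
- by rewrite w_eq -catA.
move=> t _; rewrite /wlt !rev_cat !rev_cons -!cats1 -!catA /=.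
by apply: nlex_catk => //; rewrite all_rev.
Qed.

Lemma low_block p b s : w = p ++ k :: b ++ k :: s ->
  low k (@in_W K q X r) dn b (dw dn s f).
Proof.
move=> w_eq; split.
  by apply: (@lowest_suffix (p ++ k :: b)); rewrite cat_rcons w_eq -catA.
by move=> b' ltb' lt_b'b; apply: (block_kill w_eq).
Qed.

Definition special (a b : seq nat) :=
  [/\ X = typeC, (0 < k)%N, a = up k 0 & b = up k 1].

Lemma blocks_sorted p a b s : w = p ++ a ++ k :: b ++ k :: s -> below a -> below b ->
  wlt a b -> special a b.
Proof.
move=> w_eq lta ltb lt_ab.
have pa : pathp X k a by apply: block_path w_eq lta.
have pb : pathp X k b.
  by apply: (@block_path (p ++ a ++ [:: k]) b s) => //; rewrite w_eq -!catA.
have lowb : low k (@in_W K q X r) dn b (dw dn s f).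
  by apply: (@low_block (p ++ a)); rewrite w_eq -catA.
have ne0 : (dw dn a (dn k (dw dn b (dn k (dw dn s f)))))@_(nword p) != 0.
  have := @mcoeff_block p a (b ++ k :: s) w_eq.
  by rewrite dw_cat.
have drop nsp := block_drop q_neq0 q_not_root1 serreW pa pb lt_ab nsp lowb.
have XCP : X = typeC \/ X <> typeC by case: X; [right|right|left|right].
have nspec : ~ (X = typeC /\ a = up k 0 /\ b = up k 1) -> False.
  by move=> /drop drop0; rewrite drop0 mcoeff0 eqxx in ne0.
case: XCP => [XC|nXC]; last by case: nspec => -[].
have [a_eq|/eqP na] := eqVneq a (up k 0); last by case: nspec => -[_ []].
have [b_eq|/eqP nb] := eqVneq b (up k 1); last by case: nspec => -[_ []].
split=> //; rewrite lt0n; apply: contraTneq lt_ab => k0.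
by rewrite a_eq b_eq !up_nil ?wlt_irr // k0.
Qed.

Lemma no_xyy p s : X = typeC -> (0 < k)%N ->
  w = p ++ up k 0 ++ k :: up k 1 ++ k :: up k 1 ++ k :: s -> False.
Proof.
move=> XC k_gt0 w_eq; set y := up k 1 in w_eq; set x := up k 0 in w_eq.
have lowy : low k (@in_W K q X r) dn y (dw dn s f).
  by apply: (@low_block (p ++ x ++ k :: y)); rewrite w_eq -!catA.
have ne0 := @mcoeff_block p x (y ++ k :: y ++ k :: s) w_eq.
have H : dw dn x (dn k (dw dn (y ++ k :: y ++ k :: s) f)) = 0.
  rewrite dw_cat /= dw_cat /=; apply: (drop_xyy q_neq0 q_not_root1 serreW XC k_gt0 lowy) =>
    b ltb lt_by.
  have := @block_kill (p ++ x) y (k :: y ++ k :: s) b _ ltb lt_by.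
  by rewrite /= dw_cat; apply; rewrite w_eq -!catA.
by rewrite H mcoeff0 eqxx in ne0.
Qed.

Lemma no_xxy p s : X = typeC -> (0 < k)%N ->
  w = p ++ up k 0 ++ k :: up k 0 ++ k :: up k 1 ++ k :: s -> False.
Proof.
move=> XC k_gt0 w_eq; set y := up k 1 in w_eq; set x := up k 0 in w_eq.
have lowy : low k (@in_W K q X r) dn y (dw dn s f).
  by apply: (@low_block (p ++ x ++ k :: x)); rewrite w_eq -!catA.
have ne0 := @mcoeff_block p x (x ++ k :: y ++ k :: s) w_eq.
have H : dw dn x (dn k (dw dn (x ++ k :: y ++ k :: s) f)) = 0.
  rewrite dw_cat /= dw_cat /=; apply: (drop_xxy q_neq0 q_not_root1 serreW XC k_gt0 lowy) =>
    b ltb lt_bx.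
  have := @block_kill (p ++ x) x (k :: y ++ k :: s) b _ ltb lt_bx.
  by rewrite /= dw_cat; apply; rewrite w_eq -catA.
by rewrite H mcoeff0 eqxx in ne0.
Qed.

(** * Factorization of a Lyndon word into blocks closed by [k] *)

Let glue bs := flatten [seq rcons b k | b <- bs].

Let glue_cons b bs : glue (b :: bs) = b ++ k :: glue bs.
Proof. by rewrite /glue /= cat_rcons. Qed.

Let glue1 b : glue [:: b] = rcons b k.
Proof. by rewrite /glue /= cats0. Qed.

Let glue_cat bs cs : glue (bs ++ cs) = glue bs ++ glue cs.
Proof. by rewrite /glue map_cat flatten_cat. Qed.

Let glue_exists s : all (fun i => i <= k)%N s -> exists bs c,
  [/\ s = glue bs ++ c, all below bs & below c].
Proof.
elim/last_ind: s => [_|s i IHs]; first by exists [::], [::].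
rewrite all_rcons => /andP[le_i /IHs[bs [c [-> lbs lc]]]].
move: le_i; rewrite leq_eqVlt => /predU1P[->|lti].
  exists (rcons bs c), [::]; split=> //; last by rewrite all_rcons lc.
  by rewrite -[rcons bs c]cats1 glue_cat glue1 cats0 rcons_cat.
exists bs, (rcons c i); split=> //; first by rewrite rcons_cat.
by rewrite all_rcons lti.
Qed.

Let rev_glue bs b : exists t, rev (glue (rcons bs b)) = k :: t.
Proof.
exists (rev (glue bs ++ b)).
by rewrite -cats1 glue_cat glue1 -rcons_cat rev_rcons.
Qed.

Let wlt_le a b : ~~ wlt a b -> a = b \/ wlt b a.
Proof. by case: (wlt_total a b) => [|->|] //; [left|right]. Qed.

Hypothesis w_lyndon : forall u v, u <> [::] -> v <> [::] -> w = u ++ v -> wlt u w.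

Let glue_neq0 bs : bs <> [::] -> glue bs <> [::].
Proof. by case: bs => // b bs _; rewrite glue_cons; case: b. Qed.

(** The left factor ending with a block [a] larger than the last block would exceed [w]; since [k]
    is above all letters of the blocks, these last blocks decide the comparison. *)
Let block_le p a c s : w = glue (p ++ a :: rcons s c) -> below c -> ~~ wlt c a.
Proof.
move=> w_eq ltc; apply/negP => lt_ca.
have : wlt (glue (rcons p a)) w.
  apply: (@w_lyndon _ (glue (rcons s c))).
  - by apply: glue_neq0; case: p {w_eq}.
  - by apply: glue_neq0; case: s {w_eq}.
  - by rewrite -glue_cat cat_rcons.
rewrite w_eq -cat_rcons -!cats1 catA glue_cat (glue_cat (_ ++ _) [:: c]) !glue1.
rewrite -!cats1 !catA wlt_cat2r /wlt.
rewrite (rev_cat (glue p)) (rev_cat (glue _)) => lt1.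
have lt2 : nlex (rev c ++ rev (glue ((p ++ [:: a]) ++ s))) (rev a ++ rev (glue p)).
  case/lastP: p {w_eq lt1} => [|p e]; first by rewrite cats0; apply: nlex_catr.
  by have [t ->] := rev_glue p e; apply: nlex_catk; rewrite ?all_rev.
by have := nlex_trans lt1 lt2; rewrite nlex_irr.
Qed.

(** The inequality is strict: were the first block equal to the last, the left factor it forms with
    [k] would also be a right factor of [w], hence larger than [w]. *)
Let block_first a c s : w = glue (a :: rcons s c) -> below a -> wlt a c.
Proof.
move=> w_eq lta.
have : wlt (glue [:: a]) w.
  apply: (@w_lyndon _ (glue (rcons s c))).
  - exact: glue_neq0.
  - by apply: glue_neq0; case: s {w_eq}.
  - by rewrite -glue_cat.
rewrite w_eq -rcons_cons -cats1 glue_cat !glue1 glue_cons -!cats1 !catA wlt_cat2r /wlt.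
rewrite rev_cat -glue_cons lastI; have [t ->] := rev_glue (belast a s) (last a s).
by apply: nlex_sep; rewrite all_rev.
Qed.

Let rise c s M : wlt c M -> (forall a, a \in rcons s M -> ~~ wlt M a) ->
  exists p a t, c :: rcons s M = p ++ a :: M :: t /\ wlt a M.
Proof.
elim: s c => [|b s IHs] c lt_cM le_M; first by exists [::], c, [::].
have /wlt_le[eq_b|lt_bM] : ~~ wlt M b by apply: le_M; rewrite /= in_cons eqxx.
  by exists [::], c, (rcons s M); subst b.
have [|p [a [t [eq_bs lt_aM]]]] := IHs b lt_bM.
  by move=> a a_s; apply: le_M; rewrite /= in_cons a_s orbT.
by exists (c :: p), a, t; rewrite /= eq_bs.
Qed.

Let between b : X = typeC -> (0 < k)%N -> pathp X k b -> wlt (up k 0) b ->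
  ~~ wlt (up k 1) b -> b = up k 1.
Proof.
move=> -> k_gt0 [[j le_jk ->]|[m _ ->]] lt_xb; last first.
  by move: lt_xb; rewrite climb_cat wlt_suffix.
have [j_gt1|j_le1] := ltnP 1 j.
  rewrite (@up_split _ 1 j.-1) ?(@upS _ j.-1) ?prednK; try lia.
  by rewrite wlt_catr // wlt_cons.
have [j0|->//] : j = 0%N \/ j = 1%N by lia.
by rewrite j0 wlt_irr in lt_xb.
Qed.

Lemma lyndon_blocks : w <> [::] -> last 0%N w = k ->
  (exists2 x, pathp X k x & w = rcons x k) \/
  [/\ X = typeC, (0 < k)%N & w = up k 0 ++ k :: rcons (up k 1) k].
Proof.
move=> w_neq0 last_w.
have [w' w_rcons] : exists w', w = rcons w' k.
  by case/lastP: w w_neq0 last_w => // w' l _; rewrite last_rcons => ->; exists w'.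
(* The left factor ending at a letter [l] is smaller than [w], so [l] is at most the last letter
   [k]. *)
have le_w' : all (fun i => i <= k)%N w'.
  apply/allP => l /splitPr l_w'; case: l_w' w_rcons => p s w_eq.
  have := @w_lyndon (rcons p l) (rcons s k).
  rewrite w_eq cat_rcons -rcons_cons -rcons_cat.
  move=> /(_ _ _ erefl); rewrite /wlt !rev_rcons /=.
  have nil (t : seq nat) i : rcons t i <> [::] by case: t.
  move=> /(_ (nil _ _) (nil _ _)); case/orP=> [/ltnW//|/andP[/eqP-> _]].
  exact: leqnn.
have [bs [M [w'_eq lt_bs lt_M]]] := glue_exists le_w'.
have w_glue : w = glue (rcons bs M).
  by rewrite w_rcons w'_eq -[rcons bs M]cats1 glue_cat glue1 -rcons_cat.
have below_in a : a \in rcons bs M -> below a.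
  by rewrite mem_rcons in_cons => /predU1P[->//|/(allP lt_bs)].
have path_in a : a \in rcons bs M -> pathp X k a.
  move=> a_bs; have lta := below_in a a_bs.
  move: w_glue; case/splitPr: a_bs => p s w_eq.
  by apply: (@block_path (glue p) a (glue s)); rewrite // w_eq glue_cat glue_cons.
have sorted p a b s : rcons bs M = p ++ a :: b :: s -> wlt a b -> special a b.
  move=> bs_eq; apply: (@blocks_sorted (glue p) a b (glue s)).
  - by rewrite w_glue bs_eq glue_cat !glue_cons.
  - by apply: below_in; rewrite bs_eq mem_cat !in_cons eqxx orbT.
  - by apply: below_in; rewrite bs_eq mem_cat !in_cons eqxx !orbT.
case: bs => [|c bs] in w_glue path_in sorted below_in {w'_eq lt_bs} *.
  left; exists M; first by apply: path_in; rewrite inE.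
  by rewrite w_glue glue1.
right; have lt_cM : wlt c M.
  by apply: (@block_first c M bs) => //; apply: below_in; rewrite /= in_cons eqxx.
have le_M a : a \in rcons (c :: bs) M -> ~~ wlt M a.
  rewrite mem_rcons in_cons => /predU1P[->|]; first by rewrite wlt_irr.
  move=> a_bs; move: w_glue; case/splitPr: a_bs => p s.
  by rewrite rcons_cat rcons_cons => w_eq; apply: block_le w_eq lt_M.
(* The blocks start below the maximal one, so somewhere a smaller block stands directly before it.
   That ascent must be the exceptional pair, which identifies the last block as [up k 1]. *)
have [|p [a [t [bs_eq lt_aM]]]] := rise lt_cM (s := bs).
  by move=> a a_bs; apply: le_M; rewrite /= in_cons a_bs orbT.
have [XC k_gt0 _ M_eq] := sorted p a M t bs_eq lt_aM.
clear p a t bs_eq lt_aM.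
subst M; set x := up k 0; set y := up k 1 in lt_cM le_M w_glue path_in sorted lt_M below_in *.
have lt_xy : wlt x y by rewrite /x (upS k_gt0) wlt_cons.
(* The induction runs from the right. An ascent is the exceptional pair, and a descent can only go
   from [y] to [x], because no path word lies strictly between them and none of the blocks exceeds
   [y]. *)
have xy_suffix s p : rcons (c :: bs) y = p ++ rcons s y ->
    forall a, a \in rcons s y -> a = x \/ a = y.
  elim: s p => [|b s IHs] p L_eq a; first by rewrite inE => /eqP->; right.
  have IH : forall e, e \in rcons s y -> e = x \/ e = y.
    by apply: (IHs (rcons p b)); rewrite cat_rcons.
  rewrite in_cons => /predU1P[->{a}|]; last exact: IH.
  have b_L : b \in rcons (c :: bs) y by rewrite L_eq mem_cat in_cons eqxx orbT.
  have [e [s' s_eq]] : exists e s', rcons s y = e :: s'.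
    by case: (s) => [|e s'']; [exists y, [::]|exists e, (rcons s'' y)].
  have e_xy : e = x \/ e = y by apply: IH; rewrite s_eq in_cons eqxx.
  have [lt_be|] := boolP (wlt b e).
    left; have L_eq' : rcons (c :: bs) y = p ++ b :: e :: s' by rewrite L_eq /= s_eq.
    by have [] := sorted p b e s' L_eq' lt_be.
  case/wlt_le=> [->//|lt_eb]; right; case: e_xy => e_eq; rewrite e_eq in lt_eb.
    by apply: between => //; [apply: path_in|apply: le_M].
  by rewrite (negPf (le_M b b_L)) in lt_eb.
have {xy_suffix} in_xy := xy_suffix (c :: bs) [::] erefl.
have c_x : c = x.
  case: (in_xy c) => //; first by rewrite /= in_cons eqxx.
  by move=> c_y; rewrite c_y wlt_irr in lt_cM.
subst c.
have nxyy p s : rcons (x :: bs) y = p ++ x :: y :: y :: s -> False.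
  move=> L_eq; apply: (@no_xyy (glue p) (glue s)) => //.
  by rewrite w_glue L_eq glue_cat !glue_cons.
have nxxy p s : rcons (x :: bs) y = p ++ x :: x :: y :: s -> False.
  move=> L_eq; apply: (@no_xxy (glue p) (glue s)) => //.
  by rewrite w_glue L_eq glue_cat !glue_cons.
(* After two adjacent [x] a [y] comes eventually, so [x x y] would occur. *)
have run_x t p : rcons (x :: bs) y = p ++ x :: x :: rcons t y -> False.
  elim: t p => [|a t IHt] p L_eq; first exact: nxxy L_eq.
  have [a_x|a_y] : a = x \/ a = y.
  - by apply: in_xy; rewrite L_eq mem_cat !in_cons eqxx !orbT.
  - by apply: (IHt (rcons p x)); rewrite cat_rcons L_eq /= a_x.
  - by apply: (nxxy p (rcons t y)); rewrite L_eq /= a_y.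
(* Going left from two adjacent [y] an [x] comes eventually, so [x y y] would occur. *)
have run_y t s : rcons (x :: bs) y = x :: t ++ y :: y :: s -> False.
  elim/last_ind: t s => [|t a IHt] s L_eq; first exact: (nxyy [::] s).
  have [a_x|a_y] : a = x \/ a = y.
  - by apply: in_xy; rewrite L_eq in_cons mem_cat mem_rcons in_cons eqxx !orbT.
  - by apply: (nxyy (x :: t) s); rewrite L_eq cat_rcons a_x.
  - by apply: (IHt (y :: s)); rewrite L_eq cat_rcons a_y.
case: bs => [|b bs] in w_glue in_xy nxyy nxxy run_x run_y {path_in sorted below_in le_M} *.
  by split=> //; rewrite w_glue glue_cons glue1.
have [b_x|b_y] : b = x \/ b = y by apply: in_xy; rewrite /= !in_cons eqxx orbT.
  by case: (run_x bs [::]); rewrite b_x.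
case/lastP: bs => [|bs e] in w_glue in_xy nxyy nxxy run_x run_y *.
  by case: (nxyy [::] [::]); rewrite b_y.
have [e_x|e_y] : e = x \/ e = y.
- by apply: in_xy; rewrite mem_rcons !in_cons mem_rcons in_cons eqxx !orbT.
(* The two blocks [x y] are then both a left and a right factor of [w]. A right factor is larger
   than [w], against the Lyndon condition. *)
- have w_eq : w = glue ([:: x; y] ++ bs) ++ glue [:: x; y].
    by rewrite w_glue -glue_cat b_y e_x -catA /= -cats1 -cats1 -catA.
  have w_eq' : w = glue [:: x; y] ++ glue (bs ++ [:: x; y]).
    by rewrite w_eq -!glue_cat -catA.
  have : wlt (glue [:: x; y]) w.
    apply: (w_lyndon _ _ w_eq'); apply: glue_neq0 => //.
    by case: (bs).
  by rewrite w_eq wlt_suffix.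
case: (run_y (b :: bs) [::]).
by rewrite e_y /= -!cats1 -!catA.
Qed.

End GoodWord.
(** * Root words are good *)

(** The shuffle algebra as seen through words over numbers: [sn] appends a letter and [P] is
    membership in the subalgebra. *)
Record shuffle_words (K : fieldType) (q : K) (X : classical_type) (r : nat)
    (M : lmodType K) (P : M -> Prop) (mul : M -> M -> M) (wn : seq nat -> M)
    (sn : nat -> M -> M) : Prop := {
  sw_mulDl : forall c x y z, mul (c *: x + y) z = c *: mul x z + mul y z;
  sw_mulDr : forall c x y z, mul z (c *: x + y) = c *: mul z x + mul z y;
  sw_sn : forall i c x y, sn i (c *: x + y) = c *: sn i x + sn i y;
  sw_sn_wn : forall i s, sn i (wn s) = wn (rcons s i);
  sw_mul0l : forall x, mul (wn [::]) x = x;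
  sw_mul0r : forall x, mul x (wn [::]) = x;
  sw_mul_rcons : forall u v i j, all (fun l => l < r)%N (rcons u i) -> (j < r)%N ->
    mul (wn (rcons u i)) (wn (rcons v j)) =
      sn i (mul (wn u) (wn (rcons v j)))
      + q ^ (- \sum_(l <- rcons u i) gr X l j) *: sn j (mul (wn (rcons u i)) (wn v));
  sw_P0 : P 0;
  sw_P_lin : forall c x y, P x -> P y -> P (c *: x + y);
  sw_P_letter : forall i, (i < r)%N -> P (wn [:: i]);
  sw_P_mul : forall x y, P x -> P y -> P (mul x y)
}.

Section LowerBound.
Variables (K : fieldType) (q : K) (X : classical_type) (r : nat).
Variables (M : lmodType K) (P : M -> Prop) (mul : M -> M -> M).
Variables (wn : seq nat -> M) (sn : nat -> M -> M).
Hypothesis q_neq0 : q != 0.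
Hypothesis q_not_root1 : forall n, q ^+ n.+1 != 1.
Hypothesis swM : shuffle_words q X r P mul wn sn.
Local Notation small := (all (fun i => i < r)%N).
Local Notation "x ** y" := (mul x y) (at level 40, left associativity).

Let mulDl := sw_mulDl swM.
Let mulDr := sw_mulDr swM.
Let sn_lin := sw_sn swM.
Let sn_wn := sw_sn_wn swM.

Let sn0 i : sn i 0 = 0.
Proof. by apply: (addIr (sn i 0)); have := sn_lin i 1 0 0; rewrite !scale1r !addr0 add0r. Qed.
Let snD i x y : sn i (x + y) = sn i x + sn i y.
Proof. by have := sn_lin i 1 x y; rewrite !scale1r. Qed.
Let snZ i c x : sn i (c *: x) = c *: sn i x.
Proof. by have := sn_lin i c x 0; rewrite sn0 !addr0. Qed.
Let snN i x : sn i (- x) = - sn i x.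
Proof. by rewrite -scaleN1r snZ scaleN1r. Qed.

(** * Insertion of a letter by a q-commutator *)

Definition wf (u : seq nat) (j : nat) : int := \sum_(i <- u) gr X i j.
(** This is the coefficient with which a letter is inserted after a prefix whose weight pairs with
    it to [n]. *)
Definition phi (c : K) (n : int) : K := q ^ (- n) - c * q ^ n.

Lemma wf_nil j : wf [::] j = 0.
Proof. exact: big_nil. Qed.

Lemma wf_cons i u j : wf (i :: u) j = gr X i j + wf u j.
Proof. exact: big_cons. Qed.

Lemma wf_cat u v j : wf (u ++ v) j = wf u j + wf v j.
Proof. exact: big_cat. Qed.

Lemma wf_rcons u i j : wf (rcons u i) j = wf u j + gr X i j.
Proof. by rewrite -cats1 wf_cat wf_cons wf_nil addr0. Qed.

Lemma wf_perm u v j : perm_eq u v -> wf u j = wf v j.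
Proof. by move=> uv; rewrite /wf (perm_big _ uv). Qed.

Lemma wf_orth u j : all (fun i => com X i j) u -> wf u j = 0.
Proof.
elim: u => [|i u IHu]; first by rewrite wf_nil.
by case/andP=> /eqP gij /IHu; rewrite wf_cons gij => ->.
Qed.

(* The q-commutator of the word [u] with the letter [j]: it inserts [j] into [u]. *)
Definition Dw (c : K) (j : nat) (u : seq nat) : M :=
  wn u ** wn [:: j] - (c * q ^ wf u j) *: (wn [:: j] ** wn u).

Lemma Dw_nil c j : Dw c j [::] = phi c 0 *: wn [:: j].
Proof.
rewrite /Dw wf_nil (sw_mul0l swM) (sw_mul0r swM) /phi oppr0 expr0z mulr1.
by rewrite scalerBl scale1r.
Qed.

Lemma Dw_rcons c j u i : small (j :: i :: u) ->
  Dw c j (rcons u i) =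
    sn i (Dw c j u) + phi c (wf (rcons u i) j) *: wn (rcons (rcons u i) j).
Proof.
case/and3P => ltj lti ltu; rewrite /Dw.
have -> : wn (rcons u i) ** wn [:: j] =
    sn i (wn u ** wn [:: j]) + q ^ (- wf (rcons u i) j) *: wn (rcons (rcons u i) j).
  have := @sw_mul_rcons _ _ _ _ _ _ _ _ _ swM u [::] i j.
  by rewrite all_rcons lti => /(_ ltu ltj) ->; rewrite (sw_mul0r swM) sn_wn.
have -> : wn [:: j] ** wn (rcons u i) =
    wn (rcons (rcons u i) j) + q ^ (- gr X j i) *: sn i (wn [:: j] ** wn u).
  have := @sw_mul_rcons _ _ _ _ _ _ _ _ _ swM [::] u j i.
  rewrite /= ltj => /(_ isT lti) ->; rewrite (sw_mul0l swM) sn_wn.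
  by rewrite big_cons big_nil addr0.
rewrite snD snN snZ /phi wf_rcons.
rewrite (gr_sym X j i); set S := wf u j; set g := gr X i j.
have -> : q ^ (- g) = (q ^ g)^-1 by rewrite invr_expz.
rewrite !expfzDr // !opprD !expfzDr // -!invr_expz.
have [g0 S0] : q ^ g != 0 /\ q ^ S != 0 by split; apply: expfz_neq0.
by move: (q ^ g) (q ^ S) g0 S0 => x y x0 y0; lincomb M; field; rewrite ?x0 ?y0.
Qed.

Definition app (t : seq nat) (x : M) : M := foldl (fun y i => sn i y) x t.

Arguments app : simpl never.

Lemma app_cons i t x : app (i :: t) x = app t (sn i x).
Proof. by []. Qed.

Lemma app_wn s t : app t (wn s) = wn (s ++ t).
Proof.
elim: t s => [|i t IHt] s; first by rewrite cats0.
by rewrite app_cons sn_wn IHt cat_rcons.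
Qed.

Lemma app_lin t c x y : app t (c *: x + y) = c *: app t x + app t y.
Proof. by elim: t x y => [|i t IHt] x y //; rewrite !app_cons sn_lin IHt. Qed.

Let app0 t : app t 0 = 0.
Proof. by elim: t => [|i t IHt] //; rewrite app_cons sn0. Qed.
Let appD t x y : app t (x + y) = app t x + app t y.
Proof. by have := app_lin t 1 x y; rewrite !scale1r. Qed.
Let appZ t c x : app t (c *: x) = c *: app t x.
Proof. by have := app_lin t c x 0; rewrite app0 !addr0. Qed.

Lemma Dw_skip c j u i : small (j :: i :: u) -> phi c (wf (rcons u i) j) = 0 ->
  Dw c j (rcons u i) = sn i (Dw c j u).
Proof. by move=> lt0 ph0; rewrite Dw_rcons // ph0 scale0r addr0. Qed.

(** Along [t] the pairing with [j] stays at its value after [u], a zero of [phi c]. *)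
Lemma Dw_orth c j u t : small (j :: u ++ t) -> all (fun i => com X i j) t ->
  phi c (wf u j) = 0 -> Dw c j (u ++ t) = app t (Dw c j u).
Proof.
elim: t u => [|i t IHt] u; first by rewrite cats0.
rewrite -cat_rcons /= => lt_s /andP[/eqP gij ot] ph0.
have wfi : wf (rcons u i) j = wf u j by rewrite wf_rcons gij addr0.
rewrite (IHt _ lt_s ot) ?wfi ?ph0 // app_cons Dw_skip ?wfi ?ph0 //.
by move: lt_s; rewrite /= all_cat all_rcons => /and3P[-> /andP[-> ->]].
Qed.

Lemma in_W_Dw c j u : (j < r)%N -> P (wn u) -> P (Dw c j u).
Proof.
move=> /(sw_P_letter swM) Pj Pu; rewrite /Dw addrC -scaleNr.
by apply: (sw_P_lin swM); apply: (sw_P_mul swM).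
Qed.

Lemma in_W_scaled c (x : M) : c != 0 -> P (c *: x) -> P x.
Proof.
by move=> c0 Wx; rewrite -[x]scale1r -(mulVf c0) -scalerA -[_ *: _]addr0;
  apply: (sw_P_lin swM) => //; apply: (sw_P0 swM).
Qed.

Lemma expz_neq1 n : (0 < n)%N -> q ^ n%:Z != 1.
Proof. by case: n => // n _; apply: q_not_root1. Qed.

Lemma exp_oppz_neq n : (0 < n)%N -> q ^ n%:Z - q ^ (- n%:Z) != 0.
Proof.
move=> n_gt0; have x0 : q ^ n%:Z != 0 by apply: expfz_neq0.
apply: contra (@expz_neq1 (n * 2) _) => [/eqP H|]; last by rewrite muln_gt0 n_gt0.
rewrite PoszM -exprz_exp -invr_expz in H *; move: (q ^ n%:Z) x0 H => x x0 H; apply/eqP.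
have -> : x ^ 2%:Z = x ^+ 2 by [].
have -> : x ^+ 2 = 1 + x * (x - x^-1) by field.
by rewrite H mulr0 addr0.
Qed.

Lemma phi1_0 : phi 1 0 = 0.
Proof. by rewrite /phi oppr0 expr0z mulr1 subrr. Qed.

Lemma phi_exp0 n : phi (q ^ n) 0 = 1 - q ^ n.
Proof. by rewrite /phi oppr0 expr0z mulr1. Qed.

Lemma phi_expN (n : int) : phi (q ^ n) (- n) = q ^ n - 1.
Proof. by rewrite /phi opprK -expfzDr // subrr expr0z. Qed.

Lemma Dw1_orth j u : small (j :: u) -> all (fun l => com X l j) u -> Dw 1 j u = 0.
Proof.
move=> lt_s ou; rewrite -(cat0s u) (@Dw_orth 1 j [::] u lt_s ou); last first.
  by rewrite wf_nil phi1_0.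
by rewrite Dw_nil phi1_0 scale0r app0.
Qed.

Lemma Dw1_end u i j : small (j :: i :: u) -> all (fun l => com X l j) u ->
  Dw 1 j (rcons u i) = phi 1 (gr X i j) *: wn (rcons (rcons u i) j).
Proof.
move=> lt_s ou; have lt_ju : small (j :: u) by move: lt_s => /= /and3P[-> _ ->].
rewrite (Dw_rcons 1 lt_s) (Dw1_orth lt_ju ou) sn0 add0r.
by rewrite wf_rcons (wf_orth ou) add0r.
Qed.

Lemma phi1_neq0 n : phi 1 (- n.+1%:Z) != 0.
Proof. by rewrite /phi opprK mul1r; apply: exp_oppz_neq. Qed.

(** With [c = 1] an insertion after a prefix orthogonal to [j] has coefficient 0, so only the one at
    the end remains. *)
Lemma in_W_extend u i j n : small (j :: i :: u) -> all (fun l => com X l j) u ->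
  gr X i j = - n.+1%:Z -> P (wn (rcons u i)) -> P (wn (rcons (rcons u i) j)).
Proof.
move=> lt_s ou gij Wu; apply: (in_W_scaled (phi1_neq0 n)).
by rewrite -gij -(Dw1_end lt_s ou); apply: in_W_Dw => //; case/andP: lt_s.
Qed.

(* The contributions of the insertions on both sides of the letter [j] cancel. *)
Lemma Dw_front j i y t n c : c = q ^ n ->
  small (j :: i :: y ++ t) -> gr X j j = n -> wf y j = - n ->
  phi c (gr X i j) = 0 -> all (fun l => com X l j) t ->
  Dw c j y = phi c 0 *: wn (j :: y) + phi c (- n) *: wn (rcons y j) ->
  Dw c j (y ++ j :: i :: t) = phi c 0 *: wn (j :: y ++ j :: i :: t).
Proof.
move=> def_c; rewrite /= all_cat => /and4P[ltj lti lty ltt] gjj wfy ph_i ot Dy.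
have wfyj : wf (rcons y j) j = 0 by rewrite wf_rcons gjj wfy addNr.
have wfyji : wf (rcons (rcons y j) i) j = gr X i j by rewrite wf_rcons wfyj add0r.
have lt1 : small (j :: j :: y) by rewrite /= ltj lty.
have lt2 : small (j :: i :: rcons y j) by rewrite /= ltj lti all_rcons ltj.
have lt3 : small (j :: rcons (rcons y j) i ++ t).
  by rewrite /= all_cat !all_rcons ltj lti lty ltt.
have Dyj : Dw c j (rcons y j) = phi c 0 *: wn (j :: rcons y j).
  have p0 : phi c 0 + phi c (- n) = 0.
    by rewrite def_c phi_exp0 phi_expN addrA subrK subrr.
  rewrite (Dw_rcons c lt1) Dy wfyj.
  rewrite snD.
  rewrite 2!snZ.
  rewrite !sn_wn.
  rewrite rcons_cons.
  by rewrite -addrA -scalerDl (addrC (phi c (- n))) p0 scale0r addr0.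
have -> : y ++ j :: i :: t = rcons (rcons y j) i ++ t.
  by rewrite -!cats1 -!catA.
rewrite (Dw_orth lt3 ot); last by rewrite wfyji.
rewrite (Dw_skip lt2); last by rewrite wfyji.
by rewrite Dyj snZ sn_wn appZ app_wn.
Qed.

(** * Elements with a controlled smallest word *)

Inductive spanW (A : seq nat -> Prop) : M -> Prop :=
  | spanW0 : spanW A 0
  | spanWD c u x : A u -> spanW A x -> spanW A (c *: wn u + x).

Definition leads (w : seq nat) (x : M) : Prop :=
  exists c y, [/\ c != 0, spanW (fun v => perm_eq v w /\ wlt w v) y &
                  x = c *: wn w + y].

Lemma spanW_sub (A B : seq nat -> Prop) x :
  (forall u, A u -> B u) -> spanW A x -> spanW B x.
Proof.
by move=> AB; elim=> [|c u y Au _ IHy]; [apply: spanW0|apply: spanWD; [apply: AB|]].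
Qed.

Lemma spanW_lin A c x y : spanW A x -> spanW A y -> spanW A (c *: x + y).
Proof.
move=> Ax Ay; elim: Ax => [|b u z Au _ IHz]; first by rewrite scaler0 add0r.
by rewrite scalerDr scalerA -addrA; apply: spanWD.
Qed.

Lemma spanW_add A x y : spanW A x -> spanW A y -> spanW A (x + y).
Proof. by move=> Ax Ay; rewrite -[x]scale1r; apply: spanW_lin. Qed.

Lemma spanW_wn (A : seq nat -> Prop) c u : A u -> spanW A (c *: wn u).
Proof. by move=> Au; rewrite -[_ *: _]addr0; apply: spanWD => //; apply: spanW0. Qed.

Lemma spanW_sn (A : seq nat -> Prop) i x :
  spanW (fun u => A (rcons u i)) x -> spanW A (sn i x).
Proof.
elim=> [|c u y Au _ IHy]; first by rewrite sn0; apply: spanW0.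
by rewrite sn_lin sn_wn; apply: spanWD.
Qed.

Lemma leads_wn w : leads w (wn w).
Proof.
exists 1, 0; split; rewrite ?oner_eq0 //; first exact: spanW0.
by rewrite scale1r addr0.
Qed.

(** Separates the insertions into [p] from those after a nonempty part of [s]; only positions with
    nonzero coefficient have to satisfy [A]. *)
Lemma Dw_cat c j p s (A : seq nat -> Prop) : small (j :: p ++ s) ->
  (forall s1 i s2, s = rcons s1 i ++ s2 -> phi c (wf (p ++ rcons s1 i) j) != 0 ->
     A (p ++ rcons s1 i ++ j :: s2)) ->
  exists2 y, spanW A y & Dw c j (p ++ s) = app s (Dw c j p) + y.
Proof.
elim/last_ind: s A => [|s i IHs] A.
  by move=> _ _; exists 0; [apply: spanW0|rewrite cats0 addr0].
rewrite -rcons_cat /= all_rcons => /and3P[ltj lti lts] As.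
have [||y Ay eq_y] := IHs (fun u => A (rcons u i)); first by rewrite /= ltj.
  move=> s1 l s2 eq_s ph; rewrite !rcons_cat /=; apply: As => //.
  by rewrite eq_s rcons_cat.
exists (sn i y + phi c (wf (rcons (p ++ s) i) j) *: wn (rcons (rcons (p ++ s) i) j)).
  apply: spanW_add; first exact: spanW_sn.
  have [->|ph] := eqVneq (phi c (wf (rcons (p ++ s) i) j)) 0.
    by rewrite scale0r; apply: spanW0.
  apply: spanW_wn; rewrite -cats1 rcons_cat -catA; apply: As; first by rewrite cats0.
  by rewrite -rcons_cat.
rewrite Dw_rcons /= ?ltj ?lti // eq_y snD addrA; congr (_ + _ + _).
by rewrite /app -cats1 foldl_cat.
Qed.

(** The exponent is a parameter, which makes the map linear; on words pairing with [j] to [s] it is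
    [Dw 1 j]. *)
Definition insert (j : nat) (s : int) (x : M) : M :=
  x ** wn [:: j] - q ^ s *: (wn [:: j] ** x).

Lemma insert_lin j s c x y : insert j s (c *: x + y) = c *: insert j s x + insert j s y.
Proof. by rewrite /insert mulDl mulDr; lincomb M; ring. Qed.

Lemma insert0 j s : insert j s 0 = 0.
Proof.
apply: (addIr (insert j s 0)).
by rewrite add0r -{1}[insert j s 0]scale1r -insert_lin scaler0 add0r.
Qed.

Lemma insertZ j s c x : insert j s (c *: x) = c *: insert j s x.
Proof. by have := insert_lin j s c x 0; rewrite insert0 !addr0. Qed.

Lemma insertD j s x y : insert j s (x + y) = insert j s x + insert j s y.
Proof. by have := insert_lin j s 1 x y; rewrite !scale1r. Qed.

Lemma insert_wn j u : insert j (wf u j) (wn u) = Dw 1 j u.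
Proof. by rewrite /insert /Dw mul1r. Qed.

Lemma insert_P j s x : (j < r)%N -> P x -> P (insert j s x).
Proof.
move=> /(sw_P_letter swM) Pj Px; rewrite /insert addrC -scaleNr.
by apply: (sw_P_lin swM); apply: (sw_P_mul swM).
Qed.

Lemma insert_sn i j s x : (i < r)%N -> (j < r)%N ->
  spanW (fun u => small u /\ wf u j = s - gr X i j) x ->
  insert j s (sn i x) = sn i (insert j (s - gr X i j) x) + phi 1 s *: sn j (sn i x).
Proof.
move=> lti ltj; elim=> [|c u y [ltu wfu] _ IHy].
  by rewrite sn0 !insert0 !sn0 scaler0 addr0.
rewrite sn_lin !insert_lin IHy sn_lin -{2}wfu insert_wn !sn_lin !sn_wn.
have wfs : wf (rcons u i) j = s by rewrite wf_rcons wfu subrK.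
have lt_s : small (j :: i :: u) by rewrite /= ltj lti.
by rewrite -{1}wfs insert_wn (Dw_rcons 1 lt_s) wfs; lincomb M; ring.
Qed.

Lemma Dw_wf c j u : small (j :: u) ->
  spanW (fun v => small v /\ wf v j = wf u j + gr X j j) (Dw c j u).
Proof.
move=> lt_s; have [|y Ay] := @Dw_cat c j [::] u
    (fun v => small v /\ wf v j = wf u j + gr X j j) lt_s.
  move=> s1 i s2 eq_u _; move: lt_s; rewrite eq_u /= !all_cat /=.
  by case/and3P=> -> -> ->; rewrite !wf_cat wf_cons; split=> //; ring.
have app_wn' : forall t, app t (Dw c j [::]) = phi c 0 *: wn (j :: t).
  by move=> t; rewrite Dw_nil appZ app_wn.
move=> ->; rewrite app_wn'; apply: spanWD => //.
by split=> //; rewrite wf_cons addrC.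
Qed.

Lemma phi1N n : phi 1 (- n) = - phi 1 n.
Proof. by rewrite /phi opprK !mul1r opprB. Qed.

(* The quantum Serre relation between [a] and [j], inside a longer word. *)
Lemma insert2_0 a j u : small (j :: u) -> gr X j j = 2 -> gr X a j = -1 ->
  {in u, forall l, l != a -> com X l j} -> count_mem a u = 1%N ->
  insert j 1 (Dw 1 j u) = 0.
Proof.
move=> + gjj gaj; elim/last_ind: u => [|u i IHu] //.
rewrite /= all_rcons => /and3P[ltj lti ltu] ou ca.
have lt_s : small (j :: i :: u) by rewrite /= ltj lti.
have ou' : {in u, forall l, l != a -> com X l j}.
  by move=> l lu; apply: ou; rewrite mem_rcons inE lu orbT.
have ortho_u : count_mem a u = 0%N -> all (fun l => com X l j) u.
  move=> cu; apply/allP => l lu; apply: ou' => //.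
  by apply: contraTneq lu => ->; rewrite -has_pred1 has_count cu.
have cau : (count_mem a u + (i == a) = 1)%N by rewrite -ca -cats1 count_cat /= addn0.
have [wfu D2] : wf u j = -1 - gr X i j /\ insert j (1 - gr X i j) (Dw 1 j u) = 0.
  have [eq_ia|ne_ia] := eqVneq i a.
    have /ortho_u ou0 : count_mem a u = 0%N by move: cau; rewrite eq_ia eqxx; lia.
    by rewrite (wf_orth ou0) (Dw1_orth _ ou0) ?insert0 /= ?ltj // eq_ia gaj.
  have gij : gr X i j = 0 by apply/eqP/(ou i) => //; rewrite mem_rcons mem_head.
  rewrite gij !subr0; move: cau; rewrite (negPf ne_ia) addn0 => cu.
  split; last by apply: IHu => //; rewrite /= ltj.
  have -> : wf u j = \sum_(l <- u) (- (l == a)%:R).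
    apply: eq_big_seq => l lu; case: eqVneq => [->//|ne_la].
    by rewrite oppr0; apply/eqP/ou'.
  by rewrite sumrN -sum1_count big_mkcond /= in cu *; rewrite -natr_sum cu.
have wfi : wf (rcons u i) j = -1 by rewrite wf_rcons wfu subrK.
have wfij : wf (rcons (rcons u i) j) j = 1 by rewrite wf_rcons wfi gjj.
rewrite (Dw_rcons 1 lt_s) wfi insertD insertZ insert_sn //; last first.
  apply: spanW_sub (Dw_wf 1 _); last by rewrite /= ltj.
  by move=> v [-> ->]; rewrite wfu gjj; split=> //; ring.
have -> : insert j 1 (wn (rcons (rcons u i) j)) = Dw 1 j (rcons (rcons u i) j).
  by rewrite -wfij insert_wn.
rewrite D2 sn0 add0r (Dw_rcons 1 (u := rcons u i)); last first.
  by rewrite /= ltj all_rcons lti.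
rewrite (Dw_rcons 1 lt_s) wfi wfij phi1N snD snZ !sn_wn.
by lincomb M; ring.
Qed.

Lemma leads_span w x : leads w x -> spanW (fun v => perm_eq v w) x.
Proof.
by case=> c [y [_ Ay ->]]; apply: spanWD; rewrite ?perm_refl //; apply: spanW_sub Ay => v [].
Qed.

Lemma leads_sn w i x : leads w x -> leads (rcons w i) (sn i x).
Proof.
case=> c [y [c0 Ay ->]]; exists c, (sn i y); split=> //; last by rewrite sn_lin sn_wn.
apply: spanW_sn; apply: spanW_sub Ay => v [pv lt_wv].
by rewrite -!cats1 perm_cat2r pv wlt_cat2r.
Qed.

(** If [u] leaves [S] or stops inside it, the comparison is settled there, because [k] exceeds the
    letters of [S]. The third case is an insertion after a proper extension of [S]. *)
Lemma nlex_insert k S T u v : all (fun i => i < k)%N S ->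
  S ++ T = u ++ v \/ nlex (S ++ T) (u ++ v) ->
  [\/ u = S /\ v = T, nlex (S ++ k :: T) (u ++ k :: v) |
      exists i t, u = S ++ i :: t /\ (T = i :: t ++ v \/ nlex T (i :: t ++ v))].
Proof.
elim: S u => [|i S IHS] [|l u] /=.
- by move=> _ [->|lt_Tv]; [apply: Or31|apply: Or32; rewrite ltnn eqxx].
- by move=> _ Tv; apply: Or33; exists l, u.
- by case/andP=> ->; move=> *; apply: Or32.
case/andP=> lti ltS Huv.
have [->|[-> le_uv]] : (i < l)%N \/ i = l /\ (S ++ T = u ++ v \/ nlex (S ++ T) (u ++ v)).
- by case: Huv => [[-> ->]|/orP[->|/andP[/eqP-> ->]]]; by [left|right; split=> //;
  left|right; split=> //; right].
- exact: Or32.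
case: (IHS u ltS le_uv) => [[-> ->]|lt_uv|[i' [t [-> Tt]]]].
- exact: Or31.
- by apply: Or32; rewrite eqxx lt_uv orbT.
by apply: Or33; exists i', t.
Qed.

(** * Type C: induction step for the exceptional words *)

Section SpecialC.
Variables (a j : nat) (p s : seq nat).
Hypothesis XC : X = typeC.
Hypothesis a_gt0 : (0 < a)%N.
Hypothesis def_j : j = a.+1.
Hypothesis def_p : p = up j 0.
Hypothesis def_s : s = up j 1.
Hypothesis ltj : (j < r)%N.

Let gjj : gr X j j = 2.
Proof. by rewrite XC def_j; gram. Qed.
Let gaj : gr X a j = -1.
Proof. by rewrite XC def_j; move: a_gt0; case: (a) => // b _; gram. Qed.
Let com_j l : (l < j)%N -> l != a -> com X l j.
Proof. by rewrite XC def_j => ltl nel; gram. Qed.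

Let w := p ++ s.

Let wf_count u : all (fun l => l < j)%N u -> wf u j = - (count_mem a u)%:Z.
Proof.
elim: u => [|l u IHu]; first by rewrite wf_nil.
case/andP=> ltl /IHu; rewrite wf_cons => -> /=; case: eqVneq => [->|ne_la].
  by rewrite gaj PoszD opprD.
by rewrite (eqP (com_j ltl ne_la)) add0r.
Qed.

Let below_w : all (fun l => l < j)%N w.
Proof. by rewrite all_cat def_p def_s !below_up. Qed.

Let count_s : count_mem a s = 1%N.
Proof. by rewrite def_s count_uniq_mem ?iota_uniq // mem_iota; apply/eqP;
  rewrite eqb1 def_j; lia. Qed.

Let count_p : count_mem a p = 1%N.
Proof. by rewrite def_p count_uniq_mem ?iota_uniq // mem_iota; apply/eqP;
  rewrite eqb1 def_j; lia. Qed.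

(* Writing [v = v1 v2], the comparison of [v1 j v2] with [p j s] is settled in
   [v2], unless [s] is a proper suffix of [v2]; then [v1] has no letter [a]. *)
Lemma insertion_bound v1 v2 : wf v1 j != 0 -> perm_eq (v1 ++ v2) w ->
  v1 ++ v2 = w \/ wlt w (v1 ++ v2) ->
  (v1 = p /\ v2 = s) \/ wlt (p ++ j :: s) (v1 ++ j :: v2).
Proof.
move=> wf_v1 pvw le_wv.
have le_rev : rev s ++ rev p = rev v2 ++ rev v1 \/ nlex (rev s ++ rev p) (rev v2 ++ rev v1).
  by rewrite -!rev_cat; case: le_wv => [->|lt_wv]; [left|right].
have below_s : all (fun i => i < j)%N (rev s) by rewrite all_rev def_s below_up.
have [[/(can_inj revK)-> /(can_inj revK)->]|lt_ins|[l [t [eq_v2 le_pt]]]] :=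
  nlex_insert below_s le_rev.
- by left.
- by right; rewrite /wlt (rev_cat p) (rev_cat v1) (rev_cons j s) (rev_cons j v2) 2!cat_rcons.
have below_v : all (fun i => i < j)%N (v1 ++ v2) by rewrite (perm_all _ pvw).
have lv2 : l \in v2 by rewrite -mem_rev eq_v2 mem_cat mem_head orbT.
have ltl : (l < j)%N by apply: (allP below_v); rewrite mem_cat lv2 orbT.
have rev_p : rev p = a :: rev (up a 0).
  by rewrite def_p def_j /up !subn0 -addn1 iotaD rev_cat.
have eq_la : l = a.
  move: le_pt; rewrite rev_p /= => -[[]//|/orP[lt_al|/andP[/eqP//]]].
  by move: ltl; rewrite def_j ltnS leqNgt lt_al.
have cnt2 : (1 < count_mem a v2)%N.
  by rewrite -(count_rev _ v2) eq_v2 count_cat count_rev count_s eq_la /= eqxx.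
have : (count_mem a (v1 ++ v2) = 2)%N.
  by rewrite (permP pvw) count_cat count_p count_s.
rewrite count_cat => cnt; case/negP: wf_v1; rewrite wf_count; last first.
  by move: below_v; rewrite all_cat => /andP[].
by rewrite (_ : count_mem a v1 = 0%N) //; clear -cnt cnt2; lia.
Qed.

Let small_w : small w.
Proof. by apply: sub_all below_w => i lti; apply: ltn_trans ltj. Qed.

Let lt_j_w : small (j :: w).
Proof. by rewrite /= ltj small_w. Qed.

Let phi_neq0 v : phi 1 (wf v j) != 0 -> wf v j != 0.
Proof. by apply: contraNneq => ->; rewrite phi1_0. Qed.

Let perm_insert v1 v2 v : v1 ++ v2 = v -> perm_eq v w -> perm_eq (v1 ++ j :: v2) (p ++ j :: s).
Proof. 
move=> <- /permP pv; apply/permP => b; move: (pv b).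
by rewrite !count_cat /=; lia. Qed.

(** The exponent -2 counts the two letters [a], the only ones that pair with [j]. By
    [insertion_bound] every surviving insertion into [w] or into a larger word gives at least
    [p ++ j :: s], with equality only at the one position in [w]. *)
Lemma leads_insert f : leads w f -> leads (p ++ j :: s) (insert j (-2) f).
Proof.
pose A v := perm_eq v (p ++ j :: s) /\ wlt (p ++ j :: s) v.
have small_perm v : perm_eq v w -> small (j :: v).
  by move=> pv; move: lt_j_w; rewrite /= (perm_all _ pv).
have wf_w v : perm_eq v w -> wf v j = -2.
  move=> pv; rewrite (wf_perm _ pv) (wf_count below_w) count_cat count_p count_s //.
have Dw_gt v : perm_eq v w -> wlt w v -> spanW A (Dw 1 j v).
  move=> pv lt_wv; have [|y Ay] := @Dw_cat 1 j [::] v A (small_perm v pv).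
    move=> s1 i s2 eq_v /phi_neq0; rewrite cat0s => wf0; split.
      exact: (perm_insert (esym eq_v) pv).
    have [||[eq1 eq2]|//] := @insertion_bound _ s2 wf0; rewrite -?eq_v //; first by right.
    by move: lt_wv; rewrite eq_v eq1 eq2 wlt_irr.
  by rewrite cat0s => ->; rewrite Dw_nil phi1_0 scale0r app0 add0r.
have [|y Ay eq_w] := @Dw_cat 1 j p s A lt_j_w.
  move=> s1 i s2 eq_s /phi_neq0 wf0; rewrite catA; split.
    by apply: (@perm_insert _ _ w) => //; rewrite -catA -eq_s.
  have eq_v : (p ++ rcons s1 i) ++ s2 = w by rewrite -catA -eq_s.
  have [||[eq1 _]|//] := @insertion_bound _ s2 wf0; rewrite ?eq_v //; first by left.
  by move/(congr1 size): eq1; rewrite size_cat size_rcons; lia.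
have Dw_p : app s (Dw 1 j p) = phi 1 (- 1) *: wn (p ++ j :: s).
  have p_rcons : p = rcons (up a 0) a by rewrite def_p def_j /up !subn0 -addn1 iotaD cats1.
  have ltp : small p by move: small_w; rewrite all_cat => /andP[].
  rewrite p_rcons Dw1_end ?gaj ?appZ ?app_wn -?p_rcons ?cat_rcons //.
    by move: ltp; rewrite p_rcons all_rcons /= ltj.
  apply/allP => l; rewrite mem_iota => ltl; apply: com_j; first by rewrite def_j; lia.
  by apply/eqP; lia.
case=> c [z [c0 Az ->]]; exists (c * phi 1 (- 1)).
exists (c *: y + insert j (-2) z); split.
- by rewrite mulf_neq0 // (phi1_neq0 0).
- apply: spanW_lin => //; elim: Az => [|b v x [pv lt_wv] _ IHx].
    by rewrite insert0; apply: spanW0.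
  by rewrite insert_lin -{1}(wf_w v pv) insert_wn; apply: spanW_lin => //; apply: Dw_gt.
- rewrite insert_lin -{1}(wf_w w (perm_refl w)) insert_wn /w eq_w Dw_p.
  by rewrite scalerDr scalerA -addrA.
Qed.

(** By the Serre relation two insertions of [j] into [g], whose words have a single letter [a], give
    zero. A second insertion into [sn a g] thus reduces to appending [j] after the first one, and so
    this appended element lies in the subalgebra. *)
Lemma insert2_P g : spanW (fun v => perm_eq (rcons v a) w) g -> P (sn a g) ->
  P (sn j (insert j (-2) (sn a g))).
Proof.
move=> span_g Pf; set f := sn a g.
have lta : (a < r)%N by apply: ltn_trans ltj; rewrite def_j.
have g_u v : perm_eq (rcons v a) w ->
    [/\ all (fun l => l < j)%N v, count_mem a v = 1%N & small (j :: v)].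
  move=> pv; have := below_w; rewrite -(perm_all _ pv) all_rcons => /andP[_ ltv].
  have := permP pv (pred1 a); rewrite count_cat count_p count_s -cats1 count_cat /= eqxx.
  split=> //; first by lia.
  by have := lt_j_w; rewrite /= -(perm_all _ pv) all_rcons => /and3P[-> _ ->].
have span_gw : spanW (fun v => small v /\ wf v j = -1) g.
  apply: spanW_sub span_g => v /g_u[ltv cv]; rewrite (wf_count ltv) cv.
  by case/andP.
have span_f : spanW (fun v => small v /\ wf v j = -2) f.
  apply: spanW_sn; apply: spanW_sub span_gw => v [ltv wfv].
  by rewrite all_rcons ltv lta wf_rcons wfv gaj.
pose h := insert j (-1) g.
have span_h : spanW (fun v => small v /\ wf v j = 1) h.
  rewrite /h; elim: span_g => [|c v x pv _ IHx]; first by rewrite insert0; apply: spanW0.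
  have [ltv cv ltjv] := g_u v pv; have wfv : wf v j = -1 by rewrite (wf_count ltv) cv.
  rewrite insert_lin -{1}wfv insert_wn; apply: spanW_lin => //.
  by apply: spanW_sub (Dw_wf 1 ltjv) => u [-> ->]; rewrite wfv gjj.
have h0 : insert j 1 h = 0.
  rewrite /h; elim: span_g => [|c v x pv _ IHx]; first by rewrite !insert0.
  have [ltv cv ltjv] := g_u v pv; have wfv : wf v j = -1 by rewrite (wf_count ltv) cv.
  rewrite !insert_lin IHx addr0 -{1}wfv insert_wn (insert2_0 ltjv gjj gaj) ?scaler0 //.
  by move=> l /(allP ltv); apply: com_j.
have Tf : insert j (-2) f = sn a h + phi 1 (-2) *: sn j f.
  by rewrite /f insert_sn // gaj.
have TTf : insert j 0 (insert j (-2) f) = phi 1 (-2) *: sn j (insert j (-2) f).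
  rewrite {1}Tf insertD insertZ insert_sn // gaj; last exact: span_h.
  by rewrite h0 sn0 phi1_0 scale0r !add0r insert_sn ?gjj // phi1_0 scale0r addr0.
apply: (in_W_scaled (phi1_neq0 1)); rewrite -TTf.
by do 2!apply: insert_P => //.
Qed.

End SpecialC.

(** * Root words in each type *)

Lemma iota_rcons m n : iota m n.+1 = rcons (iota m n) (m + n)%N.
Proof. by rewrite -addn1 iotaD cats1. Qed.

Lemma up_rcons j k : (j <= k)%N -> rcons (up k j) k = up k.+1 j.
Proof. by move=> le_jk; rewrite /up subSn // -addn1 iotaD cats1 subnKC. Qed.

Lemma gr_succ m : X <> typeD \/ (0 < m)%N -> exists n, gr X m m.+1 = - n.+1%:Z.
Proof.
move=> Xm; rewrite /gr ltn_eqF //; have -> : joined_lt X m m.+1.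
  by case: X Xm => //= -[//|m_gt0]; rewrite m_gt0 eqxx orbT.
have : (0 < maxn (hlen X m) (hlen X m.+1))%N by rewrite leq_max /hlen; case: X => //; case: ifP.
by case: (maxn _ _) => // n _; exists n.
Qed.

Lemma P_up u k n : small u -> (k + n < r)%N -> X <> typeD \/ (0 < k)%N ->
  (forall m, (k < m)%N -> all (fun l => com X l m) u) ->
  P (wn (rcons u k)) -> P (wn (u ++ iota k n.+1)).
Proof.
move=> ltu ltkn Xk ou Pk; elim: n ltkn => [|n IHn] ltkn; first by rewrite cats1.
rewrite iota_rcons -rcons_cat.
have lt_kn : (k + n < r)%N by apply: ltn_trans ltkn; rewrite addnS.
have -> : u ++ iota k n.+1 = rcons (u ++ iota k n) (k + n)%N.
  by rewrite iota_rcons rcons_cat.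
have [n' g] : exists n', gr X (k + n)%N (k + n).+1 = - n'.+1%:Z.
  by apply: gr_succ; case: Xk => [|k_gt0]; [left|right; rewrite addn_gt0 k_gt0].
rewrite addnS; apply: (@in_W_extend _ _ _ n') => //.
- rewrite addnS in ltkn; rewrite /= ltkn lt_kn all_cat ltu /=.
  by apply/allP => l; rewrite mem_iota; lia.
- rewrite all_cat ou /=; last by lia.
  apply/allP => l; rewrite mem_iota => ltl.
  by case: X Xk => -[neq|k_gt0]; solve [gram | by case: neq].
- by rewrite rcons_cat -iota_rcons; apply: IHn.
Qed.

Lemma phi0_neq0 (h : nat) : phi (q ^ (h.+1%:Z + h.+1%:Z)) 0 != 0.
Proof. by rewrite phi_exp0 subr_eq0 eq_sym -PoszD expz_neq1. Qed.

(** After the first neighbour [a] the pairing is [- h], where [phi (q ^ n)] vanishes, and it stays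
    so along [y]; only the two ends are left. *)
Lemma Dw_ends (a b j : nat) y (h : int) (n := h + h) : small [:: j, a, b & y] ->
  gr X a j = - h -> gr X b j = - h -> all (fun l => com X l j) y ->
  wf (rcons (a :: y) b) j = - n /\
  Dw (q ^ n) j (rcons (a :: y) b) =
    phi (q ^ n) 0 *: wn (j :: rcons (a :: y) b)
    + phi (q ^ n) (- n) *: wn (rcons (rcons (a :: y) b) j).
Proof.
case/and4P=> ltj lta ltb lty gaj gbj oy.
have wf_ab : wf (rcons (a :: y) b) j = - n.
  by rewrite wf_rcons wf_cons (wf_orth oy) gaj gbj /n opprD addr0.
split=> //.
have ph : phi (q ^ n) (wf [:: a] j) = 0.
  by rewrite wf_cons wf_nil addr0 gaj /phi opprK /n -expfzDr // addrK subrr.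
rewrite (Dw_rcons _ (u := a :: y)); last by apply/and4P.
rewrite wf_ab; congr (_ + _); rewrite -cat1s Dw_orth //; last first.
  by apply/and3P; split.
rewrite -[[:: a]]/(rcons [::] a) Dw_skip //=; last by rewrite ltj lta.
by rewrite Dw_nil snZ appZ snZ sn_wn app_wn sn_wn.
Qed.

Lemma front_up j k y (h : int) (n := h + h) : (0 < j < k)%N -> (k < r)%N ->
  small y -> gr X j j = n -> gr X j.+1 j = - h -> wf y j = - n ->
  Dw (q ^ n) j y = phi (q ^ n) 0 *: wn (j :: y) + phi (q ^ n) (- n) *: wn (rcons y j) ->
  Dw (q ^ n) j (y ++ up k.+1 j) = phi (q ^ n) 0 *: wn (j :: y ++ up k.+1 j).
Proof.
move=> /andP[j_gt0 lt_jk] ltk lty gjj gij wfy Dy.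
rewrite upS; last by lia.
rewrite upS; last by lia.
apply: (@Dw_front _ _ _ _ n) => //.
- rewrite /= all_cat lty; apply/and4P; split=> //; try lia.
  by apply/allP => l; rewrite mem_iota; lia.
- by rewrite gij /phi opprK /n -expfzDr // addrK subrr.
- apply/allP => l; rewrite mem_iota => ltl.
  by case: X => /=; gram.
Qed.

(** The part up to the second letter [a] has a neighbour of [j] at each end, so [Dw_ends] supplies
    the two terms whose second one cancels against the following [j]. *)
Lemma climb_step lo lo' s m k (h : int) (a := (lo + m)%N) (j := a.+1) (n := h + h) :
  (lo' <= a)%N -> (j < k < r)%N -> all (fun i => i < a)%N s ->
  (forall l, (l < a)%N -> com X l j) ->
  gr X a j = - h -> gr X j j = n -> gr X j.+1 j = - h ->
  Dw (q ^ n) j (climb lo m.+1 (s ++ up k.+1 lo')) =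
    phi (q ^ n) 0 *: wn (climb lo m.+2 (s ++ up k.+1 lo')).
Proof.
move=> le_lo /andP[ltjk ltk] lts oa gaj gjj gij.
set y0 := climb lo m (s ++ up a lo').
have lt_y0 : all (fun i => i < a)%N y0.
  by apply: below_climb; rewrite ?all_cat ?lts ?below_up.
have def_y : rcons (a :: y0) a = climb lo m.+1 (s ++ up j lo').
  by rewrite climbS -up_rcons // /y0 /climb -!rcons_cat.
have -> : climb lo m.+2 (s ++ up k.+1 lo') = j :: climb lo m.+1 (s ++ up k.+1 lo').
  by rewrite climbS addnS.
have -> : climb lo m.+1 (s ++ up k.+1 lo') = (rcons (a :: y0) a) ++ up k.+1 j.
  by rewrite def_y (@up_split k.+1 lo' j) /climb -?catA //; apply/andP; split; lia.
have oy0 : all (fun l => com X l j) y0 by apply/allP => l /(allP lt_y0)/oa.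
have lta : (a < r)%N by apply: ltn_trans ltk; apply: ltnW.
have lt_s : small [:: j, a, a & y0].
  apply/and4P; split=> //; first exact: ltn_trans ltk.
  by apply: sub_all lt_y0 => i lti; apply: ltn_trans lta.
have [wfy Dy] := Dw_ends lt_s gaj gaj oy0.
apply: front_up => //; case/and4P: lt_s => _ _ _ lt_y.
by rewrite all_rcons; apply/and3P.
Qed.

Lemma P_asc j k : (j <= k < r)%N -> X <> typeD \/ (0 < j)%N -> P (wn (up k.+1 j)).
Proof.
move=> /andP[le_jk ltk] Xj; rewrite /up subSn // -[iota _ _]cat0s.
apply: P_up => //; first by rewrite subnKC.
by apply: (sw_P_letter swM); apply: leq_ltn_trans ltk.
Qed.

Lemma P_climbB m k : X = typeB -> (0 < m <= k)%N -> (k < r)%N ->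
  P (wn (climb 0 m (up k.+1 0))).
Proof.
move=> XB + ltk; elim: m => // m IHm lt_mk.
have [m0|m_gt0] := posnP m; last first.
  have lt_mk' : (m.+1 <= k)%N by case/andP: lt_mk.
  case: m m_gt0 IHm lt_mk lt_mk' => // m _ IHm _ lt_mk.
  apply: (in_W_scaled (phi0_neq0 1)).
  rewrite -(@climb_step 0 0 [::] m k 2) //=; try by rewrite XB; gram.
  - by apply: in_W_Dw; [apply: ltn_trans ltk|apply: IHm; apply: ltnW].
  - by rewrite add0n lt_mk.
  - by move=> l ltl; rewrite XB add0n in ltl *; gram.
have k_gt0 : (0 < k)%N by case/andP: lt_mk; case: (k).
have lt1 : (1 < r)%N by apply: leq_ltn_trans ltk.
have lt0 : (0 < r)%N by apply: ltnW.
(* The second 0 is inserted with [c = 1]: the position in front has coefficient 0, and the one after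
   the initial 0 gives the same word with coefficient [phi 1 2]. *)
rewrite m0 climbS climb0 addn0.
have Pu : P (wn (up k.+1 0)) by apply: P_asc; [rewrite ltk|left; rewrite XB].
have ph2 : phi 1 2 != 0 by rewrite -oppr_eq0 -phi1N (phi1_neq0 1).
suff D0 : Dw 1 0 (up k.+1 0) = phi 1 2 *: wn (0%N :: up k.+1 0).
  by apply: (in_W_scaled ph2); rewrite -D0; apply: in_W_Dw.
have -> : up k.+1 0 = [:: 0%N; 1%N] ++ up k.+1 2 by rewrite upS // upS.
have wf01 : wf [:: 0; 1]%N 0 = 0 by rewrite !wf_cons wf_nil XB; gram.
rewrite Dw_orth ?wf01 ?phi1_0 //; last 2 first.
- by apply/and4P; split=> //; apply/allP => l; rewrite mem_iota; lia.
- by apply/allP => l; rewrite mem_iota XB => ltl; gram.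
rewrite -[[:: 0; 1]%N]/(rcons (rcons [::] 0%N) 1%N) Dw_skip /= ?lt1 ?lt0 ?wf01 ?phi1_0 //.
rewrite -[[:: 0%N]]/(rcons [::] 0%N) Dw_rcons /= ?lt0 // Dw_nil phi1_0 scale0r sn0 add0r.
have -> : wf [:: 0%N] 0 = 2 by rewrite wf_cons wf_nil XB; gram.
by rewrite snZ appZ sn_wn app_wn.
Qed.

Lemma P_climbC m k : X = typeC -> (m < k < r)%N -> P (wn (climb 1 m (up k.+1 0))).
Proof.
move=> XC /andP[lt_mk ltk]; elim: m lt_mk => [|m IHm] lt_mk.
  by rewrite climb0; apply: P_asc; [rewrite ltk|left; rewrite XC].
have Pm : P (Dw (q ^ (1 + 1)) m.+1 (climb 1 m (up k.+1 0))).
  by apply: in_W_Dw; [apply: ltn_trans ltk|apply: IHm; apply: ltnW].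
apply: (in_W_scaled (phi0_neq0 0)).
case: m {IHm} lt_mk Pm => [|m] lt_mk Pm; last first.
  rewrite -(@climb_step 1 0 [::] m k 1) //= ?add1n ?lt_mk //; try by rewrite XC; gram.
  by move=> l ltl; rewrite XC; gram.
have lt0 : (0 < r)%N by apply: leq_ltn_trans ltk.
have lt1 : (1 < r)%N by apply: ltn_trans ltk.
(* At the double bond the single letter 0 pairs to -2 with 1 and acts as both end neighbours at
   once. *)
have wf0 : wf [:: 0%N] 1 = -2 by rewrite wf_cons wf_nil XC; gram.
rewrite climbS climb0 addn0.
have up_k : up k.+1 0 = [:: 0%N] ++ up k.+1 1 by rewrite upS.
rewrite up_k -(@front_up 1 k [:: 0%N] 1) ?lt_mk -?up_k ?wf0 //.
- by rewrite /= lt0.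
- by rewrite XC; gram.
- by rewrite XC; gram.
rewrite -[[:: 0%N]]/(rcons [::] 0%N) Dw_rcons /= ?lt0 ?lt1 // Dw_nil snZ sn_wn wf0.
by [].
Qed.

Lemma P_Dw2 c j u v : (j < r)%N -> perm_eq u v -> P (wn u + wn v) ->
  P (Dw c j u + Dw c j v).
Proof.
move=> ltj uv Puv.
have -> : Dw c j u + Dw c j v =
    (wn u + wn v) ** wn [:: j] - (c * q ^ wf u j) *: (wn [:: j] ** (wn u + wn v)).
  have := mulDl 1 (wn u) (wn v) (wn [:: j]); have := mulDr 1 (wn u) (wn v) (wn [:: j]).
  rewrite !scale1r => -> ->; rewrite /Dw (wf_perm _ uv); lincomb M; ring.
have Pj := sw_P_letter swM ltj; rewrite addrC -scaleNr.
by apply: (sw_P_lin swM); apply: (sw_P_mul swM).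
Qed.

Lemma P_forkD k : X = typeD -> (1 < k < r)%N -> P (wn (0%N :: up k.+1 2)).
Proof.
move=> XD /andP[lt1k ltk]; have lt0 : (0 < r)%N by apply: leq_ltn_trans ltk.
have -> : up k.+1 2 = iota 2 (k - 2).+1 by rewrite /up subSn.
rewrite -cat1s; apply: P_up => //; first by rewrite /= lt0.
- by rewrite subnKC.
- by right.
- by move=> l ltl; rewrite /= XD andbT; gram.
apply: (@in_W_extend [::] 0 2 0) => //=.
- by rewrite lt0 (leq_ltn_trans _ ltk).
- by rewrite XD; gram.
- exact: (sw_P_letter swM).
Qed.

(** The letters 0 and 1 are orthogonal, so 1 is inserted before and after 0 with the same
    coefficient. The two words have equal weight and stay together under the later insertions. *)
Lemma P_climbD m k : X = typeD -> (m.+1 < k < r)%N ->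
  P (wn (climb 2 m ([:: 1; 0]%N ++ up k.+1 2)) + wn (climb 2 m ([:: 0; 1]%N ++ up k.+1 2))).
Proof.
move=> XD /andP[lt_mk ltk].
have lt1 : (1 < r)%N by apply: leq_ltn_trans ltk; apply: leq_trans lt_mk.
have lt0 : (0 < r)%N by apply: ltnW.
elim: m lt_mk => [|m IHm] lt_mk.
  have Pu : P (wn (0%N :: up k.+1 2)) by apply: P_forkD; rewrite // lt_mk.
  apply: (in_W_scaled (phi0_neq0 0)).
  suff D0 : Dw (q ^ (1 + 1)) 1 (0%N :: up k.+1 2) = phi (q ^ (1 + 1)) 0 *:
      (wn (climb 2 0 ([:: 1; 0]%N ++ up k.+1 2)) + wn (climb 2 0 ([:: 0; 1]%N ++ up k.+1 2))).
    by rewrite -D0; apply: in_W_Dw.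
  have ltu : small (up k.+1 2) by apply/allP => l; rewrite mem_iota; lia.
  have lt2 : (2 < r)%N by apply: leq_ltn_trans ltk.
  have wf02 : wf [:: 0; 2]%N 1 = -1 by rewrite !wf_cons wf_nil XD; gram.
  have ph : phi (q ^ (1 + 1)) (wf [:: 0; 2]%N 1) = 0.
    by rewrite wf02 /phi opprK -expfzDr // addrK subrr.
  rewrite !climb0 upS //; set t := up k.+1 3.
  have ltt : small t by apply/allP => l; rewrite mem_iota; lia.
  rewrite -[0%N :: 2%N :: t]/([:: 0; 2]%N ++ t) Dw_orth //; last 2 first.
  - by apply/and4P.
  - by apply/allP => l; rewrite mem_iota XD => ltl; gram.
  rewrite -[[:: 0; 2]%N]/(rcons (rcons [::] 0%N) 2%N) Dw_skip //=; last by rewrite lt0 lt1 lt2.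
  rewrite -[[:: 0%N]]/(rcons [::] 0%N) Dw_rcons /= ?lt0 ?lt1 // Dw_nil snZ sn_wn.
  have -> : wf [:: 0%N] 1 = 0 by rewrite wf_cons wf_nil XD; gram.
  by rewrite snD !snZ !sn_wn appD !appZ !app_wn -scalerDr.
have perm01 : perm_eq (climb 2 m ([:: 1; 0]%N ++ up k.+1 2)) (climb 2 m ([:: 0; 1]%N ++ up k.+1 2)).
  by rewrite perm_cat2l; apply/permP => b /=; lia.
have ltm : (m.+2 < r)%N by apply: ltn_trans ltk.
have Pm := P_Dw2 (q ^ (1 + 1)) ltm perm01 (IHm (ltnW lt_mk)).
apply: (in_W_scaled (phi0_neq0 0)); rewrite scalerDr.
case: m {IHm perm01} lt_mk ltm Pm => [|m] lt_mk ltm Pm.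
  have step a b : gr X a 2 = -1 -> gr X b 2 = -1 -> (a < r)%N -> (b < r)%N ->
      Dw (q ^ (1 + 1)) 2 ([:: a; b] ++ up k.+1 2) =
        phi (q ^ (1 + 1)) 0 *: wn (2 :: [:: a; b] ++ up k.+1 2).
    move=> ga gb lta ltb; have [||wf2 D2] := @Dw_ends a b 2 [::] 1 _ ga gb _ => //.
      by rewrite /= ltm lta ltb.
    apply: front_up => //=; first by rewrite ltb lta.
    - by rewrite XD; gram.
    - by rewrite XD; gram.
  move: Pm; rewrite !climb0 !step //; by rewrite XD; gram.
rewrite -!(@climb_step 2 2 _ m k 1) ?add2n ?lt_mk //; try by rewrite XD; gram.
- by move=> l ltl; rewrite XD; gram.
- by move=> l ltl; rewrite XD; gram.
Qed.

Lemma leads_special k : X = typeC -> (0 < k < r)%N ->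
  exists2 f, P f & leads (up k 0 ++ k :: rcons (up k 1) k) f.
Proof.
move=> XC /andP[k_gt0 ltk].
(* [g] lacks the last letter. The induction inserts [k.+1] into [sn k g], and only the result with
   [k.+1] appended is claimed to lie in the subalgebra. *)
suff [g Pg lead_g] : exists2 g, P (sn k g) & leads (up k 0 ++ k :: up k 1) g.
  by exists (sn k g) => //; rewrite -rcons_cons -rcons_cat; apply: leads_sn.
elim: k k_gt0 ltk => // k IHk _ ltk.
have [k0|k_gt0] := posnP k.
  rewrite k0 in ltk *; have lt0 : (0 < r)%N by apply: ltnW.
  have wf0 : wf [:: 0%N] 1 = -2 by rewrite wf_cons wf_nil XC; gram.
  have wf01 : wf [:: 0; 1]%N 1 = 0 by rewrite !wf_cons wf_nil XC; gram.
  have D0 : Dw 1 1 [:: 0%N] = phi 1 (-2) *: wn [:: 0; 1]%N.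
    rewrite -[[:: 0%N]]/(rcons [::] 0%N) Dw_rcons /= ?ltk ?lt0 //.
    by rewrite Dw_nil phi1_0 scale0r sn0 add0r wf0.
  have D1 : Dw 1 1 [:: 0; 1]%N = phi 1 (-2) *: wn [:: 0; 1; 1]%N.
    rewrite -[[:: 0; 1]%N]/(rcons [:: 0%N] 1%N) Dw_rcons /= ?ltk ?lt0 //.
    by rewrite wf01 phi1_0 scale0r addr0 D0 snZ sn_wn.
  have P01 : P (wn [:: 0; 1]%N).
    by apply: (in_W_scaled (phi1_neq0 1)); rewrite -D0; apply: in_W_Dw => //;
      apply: (sw_P_letter swM).
  exists (wn [:: 0; 1]%N); last exact: leads_wn.
  by rewrite sn_wn; apply: (in_W_scaled (phi1_neq0 1)); rewrite -D1; apply: in_W_Dw.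
have [g Pg lead_g] := IHk k_gt0 (ltnW ltk).
have up_S i : (i <= k)%N -> up k.+1 i = rcons (up k i) k by move=> lei; rewrite up_rcons.
have eq_w : up k.+1 0 ++ up k.+1 1 = rcons (up k 0 ++ k :: up k 1) k.
  by rewrite !up_S // cat_rcons rcons_cat.
exists (insert k.+1 (-2) (sn k g)).
  apply: (@insert2_P k k.+1 (up k.+1 0) (up k.+1 1)) => //.
  apply: spanW_sub (leads_span lead_g) => v pv.
  by rewrite eq_w -!cats1 perm_cat2r.
apply: (@leads_insert k) => //; rewrite eq_w; exact: leads_sn.
Qed.

Lemma leads_path k x : pathp X k x -> (k < r)%N -> exists2 f, P f & leads (rcons x k) f.
Proof.
have word_in u : P (wn u) -> exists2 f, P f & leads u f.
  by exists (wn u); rewrite //; apply: leads_wn.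
have asc_in j : (j <= k)%N -> X <> typeD \/ (0 < j)%N -> (k < r)%N ->
    exists2 f, P f & leads (rcons (up k j) k) f.
  by move=> lej Xj ltk; rewrite up_rcons //; apply/word_in/P_asc; rewrite ?lej.
have climb_rcons lo n s : rcons (climb lo n s) k = climb lo n (rcons s k).
  by rewrite /climb rcons_cat.
rewrite /pathp; case E: X asc_in => [] asc_in.
- by case=> j lej -> ltk; apply: asc_in => //; left.
- case=> -[m lem ->] ltk; first by apply: asc_in => //; left.
  by rewrite climb_rcons up_rcons //; apply/word_in/P_climbB.
- case=> -[m lem ->] ltk; first by apply: asc_in => //; left.
  rewrite climb_rcons up_rcons //; apply/word_in/P_climbC => //.
  by rewrite ltk; case/andP: lem => _ ->.
case=> [-> ltk|[j /andP[j_gt0 lej] ->] ltk|[k2 ->] ltk|[m ltm ->] ltk].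
- exact/word_in/(sw_P_letter swM).
- by apply: asc_in => //; right.
- rewrite rcons_cons up_rcons //; apply: word_in.
  by apply: P_forkD; rewrite ?k2.
- rewrite climb_rcons !rcons_cons up_rcons; last by apply: leq_trans ltm.
  set u := [:: 1, 0 & up k.+1 2]%N; set v := [:: 0, 1 & up k.+1 2]%N.
  exists (wn (climb 2 m u) + wn (climb 2 m v)); first by apply: P_climbD => //; rewrite ltm.
  exists 1, (wn (climb 2 m v)); rewrite scale1r oner_eq0; split=> //.
  rewrite -[wn _]scale1r; apply: spanW_wn; split.
    by rewrite perm_cat2l; apply/permP => b /=; lia.
  (* Read from the right, the words first differ where [u] has 0 and [v] has 1. *)
  rewrite /climb -[u]/([:: 1; 0]%N ++ up k.+1 2) -[v]/([:: 0; 1]%N ++ up k.+1 2).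
  by rewrite !catA wlt_cat2r /wlt !rev_cat.
Qed.

End LowerBound.

(** * Conclusion *)

Definition lyndonw (w : seq nat) : Prop :=
  forall u v, u <> [::] -> v <> [::] -> w = u ++ v -> wlt u w.

Definition root_word (X : classical_type) (k : nat) (w : seq nat) : Prop :=
  (exists2 x, pathp X k x & w = rcons x k) \/
  [/\ X = typeC, (0 < k)%N & w = up k 0 ++ k :: rcons (up k 1) k].

Lemma wlt_below k u x : u <> [::] -> all (fun i => i < k)%N u -> wlt u (rcons x k).
Proof.
case/lastP: u => // u i _; rewrite all_rcons => /andP[lti _].
by rewrite /wlt !rev_rcons /= lti.
Qed.

Lemma cat_rconsP (u v x : seq nat) k : v <> [::] -> rcons x k = u ++ v ->
  exists2 v', v = rcons v' k & x = u ++ v'.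
Proof.
case/lastP: v => // v i _; rewrite -rcons_cat => /rcons_inj[-> <-].
by exists v.
Qed.

(** A left factor ending in a letter below [k] is smaller than a word ending in [k]. The only other
    proper left factor is [up k 0] followed by [k] in the exceptional word; there the comparison is
    settled by its first letter 0 against [k]. *)
Lemma root_word_lyndon X k w : root_word X k w -> lyndonw w.
Proof.
case=> [[x /pathp_below below_x ->]|[_ k_gt0 ->]] u v u0 v0.
  case/cat_rconsP=> // v' _ eq_x; apply: wlt_below => //.
  by move: below_x; rewrite eq_x all_cat => /andP[].
rewrite -rcons_cons -rcons_cat => /cat_rconsP[] // v' _ eq_w.
have [le_u|lt_u] := leqP (size u) (size (up k 0)).
  apply: wlt_below => //; apply/allP => i iu; apply: (allP (below_up k 0)).
  have -> : up k 0 = u ++ drop (size u) (up k 0).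
    rewrite -{1}(cat_take_drop (size u) (up k 0)); congr (_ ++ _).
    by rewrite -(takel_cat (k :: up k 1) le_u) eq_w take_size_cat.
  by rewrite mem_cat iu.
have [u' eq_u] : exists u', u = up k 0 ++ k :: u'.
  have eq_ud : u = up k 0 ++ drop (size (up k 0)) u.
    rewrite -{1}(cat_take_drop (size (up k 0)) u); congr (_ ++ _).
    by rewrite -(takel_cat v' (ltnW lt_u)) -eq_w take_size_cat.
  have : drop (size (up k 0)) (u ++ v') = k :: up k 1 by rewrite -eq_w drop_size_cat.
  rewrite drop_cat lt_u; case: (drop _ u) eq_ud => [|i u'].
    by move=> eq_u; move: lt_u; rewrite eq_u cats0 ltnn.
  by move=> -> [-> _]; exists u'.
move: eq_w; rewrite eq_u -catA => /(f_equal (drop (size (up k 0)))).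
rewrite !drop_size_cat // => -[eq_u'].
case/lastP: u' eq_u' eq_u => [|u' i] eq_u' _; last first.
  rewrite -rcons_cons -rcons_cat /wlt !rev_rcons /=.
  by have := below_up k 1; rewrite eq_u' all_cat all_rcons => /andP[/andP[->]].
rewrite cats1 /wlt !rev_rcons /= ltnn eqxx /= rev_cat rev_cons (upS k_gt0) rev_cons.
by rewrite -cats1 cat_rcons nlex_cat2l /= k_gt0.
Qed.

Section RootWords.
Variables (K : fieldType) (q : K) (X : classical_type) (r' : nat).
Local Notation r := r'.+1.
Local Notation F := (freealg K r).
Hypothesis q_neq0 : q != 0.
Hypothesis q_not_root1 : forall n, q ^+ n.+1 != 1.
Local Notation small := (all (fun i => i < r)%N).

Lemma lyndon_letters (w : word r) : lyndon w <-> letters w <> [::] /\ lyndonw (letters w).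
Proof.
split=> [[w0 w_lyn]|[w0 w_lyn]]; split.
- by move=> /(congr1 size)/=; rewrite size_map => /size0nil.
- move=> u v u0 v0 eq_w.
  have eq_w' : (w : seq 'I_r) = take (size u) w ++ drop (size u) w by rewrite cat_take_drop.
  have uE : u = map val (take (size u) (w : seq 'I_r)).
    by rewrite map_take -/(letters w) eq_w take_size_cat.
  have vE : v = map val (drop (size u) (w : seq 'I_r)).
    by rewrite map_drop -/(letters w) eq_w drop_size_cat.
  rewrite {1}uE -word_ltE; apply: w_lyn eq_w' => /(congr1 (map val)).
    by rewrite -uE.
  by rewrite -vE.
- by move=> wE; apply: w0; rewrite /letters wE.
move=> u v u0 v0 eq_w; rewrite word_ltE; apply: (w_lyn _ (map val v)).
- by move=> /(congr1 size)/=; rewrite size_map => /size0nil.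
- by move=> /(congr1 size)/=; rewrite size_map => /size0nil.
- by rewrite /letters eq_w map_cat.
Qed.

Lemma root_word_of_good (w : word r) : good_lyndon q X w ->
  exists2 k, (k < r)%N & root_word X k (letters w).
Proof.
case=> -[f [b [Wf _ [w_f f_min]]]] /lyndon_letters[w0 w_lyn].
have ltk : (last 0%N (letters w) < r)%N.
  have := small_letters w; case/lastP: (letters w) w0 => // s i _.
  by rewrite last_rcons all_rcons => /andP[].
exists (last 0%N (letters w)) => //.
apply: (lyndon_blocks q_neq0 q_not_root1 Wf (small_letters w)) => //.
  by rewrite nword_letters mcoeff_neq0.
move=> u ltu lt_uw; apply/eqP; rewrite mcoeff_eq0; apply: contraTN lt_uw => u_f.
have letters_u := letters_nword ltu.
have [eq_uw|neq_uw] := eqVneq (nword r' u) w.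
  by rewrite -eq_uw letters_u wlt_irr.
have := f_min _ u_f (elimN eqP neq_uw).
rewrite word_ltE -/(letters w) -/(letters (nword r' u)) letters_u => lt_wu.
by apply: contraFN (wlt_irr u) => /wlt_trans; apply.
Qed.

Lemma shuffle_words_F :
  @shuffle_words K q X r F (@in_W K q X r) (qsh q X (r:=r)) (fun s => wd K (map inord s))
    (fun i => snoc (inord i)).
Proof.
split.
- by move=> c x y z; rewrite qshDl qshZl.
- by move=> c x y z; rewrite qshDr qshZr.
- by move=> i; apply: snoc_lin.
- by move=> i s; rewrite snoc_wd map_rcons.
- exact: qsh_nil_l.
- exact: qsh_nil_r.
- move=> u v i j ltui ltj.
  have -> : \sum_(l <- rcons u i) gr X l j = wform X (map inord (rcons u i)) (inord j : 'I_r).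
    rewrite /wform big_map [RHS]big_seq [LHS]big_seq; apply: eq_bigr => l lu.
    by rewrite !inordK ?(allP ltui _ lu).
  by rewrite !map_rcons; apply: qsh_rcons.
- exact: in_W_0.
- by move=> c x y; apply: in_W_lin.
- by move=> i _; rewrite -letter_wd; apply: in_W_letter.
- by move=> x y; apply: in_W_qsh.
Qed.

Let wn (s : seq nat) : F := wd K (map inord s).

Lemma spanW_msupp (A : seq nat -> Prop) (x : F) (u : word r) : spanW wn A x ->
  u \in msupp x -> exists2 v, A v & u = nword r' v.
Proof.
elim=> [|c v y Av _ IHy]; first by rewrite msupp0 inE.
rewrite -mcoeff_neq0 mcoeffD mcoeffZ mcoeff_wd.
have [eq_vu|] := eqVneq (map inord v) (u : seq 'I_r).
  by move=> _; exists v => //; apply/eqP; rewrite fmP /= eq_vu.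
by move=> _; rewrite mulr0 add0r mcoeff_neq0.
Qed.

Lemma good_of_leads (w : seq nat) (x : F) : small w -> in_W q X x -> leads wn w x ->
  good q X (nword r' w).
Proof.
move=> ltw Wx [c [y [c0 Ay def_x]]].
have other u : u \in msupp x -> u <> nword r' w ->
    exists2 v, perm_eq v w /\ wlt w v & u = nword r' v.
  move=> ux neq_u; apply: (spanW_msupp Ay); move: ux.
  rewrite -!mcoeff_neq0 def_x mcoeffD mcoeffZ mcoeff_wd.
  have [eq_wu|_] := eqVneq (map inord w) (u : seq 'I_r); last by rewrite mulr0 add0r.
  by case: neq_u; apply/eqP; rewrite fmP /= eq_wu.
have neq_min v : wlt w v -> small v -> nword r' v <> nword r' w.
  move=> lt_wv ltv /(congr1 (@letters r)).
  by rewrite !letters_nword // => eq_vw; rewrite eq_vw wlt_irr in lt_wv.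
have small_perm v : perm_eq v w -> small v by move=> pv; rewrite (perm_all _ pv).
exists x, (weight (nword r' w)); split=> //.
  move=> u ux; have [->//|neq_u] := eqVneq u (nword r' w).
  have [v [pv _] ->] := other u ux (elimN eqP neq_u).
  by rewrite /weight (perm_big (nword r' w)) //=; apply: perm_map.
split.
  have y_w : y@_(nword r' w) = 0.
    apply/eqP; rewrite mcoeff_eq0; apply/negP => /(spanW_msupp Ay)[v [pv lt_wv] eq_v].
    exact: (neq_min v lt_wv (small_perm v pv)).
  by rewrite -mcoeff_neq0 def_x mcoeffD mcoeffZ y_w mcoeff_wd eqxx mulr1 addr0.
move=> u ux neq_u; have [v [pv lt_wv] ->] := other u ux neq_u.
rewrite word_ltE -/(letters (nword r' w)) -/(letters (nword r' v)).
by rewrite !letters_nword // small_perm.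
Qed.

Lemma good_of_root_word (w : word r) k : (k < r)%N -> root_word X k (letters w) ->
  good_lyndon q X w.
Proof.
move=> ltk wX; split; last first.
  apply/lyndon_letters; split; last exact: root_word_lyndon wX.
  by case: wX => [[x _ ->]|[_ _ ->]]; [case: x|case: (up k 0)].
rewrite -(nword_letters w).
have [x Wx lead_x] : exists2 f, in_W q X f & leads wn (letters w) f.
  case: wX => [[x px ->]|[XC k_gt0 ->]].
    exact: (leads_path q_neq0 q_not_root1 shuffle_words_F px ltk).
  by apply: (leads_special q_neq0 q_not_root1 shuffle_words_F XC); rewrite k_gt0.
exact: good_of_leads (small_letters w) Wx lead_x.
Qed.

Lemma good_lyndonE (w : word r) :
  good_lyndon q X w <-> exists2 k, (k < r)%N & root_word X k (letters w).
Proof.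
split; first exact: root_word_of_good.
by case=> k; apply: good_of_root_word.
Qed.

End RootWords.

Lemma qvar_neq0 : qvar != 0.
Proof. by rewrite /qvar tofrac_eq0 polyX_eq0. Qed.

Lemma qvar_not_root1 n : qvar ^+ n.+1 != 1.
Proof.
rewrite /qvar -tofracXn -tofrac1 tofrac_eq; apply/eqP => /(congr1 (size \o val)) /=.
by rewrite size_polyXn size_poly1.
Qed.

(** * Root words in the notation of the statement *)

Lemma rcons_up j k : (j <= k)%N -> rcons (up k j) k = asc j k.
Proof. exact: up_rcons. Qed.

Lemma rcons_climb lo m k w : rcons (climb lo m w) k = climb lo m (rcons w k).
Proof. by rewrite /climb rcons_cat. Qed.

Lemma climb0_desc m w : climb 0 m.+1 w = desc m 0 ++ w.
Proof. by []. Qed.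

Lemma climb1_desc m w : climb 1 m (0%N :: w) = desc m 0 ++ w.
Proof. by rewrite /climb /desc /asc subn0 /= rev_cons cat_rcons. Qed.

Lemma climb2_desc m w : climb 2 m [:: 1, 0 & w]%N = desc m.+1 0 ++ w.
Proof. by rewrite /climb /desc /asc subn0 /= !rev_cons !cat_rcons. Qed.

Lemma asc_cons i k : (i <= k)%N -> asc i k = i :: asc i.+1 k.
Proof. by move=> le_ik; rewrite /asc subSn // subSS. Qed.

Lemma asc_nn k : asc k k = [:: k].
Proof. by rewrite /asc subSnn. Qed.

Lemma special_word k : (0 < k)%N -> up k 0 ++ k :: rcons (up k 1) k = asc 0 k ++ asc 1 k.
Proof. by move=> k_gt0; rewrite -cat_rcons !rcons_up. Qed.

Theorem proposition5p1p1 :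
  (forall r : nat, (1 <= r)%N -> forall w : word r,
     good_lyndon qvar typeA w <->
     exists i j : nat, (i <= j < r)%N /\ letters w = asc i j) /\
  (forall r : nat, (2 <= r)%N -> forall w : word r,
     good_lyndon qvar typeB w <->
     (exists i j : nat, (i <= j < r)%N /\ letters w = asc i j) \/
     (exists j k : nat, (j < k < r)%N /\ letters w = desc j 0 ++ asc 0 k)) /\
  (forall r : nat, (2 <= r)%N -> forall w : word r,
     good_lyndon qvar typeC w <->
     [\/ exists i j : nat, (i <= j < r)%N /\ letters w = asc i j,
         exists j k : nat,
           [/\ (1 <= j)%N, (j < k)%N, (k <= r - 1)%N & letters w = desc j 0 ++ asc 1 k]
       | exists j : nat, (1 <= j < r)%N /\ letters w = asc 0 j ++ asc 1 j]) /\
  (forall r : nat, (3 <= r)%N -> forall w : word r,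
     good_lyndon qvar typeD w <->
     [\/ letters w = [:: 0%N],
         exists i : nat, (2 <= i < r)%N /\ letters w = 0%N :: asc 2 i,
         exists i j : nat,
           [/\ (1 <= i)%N, (i <= j)%N, (j <= r - 1)%N & letters w = asc i j]
       | exists j k : nat,
           [/\ (1 <= j)%N, (j < k)%N, (k < r)%N & letters w = desc j 0 ++ asc 2 k]]).
Proof.
have goodE X r (w : word r) : (0 < r)%N ->
    good_lyndon qvar X w <-> exists2 k, (k < r)%N & root_word X k (letters w).
  case: r w => // r' w _; exact: (@good_lyndonE ratfun qvar X r' qvar_neq0 qvar_not_root1 w).
split; [|split; [|split]] => r r_gt0 w; have /(goodE _ r w) -> : (0 < r)%N by lia.
- split=> [[k ltk [[_ [j le_jk ->] ->]|[]//]]|[j [k [/andP[le_jk ltk] ->]]]].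
    by exists j, k; rewrite le_jk rcons_up.
  by exists k => //; left; exists (up k j); rewrite ?rcons_up //; exists j.
- split=> [[k ltk [[_ [[j le_jk ->]|[m lem ->]] ->]|[]//]]|].
  + by left; exists j, k; rewrite le_jk rcons_up.
  + right; case: m lem => // m lem; exists m, k.
    by rewrite rcons_climb rcons_up // climb0_desc; split=> //; lia.
  case=> [[j [k [/andP[le_jk ltk] ->]]]|[j [k [/andP[lt_jk ltk] ->]]]]; exists k => //; left.
    by exists (up k j); rewrite ?rcons_up //; left; exists j.
  exists (climb 0 j.+1 (up k 0)); last by rewrite rcons_climb rcons_up.
  by right; exists j.+1.
- split=> [[k ltk [[_ [[j le_jk ->]|[m lem ->]] ->]|[_ k_gt0 ->]]]|].
  + by apply: Or31; exists j, k; rewrite le_jk rcons_up.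
  + apply: Or32; exists m, k.
    rewrite rcons_climb rcons_up // (@asc_cons 0 k) // climb1_desc; split=> //; lia.
  + by apply: Or33; exists k; rewrite special_word // k_gt0.
  case=> [[j [k [/andP[le_jk ltk] ->]]]|[j [k [j_gt0 lt_jk lek ->]]]|[k [/andP[k_gt0 ltk] ->]]].
  + by exists k => //; left; exists (up k j); rewrite ?rcons_up //; left; exists j.
  + exists k; first by lia.
    left; exists (climb 1 j (up k 0)); first by right; exists j; rewrite ?j_gt0.
    by rewrite rcons_climb rcons_up // (@asc_cons 0 k) // climb1_desc.
  + by exists k => //; right; rewrite special_word.
- split=> [[k ltk [[_ [->|[j /andP[j_gt0 le_jk] ->]|[k2 ->]|[m ltm ->]] ->]|[]//]]|].
  (* The empty path gives the one-letter word of [k]; it belongs to the ascending family except for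
     [k = 0], which that family omits. *)
  + have [k0|k_gt0] := posnP k; first by apply: Or41; rewrite k0.
    by apply: Or43; exists k, k; rewrite asc_nn; split=> //; lia.
  + by apply: Or43; exists j, k; rewrite rcons_up //; split=> //; lia.
  + by apply: Or42; exists k; rewrite k2 rcons_cons rcons_up.
  + apply: Or44; exists m.+1, k.
    by rewrite rcons_climb !rcons_cons rcons_up ?climb2_desc //; lia.
  case=> [->|[k [/andP[k2 ltk] ->]]|[j [k [j_gt0 le_jk lek ->]]]|[j [k [j_gt0 lt_jk ltk ->]]]].
  + by exists 0%N; [lia|left; exists [::] => //; apply: Or41].
  + exists k => //; left; exists (0%N :: up k 2); last by rewrite rcons_cons rcons_up.
    by apply: Or43.
  + exists k; first by lia.
    by left; exists (up k j); rewrite ?rcons_up //; apply: Or42; exists j; rewrite ?j_gt0.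
  (* The descent from [j] already includes the letters 1 and 0 of the fork, so [j.-1] letters are
     climbed from 2. *)
  + exists k => //; left; exists (climb 2 j.-1 [:: 1, 0 & up k 2]%N).
      by apply: Or44; exists j.-1; rewrite ?prednK.
    by rewrite rcons_climb !rcons_cons rcons_up ?climb2_desc ?prednK //; lia.
Qed.
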